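(* Let $\mathbb{X}$ be a Polish space and let $c:\mathbb{X}\times\mathbb{X}\to\mathbb{R}$ be a continuous negative definite cost. Fix $\varepsilon>0$. Then there exist a Polish space $\mathcal{Z}$, a probability measure $\lambda\in\mathcal{P}(\mathcal{Z})$ and a measurable function $\rho_\varepsilon:\mathbb{X}\times\mathcal{Z}\to(0,\infty)$ such that for every $x,y\in\mathbb{X}$ $$\exp\Big(-\frac{c(x,y)}{\varepsilon}\Big)=\int_{\mathcal{Z}}\rho_\varepsilon(x,z)\,\rho_\varepsilon(y,z)\,d\lambda(z).$$ For $\tilde\psi(x,z):=-\varepsilon\log\rho_\varepsilon(x,z)$ and $\tilde c_{\varepsilon,\lambda}(x,y):=-\varepsilon\log\int_{\mathcal{Z}}e^{-\frac{\tilde\psi(x,z)+\tilde\psi(y,z)}{\varepsilon}}\,d\lambda(z)$, one then has $c=\tilde c_{\varepsilon,\lambda}$, and hence, for all $\mu,\nu\in\mathcal{P}(\mathbb{X})$, $$\mathrm{OT}^\varepsilon_c(\mu,\nu)=\inf_{\eta\in\mathcal{P}(\mathcal{Z})}\mathrm{OT}^\varepsilon_{\tilde\psi}(\mu,\eta)+\mathrm{OT}^\varepsilon_{\tilde\psi}(\nu,\eta)+\varepsilon\,\mathrm{KL}(\eta|\lambda).$$ An explicit choice is the following: writing $c(x,y)=|\phi(x)-\phi(y)|^2_{H_c}+s(x)+s(y)$ with $H_c$ a separable Hilbert space with countable orthonormal basis $(e_i)_{i\in I}$, $\phi=\sum_{i\in I}\phi_ie_i:\mathbb{X}\to H_c$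 and $s:\mathbb{X}\to\mathbb{R}$, take $\mathcal{Z}=\mathbb{R}^I$, $\lambda=\bigotimes_{i\in I}\mathcal{N}(0,1)$, $$\rho_\varepsilon(x,z)=\exp\Big(\sqrt{\tfrac{2}{\varepsilon}}\sum_{i\in I}\phi_i(x)z_i-\tfrac{2}{\varepsilon}\sum_{i\in I}\phi_i(x)^2-\tfrac{s(x)}{\varepsilon}\Big),\qquad\tilde\psi(x,z)=-\sqrt{2\varepsilon}\sum_{i\in I}\phi_i(x)z_i+2|\phi(x)|^2_{H_c}+s(x),$$ where for each $x$ the series $\sum_{i}\phi_i(x)z_i$ converges for $\lambda$-a.e. $z$.
   Context: A function $c:\mathbb{X}\times\mathbb{X}\to\mathbb{R}$ is negative definite if $c(x,y)=c(y,x)$ and $\sum_{i,j=1}^Na_ia_jc(x_i,x_j)\le0$ for all $N\ge1$, $x_1,\dots,x_N\in\mathbb{X}$ and $a_1,\dots,a_N\in\mathbb{R}$ with $\sum_ia_i=0$. It is classical that this is equivalent to the existence of a Hilbert space $H_c$, a map $\phi:\mathbb{X}\to H_c$ and $s:\mathbb{X}\to\mathbb{R}$ with $c(x,y)=|\phi(x)-\phi(y)|^2_{H_c}+s(x)+s(y)$ (then $s(x)=c(x,x)/2$); for continuous $c$ on a Polish space one may take $H_c$ separable. $\mathcal{P}$: Borel probability measures; $\Pi(\mu,\eta)$: couplings. $\mathrm{KL}(\mu|\nu)=\int\log\frac{d\mu}{d\nu}\,d\mu$ if $\mu\ll\nu$, $+\infty$ otherwise. For measurable $b$ on $\mathbb{X}\times\mathbb{Y}$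 ($\mathbb{Y}=\mathbb{X}$ or $\mathcal{Z}$), $\mathrm{OT}^\varepsilon_b(\mu,\eta)=\inf_{\pi\in\Pi(\mu,\eta)}\int b\,d\pi+\varepsilon\,\mathrm{KL}(\pi|\mu\otimes\eta)$. All integrals and infima in the last formula are assumed well defined in $\mathbb{R}\cup\{+\infty\}$.
   Formalization: The OT identity is stated for μ, ν with OT_c well defined, OT_ψ̃ well defined for all η of finite entropy relative to λ, and ψ̃⁻ integrable under π(dx,dy)e^{(c-ψ̃-ψ̃)/ε}λ(dz) for π of finite cost; for heavy-tailed μ, ν it can fail otherwise. *)

(* Defs.v *)
From HB Require Import structures.
From mathcomp Require Import all_boot all_order all_algebra.
From mathcomp Require Import all_classical all_reals all_analysis.

Set Implicit Arguments.
Unset Strict Implicit.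
Unset Printing Implicit Defensive.

Import Order.TTheory GRing.Theory Num.Theory.
Import numFieldNormedType.Exports.

Local Open Scope classical_set_scope.
Local Open Scope ring_scope.

Definition complete_compatible_metric (R : realType) (T : topologicalType)
    (d : T -> T -> R) : Prop :=
  [/\ forall x y, d x y = 0 <-> x = y,
      forall x y, d x y = d y x,
      forall x y z, d x z <= d x y + d y z,
      forall x (A : set T),
        nbhs x A <-> exists2 r : R, 0 < r & [set y | d x y < r] `<=` A
    & forall u : nat -> T,
        (forall r : R, 0 < r ->
           exists N, forall m n, (N <= m)%N -> (N <= n)%N -> d (u m) (u n) < r) ->
        exists l : T, u @ \oo --> l].

Definition polish (R : realType) (T : topologicalType) : Prop :=
  (exists d : T -> T -> R, complete_compatible_metric d) /\
  (exists2 D : set T, countable D & dense D).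

Notation borel T := (g_sigma_algebraType (@open T)).

Definition negative_definite (R : realType) (X : Type) (c : X -> X -> R) : Prop :=
  (forall x y, c x y = c y x) /\
  (forall (N : nat) (x : 'I_N -> X) (a : 'I_N -> R), (1 <= N)%N ->
     \sum_(i < N) a i = 0 ->
     \sum_(i < N) \sum_(j < N) a i * a j * c (x i) (x j) <= 0).

Definition KL d (T : measurableType d) (R : realType) (P Q : probability T R) :
    \bar R :=
  if pselect (P `<< Q) then
    (\int[P]_t lne (Radon_Nikodym (charge_of_finite_measure P) Q t))%E
  else +oo%E.

Section product_probability.
Local Open Scope ereal_scope.
Context d1 d2 (T1 : measurableType d1) (T2 : measurableType d2) (R : realType).
Variables (P1 : probability T1 R) (P2 : probability T2 R).

Definition product_probability : set (T1 * T2) -> \bar R := P1 \x P2.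

HB.instance Definition _ := Measure.on product_probability.

Let product_probability_setT : product_probability setT = 1.
Proof.
rewrite -setXTT.
have -> : product_probability (setT `*` setT) = P1 setT * P2 setT.
  exact: product_measure1E.
by rewrite !probability_setT mule1.
Qed.

HB.instance Definition _ :=
  Measure_isProbability.Build _ _ _ product_probability product_probability_setT.

End product_probability.

Section entropic_transport.
Context d1 d2 (T1 : measurableType d1) (T2 : measurableType d2) (R : realType).
Variables (eps : R) (mu : probability T1 R) (eta : probability T2 R).
Variable b : T1 -> T2 -> R.

Definition couplings : set (probability (T1 * T2)%type R) :=
  [set pi | (forall A, measurable A -> pi (A `*` setT) = mu A) /\
            (forall B, measurable B -> pi (setT `*` B) = eta B)].

(* The addition is the one with -oo + +oo = +oo: a coupling of infinite
   relative entropy never realises the infimum. *)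
Definition OT_objective (pi : probability (T1 * T2)%type R) : \bar R :=
  ((\int[pi]_p (b p.1 p.2)%:E)%E + (eps%:E * KL pi (product_probability mu eta))%E)%dE.

Definition OT : \bar R := ereal_inf [set OT_objective pi | pi in couplings].

(* OT takes its value in R `|` {+oo} and, for every coupling of finite entropy,
   so does the integral of b (i.e. the negative part of b is integrable). *)
Definition OT_well_defined : Prop :=
  (forall pi, couplings pi -> (KL pi (product_probability mu eta) < +oo)%E ->
     (\int[pi]_p (Num.max (- b p.1 p.2) 0)%:E < +oo)%E) /\
  (-oo < OT)%E.

End entropic_transport.

Section latent_cost.
Context (R : realType) (X Z : ptopologicalType).
Variables (c : X -> X -> R) (eps : R).
Variables (lambda : probability (borel Z) R) (rho : X -> Z -> R).

Definition psi_of (x : X) (z : Z) : R := - (eps * ln (rho x z)).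

Definition induced_cost (psi : X -> Z -> R) (x y : X) : \bar R :=
  (- (eps%:E *
      lne (\int[lambda]_z (expR (- ((psi x z + psi y z) / eps)))%:E)))%E.

(* Density, with respect to lambda, of the conditional law of z given (x, y)
   which attains the infimum defining the induced cost at (x, y). *)
Definition gibbs_density (psi : X -> Z -> R) (x y : X) (z : Z) : R :=
  expR ((c x y - psi x z - psi y z) / eps).

(* Well-definedness in R `|` {+oo} of the terms of the decomposition formula.
   It cannot be asked for all eta: as psi x is in general unbounded below, its
   integral is undefined or -oo for some heavy-tailed eta.  It is asked when
   KL(eta|lambda) < +oo, and for the integrals of psi against the (x, z) and
   (y, z) marginals of pi(dx dy) gibbs_density(x, y, z) lambda(dz), where pi is
   a coupling of mu and nu of finite cost.  The latter cannot be dropped: for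
   c x y = (x - y)^2 on the line, gaussian_rho below and mu = nu without second
   moment, the left hand side of the decomposition may be finite while no eta
   with KL(eta|lambda) < +oo gives a finite value on the right hand side. *)
Definition decomposition_well_defined (mu nu : probability (borel X) R) : Prop :=
  [/\ OT_well_defined eps mu nu c,
      forall eta : probability (borel Z) R, (KL eta lambda < +oo)%E ->
        OT_well_defined eps mu eta psi_of /\ OT_well_defined eps nu eta psi_of
    & forall pi, couplings mu nu pi -> (OT_objective eps mu nu c pi < +oo)%E ->
        (\int[pi]_p \int[lambda]_z
           (Num.max (- psi_of p.1 z) 0 * gibbs_density psi_of p.1 p.2 z)%:E
         < +oo)%E /\
        (\int[pi]_p \int[lambda]_z
           (Num.max (- psi_of p.2 z) 0 * gibbs_density psi_of p.1 p.2 z)%:E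
         < +oo)%E].

(* As in OT_objective, -oo + +oo = +oo. *)
Definition latent_OT (mu nu : probability (borel X) R) : \bar R :=
  ereal_inf
    [set (OT eps mu eta psi_of + OT eps nu eta psi_of +
          (eps%:E * KL eta lambda)%E)%dE
    | eta in [set: probability (borel Z) R]].

Definition latent_representation : Prop :=
  [/\ forall x z, 0 < rho x z,
      measurable_fun setT (fun p : (borel X * borel Z)%type => rho p.1 p.2),
      forall x y, (expR (- (c x y / eps)))%:E =
        (\int[lambda]_z (rho x z * rho y z)%:E)%E,
      forall x y, (c x y)%:E = induced_cost psi_of x y
    & forall mu nu : probability (borel X) R,
        decomposition_well_defined mu nu ->
        OT eps mu nu c = latent_OT mu nu].

End latent_cost.

Definition inner_product (R : realType) (H : normedModType R)
    (ip : H -> H -> R) : Prop :=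
  [/\ forall u v, ip u v = ip v u,
      forall (a : R) u v w, ip (a *: u + v) w = a * ip u w + ip v w
    & forall u, ip u u = `|u| ^+ 2].

Section countable_sums.
Context (I : countType).

(* Partial sums along the enumeration of I given by its countType structure;
   an element of I occurs exactly once in it, and indices coding no element of
   I contribute 0.  The value of csum is irrelevant when the limit does not
   exist. *)
Definition psum (V : zmodType) (F : I -> V) (n : nat) : V :=
  \sum_(0 <= k < n) oapp F 0 (@pickle_inv I k).

Definition csum (R : realType) (F : I -> R) : R := limn (psum F).

End countable_sums.

Definition orthonormal_basis (R : realType) (H : normedModType R)
    (ip : H -> H -> R) (I : countType) (e : I -> H) : Prop :=
  (forall i j, ip (e i) (e j) = (i == j)%:R) /\
  (forall h, psum (fun i => ip h (e i) *: e i) @ \oo --> h).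

Section real_product.
Context (R : realType) (I : countType).

Definition pointwise_reals := {ptws I -> R}.

HB.instance Definition _ := Topological.on pointwise_reals.
HB.instance Definition _ := isPointed.Build pointwise_reals (fun=> 0).

Definition real_product : ptopologicalType := pointwise_reals.

End real_product.

Definition standard_gaussian_product (R : realType) (I : countType)
    (lambda : probability (borel (real_product R I)) R) : Prop :=
  forall (J : seq I) (A : I -> set R), uniq J -> (forall i, measurable (A i)) ->
    lambda [set z | forall i, i \in J -> A i (z i)] =
    (\prod_(i <- J) normal_prob 0 1 (A i))%E.

Section gaussian_choice.
Context (R : realType) (X : Type) (I : countType) (H : normedModType R).
Variables (ip : H -> H -> R) (e : I -> H) (phi : X -> H) (s : X -> R) (eps : R).

Definition basis_coord (i : I) (x : X) : R := ip (phi x) (e i).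

Definition gaussian_rho (x : X) (z : real_product R I) : R :=
  expR (Num.sqrt (2 / eps) * csum (fun i => basis_coord i x * z i)
        - 2 / eps * csum (fun i => basis_coord i x ^+ 2) - s x / eps).

Definition gaussian_psi (x : X) (z : real_product R I) : R :=
  - (Num.sqrt (2 * eps) * csum (fun i => basis_coord i x * z i))
  + 2 * `|phi x| ^+ 2 + s x.

End gaussian_choice.

(* Main.v *)
(** Normalise the representation as [|phi x - phi y|^2 = c x y - s x - s y] and
    let [xi_i] be independent standard normal variables.  The Gaussian moment
    generating function gives
    [E exp (sqrt (2 / eps) sum_i (phi_i x + phi_i y) xi_i)
       = exp (|phi x + phi y|^2 / eps)],
    and [|u + v|^2 = 2 |u|^2 + 2 |v|^2 - |u - v|^2] turns this into the factorised
    kernel.  Without a Hilbert space at hand, the coordinates [phi_n] come from a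
    Cholesky elimination of the positive kernel of [c] along a dense sequence: the
    residual kernel vanishes on the points already eliminated, hence tends to [0]
    everywhere by continuity.

    The sequence [xi] lives on [[0, 1]] with the Lebesgue measure: the binary
    digits of even and of odd rank of a uniform point give two independent uniform
    points, one is sent to a normal variable by the quantile function and the
    other one is split again.

    For the decomposition formula, disintegrate: a coupling [pi] of [mu] and [nu]
    is completed by the Gibbs kernel into a plan on [X * X * Z], and conversely
    couplings of [(mu, eta)] and [(nu, eta)] are glued along [Z]; each inequality
    is Jensen's inequality for the ratio between the plan and the product of
    the densities appearing on the other side. *)

Require Import Defs.
From HB Require Import structures.
From mathcomp Require Import all_boot all_order all_algebra.
From mathcomp Require Import all_classical all_reals all_analysis.
From mathcomp Require Import measurable_realfun.
From mathcomp Require Import ring lra.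

Set Implicit Arguments.
Unset Strict Implicit.
Unset Printing Implicit Defensive.

Import Order.TTheory GRing.Theory Num.Theory.
Import numFieldNormedType.Exports.

Local Open Scope classical_set_scope.
Local Open Scope ring_scope.

(** * Densities and relative entropy *)

(** The obstacle in the decomposition formula is integrability: [psi] and the logarithms of the
    densities are unbounded in both directions, so an entropy inequality cannot be expanded term by
    term. Two facts remove it. If P has density f, the P-mean of 1/f is at most 1, hence the
    negative part of ln f is always integrable. And Jensen's inequality is used as L <= exp L - 1
    for a combination L of such logarithms and costs: it bounds the mean of L and also makes the
    positive part of L integrable. Solving the definition of L for one term then sandwiches that
    term between integrable functions; the well-definedness hypotheses supply the negative parts of
    the costs.

    For the digits, uniformity and independence are read off a functional equation: the difference
    between the actual and the expected distribution function reproduces itself at scale 2 with a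
    factor at most 1/2, so it vanishes. The Gaussian series needs almost sure convergence, since
    [csum] is a limit taken pointwise in z and is additive where the series converge. *)

Lemma measurable_lne (R : realType) : measurable_fun [set: \bar R] (@lne R).
Proof.
have -> : @lne R = fun x => if (x <= 0)%E then -oo%E else
    if x == +oo%E then +oo%E else (ln (fine x))%:E.
  apply/funext => -[r| |] /=.
  - by rewrite lee_fin.
  - by [].
  - by rewrite leNye.
apply: (@measurable_fun_ifT _ _ (\bar R) (\bar R)).
- by apply: measurable_fun_lee => //; exact: measurable_cst.
- exact: measurable_cst.
- apply: (@measurable_fun_ifT _ _ (\bar R) (\bar R)).
  + by apply: measurable_fun_eqe => //; exact: measurable_cst.
  + exact: measurable_cst.
  + by apply/measurable_EFinP/measurableT_comp => //; exact: measurable_ln.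
Qed.

Section density.
Local Open Scope ereal_scope.
Context d (T : measurableType d) (R : realType).

(** The change of variables is the definition because every density below is used in that form;
    [density_of_measurable_sets] recovers it from the values on measurable sets. The density is a
    real function, so that [ln (f t)] is one too. *)
Definition has_density (P Q : {measure set T -> \bar R}) (f : T -> R) : Prop :=
  [/\ measurable_fun setT f, forall t, (0 <= f t)%R &
      forall F : T -> \bar R, measurable_fun setT F -> (forall t, 0 <= F t) ->
        \int[P]_t F t = \int[Q]_t (F t * (f t)%:E)].

Lemma has_density_exists (P Q : probability T R) :
  P `<< Q -> exists f, has_density P Q f.
Proof.
move=> PQ; pose g := Radon_Nikodym_SigmaFinite.f P Q.
have g0 t : 0 <= g t by exact: Radon_Nikodym_SigmaFinite.f_ge0.
have gfin t : g t \is a fin_num by exact: Radon_Nikodym_SigmaFinite.f_fin_num.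
have mg : measurable_fun setT g.
  exact: measurable_int (Radon_Nikodym_SigmaFinite.f_integrable PQ).
exists (fine \o g); split.
- exact: measurableT_comp.
- by move=> t; rewrite fine_ge0.
- move=> F mF F0.
  rewrite -(Radon_Nikodym_SigmaFinite.change_of_variables PQ F0)//.
  by apply: eq_integral => t _ /=; rewrite fineK.
Qed.

Lemma density_measurable_cond {P Q : {measure set T -> \bar R}} {f : T -> R} :
  has_density P Q f -> forall A, measurable A -> P A = \int[Q]_(t in A) (f t)%:E.
Proof.
move=> [mf f0 fE] A mA.
rewrite -[LHS]mul1e -(integral_cst P mA) integral_mkcond fE; last 2 first.
- by apply/(measurable_restrictT _ mA); exact: measurable_cst.
- by move=> t; rewrite patchE; case: ifP.
rewrite [RHS]integral_mkcond; apply: eq_integral => t _.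
by rewrite !patchE; case: ifP => _; rewrite ?mul1e ?mul0e.
Qed.

Lemma density_integral1 (P Q : probability T R) f :
  has_density P Q f -> \int[Q]_t (f t)%:E = 1.
Proof.
move=> Pf; rewrite -(density_measurable_cond Pf measurableT).
exact: probability_setT.
Qed.

Lemma density_dominates (P Q : probability T R) f :
  has_density P Q f -> P `<< Q.
Proof.
move=> Pf; apply/null_content_dominatesP => A mA QA.
rewrite (density_measurable_cond Pf)//; case: Pf => mf _ _.
by apply: null_set_integral => //; exact/measurable_EFinP/measurable_funTS.
Qed.

(** The zero set of [f] may charge [Q] but is [P]-null; this is what allows [lnK] under [P]. *)
Lemma density_gt0 (P Q : probability T R) f :
  has_density P Q f -> {ae P, forall t, (0 < f t)%R}.
Proof.
move=> Pf; have [mf f0 _] := Pf.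
have mf0 : measurable (f @^-1` [set 0%R]) by rewrite -[X in measurable X]setTI; exact: mf.
exists (f @^-1` [set 0%R]); split => //.
- by rewrite (density_measurable_cond Pf)//; apply: integral0_eq => t /= ->.
- by move=> t /= /negP; rewrite -leNgt => ft; apply/eqP; rewrite eq_le ft f0.
Qed.

Lemma KL_density (P Q : probability T R) f : has_density P Q f ->
  KL P Q = \int[P]_t (ln (f t))%:E.
Proof.
move=> Pf; have PQ := density_dominates Pf.
rewrite /KL; case: pselect => // PQ'.
set g := Radon_Nikodym _ _.
have [mf f0 _] := Pf.
have intf : Q.-integrable setT (EFin \o f).
  apply/integrableP; split; first exact/measurable_EFinP.
  under eq_integral do rewrite gee0_abs ?lee_fin//.
  by rewrite (density_integral1 Pf) ltry.
have intg : Q.-integrable setT g by exact: Radon_Nikodym_integrable.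
have gf : ae_eq Q setT g (EFin \o f).
  apply: integral_ae_eq => //; first exact: measurable_int intf.
  move=> A _ mA; rewrite -Radon_Nikodym_integral//.
  exact: (density_measurable_cond Pf).
have gfP : ae_eq P setT g (EFin \o f).
  exact: null_dominates_ae_eq PQ _.
apply: ae_eq_integral => //.
- by apply: (measurableT_comp (@measurable_lne R)); exact: measurable_int intg.
- by apply/measurable_EFinP/measurableT_comp.
(* At a zero of [f] the integrands differ, [lne 0] being [-oo] and [ln 0] being [0]; positivity
   [P]-a.e. discards such points. *)
- have := density_gt0 Pf; move: gfP; apply: filterS2 => t gft ft _.
  by rewrite gft//; exact: lne_EFin.
Qed.

End density.

Lemma density_of_measurable_sets d (T : measurableType d) (R : realType)
    (P : probability T R) (Q : {sigma_finite_measure set T -> \bar R})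
    (f : T -> R) :
  measurable_fun setT f -> (forall t, (0 <= f t)%R) ->
  (forall A, measurable A -> P A = (\int[Q]_(t in A) (f t)%:E)%E) ->
  has_density P Q f.
Proof.
move=> mf f0 Pf.
have mfE : measurable_fun setT (EFin \o f) by exact/measurable_EFinP.
have PQ : P `<< Q.
  apply/null_content_dominatesP => A mA QA; rewrite Pf//.
  by apply: null_set_integral => //; exact: measurable_funTS.
have intg := Radon_Nikodym_SigmaFinite.f_integrable PQ.
have g0 := Radon_Nikodym_SigmaFinite.f_ge0 PQ.
have fg : ae_eq Q setT (Radon_Nikodym_SigmaFinite.f P Q) (EFin \o f).
  apply: integral_ae_eq => // A _ mA.
  by rewrite -Radon_Nikodym_SigmaFinite.f_integral//; exact: Pf.
split => // F mF F0.
rewrite -(Radon_Nikodym_SigmaFinite.change_of_variables PQ F0)//.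
apply: ge0_ae_eq_integral => //.
- by apply: emeasurable_funM => //; exact: measurable_int intg.
- exact: emeasurable_funM.
- by move=> t _; rewrite mule_ge0.
- by move=> t _; rewrite mule_ge0// lee_fin.
- exact: ae_eqe_mul2l.
Qed.

Lemma probability_of_density d (T : measurableType d) (R : realType)
    (Q : {sigma_finite_measure set T -> \bar R}) (f : T -> R) :
  measurable_fun setT f -> (forall t, (0 <= f t)%R) ->
  (\int[Q]_t (f t)%:E)%E = 1%E ->
  exists P : probability T R, has_density P Q f.
Proof.
move=> mf f0 f1.
have mfE : measurable_fun setT (EFin \o f) by exact/measurable_EFinP.
pose m A := (\int[Q]_(t in A) (f t)%:E)%E.
have m0 : m set0 = 0%E by rewrite /m integral_set0.
have mge0 A : (0 <= m A)%E by apply: integral_ge0 => t _; rewrite lee_fin.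
have msa : semi_sigma_additive m.
  move=> A mA tA mUA; rewrite /m ge0_integral_bigcup//=.
  - apply: is_cvg_ereal_nneg_natsum_cond => n _ _; exact: mge0.
  - exact: measurable_funTS.
  - by move=> t _; rewrite lee_fin.
have mT : m setT = 1%E by [].
pose mM := isMeasure.Build _ _ _ m m0 mge0 msa.
pose M : {measure set T -> \bar R} := HB.pack m mM.
pose mP := Measure_isProbability.Build _ _ _ M mT.
pose P : probability T R := HB.pack m mM mP.
by exists P; apply: density_of_measurable_sets.
Qed.

Lemma pushforward_probability d d' (T : measurableType d)
    (T' : measurableType d') (R : realType) (P : probability T R)
    (phi : T -> T') : measurable_fun setT phi ->
  exists P' : probability T' R,
    [/\ forall A, measurable A -> P' A = P (phi @^-1` A),
        forall F : T' -> \bar R, measurable_fun setT F ->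
          (forall t, (0 <= F t)%E) ->
          (\int[P']_t F t = \int[P]_t F (phi t))%E &
        forall F : T' -> \bar R, measurable_fun setT F ->
          P.-integrable setT (F \o phi) ->
          P'.-integrable setT F /\
          (\int[P']_t F t = \int[P]_t F (phi t))%E].
Proof.
move=> mphi.
pose f : {mfun T >-> T'} := HB.pack phi (isMeasurableFun.Build _ _ _ _ _ mphi).
exists (distribution P f); split => //.
- by move=> F mF F0; rewrite ge0_integral_distribution.
- move=> F mF iF; split; first exact: integrable_pushforward.
  by rewrite integral_distribution.
Qed.

Section product_density.
Local Open Scope ereal_scope.
Context d1 d2 (T1 : measurableType d1) (T2 : measurableType d2) (R : realType).

Lemma density_fst (P1 Q1 : probability T1 R) (P2 : probability T2 R) f :
  has_density P1 Q1 f ->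
  has_density (product_probability P1 P2) (product_probability Q1 P2)
    (f \o fst).
Proof.
move=> [mf f0 Pf]; split; first exact: measurableT_comp.
  by move=> t /=.
move=> F mF F0.
have mfE : measurable_fun setT (fun p : T1 * T2 => (f p.1)%:E).
  by apply/measurable_EFinP; exact: measurableT_comp.
have f0' t : 0 <= (f t)%:E by rewrite lee_fin.
rewrite [LHS]fubini_tonelli1// [RHS]fubini_tonelli1//=; last 2 first.
- exact: emeasurable_funM.
- by move=> t; rewrite mule_ge0.
rewrite Pf.
- apply: eq_integral => x _; rewrite /fubini_F /= ge0_integralZr//.
  by apply: measurableT_comp => //.
- exact: measurable_fun_fubini_tonelli_F.
- by move=> x; apply: integral_ge0.
Qed.

Lemma density_snd (P1 : probability T1 R) (P2 Q2 : probability T2 R) f :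
  has_density P2 Q2 f ->
  has_density (product_probability P1 P2) (product_probability P1 Q2)
    (f \o snd).
Proof.
move=> [mf f0 Pf]; split; first exact: measurableT_comp.
  by move=> t /=.
move=> F mF F0.
have mfE : measurable_fun setT (fun p : T1 * T2 => (f p.2)%:E).
  by apply/measurable_EFinP; exact: measurableT_comp.
have f0' t : 0 <= (f t)%:E by rewrite lee_fin.
rewrite [LHS]fubini_tonelli1// [RHS]fubini_tonelli1//=; last 2 first.
- exact: emeasurable_funM.
- by move=> t; rewrite mule_ge0.
apply: eq_integral => x _; rewrite /fubini_F /= Pf//.
by apply: measurableT_comp.
Qed.

End product_density.

Lemma integral1 d (T : measurableType d) (R : realType)
  (P : probability T R) : (\int[P]_t 1 = 1)%E.
Proof. by rewrite integral_cst// mul1e; exact: probability_setT. Qed.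

(** * Jensen's inequality for the exponential, and the integrability it provides *)

Section exponential_moment.
Local Open Scope ereal_scope.
Context d (T : measurableType d) (R : realType) (P : probability T R).
Variable L : T -> R.
Hypotheses (mL : measurable_fun setT L) (expL : \int[P]_t (expR (L t))%:E <= 1).

Let integrable_expL : P.-integrable setT (fun t => (expR (L t))%:E).
Proof.
apply/integrableP; split; first by apply/measurable_EFinP; exact: measurableT_comp.
under eq_integral do rewrite gee0_abs ?lee_fin ?expR_ge0//.
by rewrite (le_lt_trans expL) ?ltry.
Qed.

(** The positive part of [L] is dominated by [expR L]; the negative part may still be
    non-integrable. *)
Lemma expR_moment_integrable_max :
  P.-integrable setT (fun t => (Num.max (L t) 0)%:E).
Proof.
apply: le_integrable integrable_expL => //.
- by apply/measurable_EFinP; exact: measurable_maxr.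
- move=> t _; rewrite /= lee_fin !ger0_norm ?expR_ge0 ?le_max ?lexx ?orbT//.
  by rewrite ge_max expR_ge0 andbT (le_trans _ (expR_ge1Dx _))// lerDr.
Qed.

(** Tangent line of the exponential at 0: [1 + x <= expR x]. *)
Lemma expR_moment_integral_le0 :
  P.-integrable setT (EFin \o L) -> \int[P]_t (L t)%:E <= 0.
Proof.
move=> iL.
have i1 : P.-integrable setT (cst 1) by exact: finite_measure_integrable_cst.
apply: (@le_trans _ _ (\int[P]_t ((expR (L t))%:E - 1))).
  apply: le_integral => //; first exact: integrableB.
  by move=> t _; rewrite -EFinB lee_fin lerBrDl expR_ge1Dx.
by rewrite integralB// integral1 sube_le0.
Qed.

End exponential_moment.

Lemma integrable_sandwich d (T : measurableType d) (R : realType)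
    (P : {measure set T -> \bar R}) (l f u : T -> R) :
  measurable_fun setT f ->
  P.-integrable setT (EFin \o l) -> P.-integrable setT (EFin \o u) ->
  (forall t, l t <= f t <= u t) -> P.-integrable setT (EFin \o f).
Proof.
move=> mf il iu lfu.
have := integrableD measurableT (integrable_abse il) (integrable_abse iu).
apply: le_integrable => //; first exact/measurable_EFinP.
move=> t _ /=; rewrite lee_fin [leRHS]ger0_norm ?addr_ge0//.
have /andP[lf fu] := lfu t.
have l1 := ler_norm (- l t); have u1 := ler_norm (u t).
have l2 := normr_ge0 (l t); have u2 := normr_ge0 (u t).
by rewrite normrN in l1; rewrite ler_norml; apply/andP; split; lra.
Qed.

Lemma integral_product_mul d1 d2 (T1 : measurableType d1)
    (T2 : measurableType d2) (R : realType) (P1 : probability T1 R)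
    (P2 : probability T2 R) (F : T1 -> \bar R) (G : T2 -> \bar R) :
  measurable_fun setT F -> measurable_fun setT G ->
  (forall t, (0 <= F t)%E) -> (forall t, (0 <= G t)%E) ->
  (\int[product_probability P1 P2]_p (F p.1 * G p.2) =
   \int[P1]_t F t * \int[P2]_t G t)%E.
Proof.
move=> mF mG F0 G0.
rewrite [LHS]fubini_tonelli1//=; last 2 first.
- by apply: emeasurable_funM; exact: measurableT_comp.
- by move=> t; rewrite mule_ge0.
rewrite -ge0_integralZr//; last by apply: integral_ge0.
by apply: eq_integral => x _; rewrite /fubini_F /= ge0_integralZl.
Qed.

Section coupling_marginals.
Local Open Scope ereal_scope.
Context d1 d2 (T1 : measurableType d1) (T2 : measurableType d2) (R : realType).
Variables (mu : probability T1 R) (eta : probability T2 R).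
Variable pi : probability (T1 * T2)%type R.
Hypothesis pic : couplings mu eta pi.

Lemma coupling_integral_fst (F : T1 -> \bar R) :
  measurable_fun setT F -> (forall t, 0 <= F t) ->
  \int[pi]_p F p.1 = \int[mu]_t F t.
Proof.
move=> mF F0.
have [P' [P'E P'F _]] := @pushforward_probability _ _ _ _ _ pi fst (@measurable_fst _ _ T1 T2).
rewrite -P'F//; apply: eq_measure_integral => A mA _.
have [pic1 _] := pic; apply: (etrans (P'E _ mA)); apply: etrans (pic1 _ mA).
by congr (pi _); apply/seteqP; split => -[x y]/=; [|case].
Qed.

Lemma coupling_integral_snd (F : T2 -> \bar R) :
  measurable_fun setT F -> (forall t, 0 <= F t) ->
  \int[pi]_p F p.2 = \int[eta]_t F t.
Proof.
move=> mF F0.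
have [P' [P'E P'F _]] := @pushforward_probability _ _ _ _ _ pi snd (@measurable_snd _ _ T1 T2).
rewrite -P'F//; apply: eq_measure_integral => A mA _.
have [_ pic2] := pic; apply: (etrans (P'E _ mA)); apply: etrans (pic2 _ mA).
by congr (pi _); apply/seteqP; split => -[x y]/=; [|case].
Qed.

(** Integrated over any [E], both sides give [eta E], by the second marginal of [pi]. This
    normalisation is what makes the glued plan have the right marginals. *)
Lemma coupling_density_marginal f :
  has_density pi (product_probability mu eta) f ->
  ae_eq eta setT (fun z => \int[mu]_x (f (x, z))%:E) (cst 1).
Proof.
move=> [mf f0 fE].
have mfE : measurable_fun setT (EFin \o f) by exact/measurable_EFinP.
have f0' t : 0 <= (EFin \o f) t by rewrite /= lee_fin.
apply: ae_eq_sym; apply: integral_ae_eq => //.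
- exact: finite_measure_integrable_cst.
- exact: (measurable_fun_fubini_tonelli_G (m1 := mu) (EFin \o f)).
- move=> E _ mE; rewrite integral_cst// mul1e.
  have mI : measurable_fun setT (EFin \o \1_E : T2 -> \bar R).
    exact/measurable_EFinP/measurable_indic.
  have I0 t : 0 <= (EFin \o \1_E : T2 -> \bar R) t by rewrite /= lee_fin.
  transitivity (\int[eta]_t (EFin \o \1_E) t).
    by rewrite integral_indic// setIT.
  rewrite -coupling_integral_snd// fE//; last first.
    by apply: (measurableT_comp mI); exact: measurable_snd.
  rewrite [LHS]fubini_tonelli2//=; last 2 first.
  + apply: emeasurable_funM => //.
    by apply: (measurableT_comp mI); exact: measurable_snd.
  + by move=> t; rewrite mule_ge0// ?lee_fin.
  rewrite [RHS]integral_mkcond; apply: eq_integral => z _.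
  rewrite /fubini_G patchE /= indicE; case: (z \in E).
  + by under eq_integral do rewrite mul1e.
  + by under eq_integral do rewrite mul0e; rewrite integral0.
Qed.

End coupling_marginals.

(** * Gluing of two couplings along a common marginal *)

Section gluing.
Local Open Scope ereal_scope.
Context dX dY dZ (X : measurableType dX) (Y : measurableType dY)
  (Z : measurableType dZ) (R : realType).
Variables (mu : probability X R) (nu : probability Y R) (eta : probability Z R).
Variables (pi1 : probability (X * Z)%type R) (pi2 : probability (Y * Z)%type R).
Hypotheses (pi1c : couplings mu eta pi1) (pi2c : couplings nu eta pi2).
Variables (f1 : X * Z -> R) (f2 : Y * Z -> R).
Hypotheses (pi1f : has_density pi1 (product_probability mu eta) f1)
  (pi2f : has_density pi2 (product_probability nu eta) f2).

Let base := product_probability (product_probability mu nu) eta.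

Let integral_glue (F1 : X * Z -> \bar R) (F2 : Y * Z -> \bar R) :
  measurable_fun setT F1 -> measurable_fun setT F2 ->
  (forall t, 0 <= F1 t) -> (forall t, 0 <= F2 t) ->
  \int[base]_t (F1 (t.1.1, t.2) * F2 (t.1.2, t.2)) =
  \int[eta]_z (\int[mu]_x F1 (x, z) * \int[nu]_y F2 (y, z)).
Proof.
move=> mF1 mF2 F10 F20.
rewrite [LHS]fubini_tonelli2//=; last 2 first.
- apply: emeasurable_funM; apply: measurableT_comp => //;
    by apply: measurable_fun_pair => //; exact: measurableT_comp.
- by move=> t; rewrite mule_ge0.
apply: eq_integral => z _; rewrite /fubini_G/=.
by apply: (@integral_product_mul _ _ _ _ _ mu nu (fun x => F1 (x, z))
  (fun y => F2 (y, z))) => //; exact: measurable_fun_pair1.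
Qed.

(** In the glued plan [x] and [y] are independent given [z], hence the density
    [f1 (x, z) * f2 (y, z)]. Integrating [y] out leaves a factor 1 for [eta]-almost every [z]. *)
Lemma integral_glue1 (F : X * Z -> \bar R) :
  measurable_fun setT F -> (forall t, 0 <= F t) ->
  \int[base]_t (F (t.1.1, t.2) * (f1 (t.1.1, t.2) * f2 (t.1.2, t.2))%:E) =
  \int[pi1]_t F t.
Proof.
move=> mF F0; have [mf1 f10 f1E] := pi1f; have [mf2 f20 _] := pi2f.
under eq_integral do rewrite EFinM muleA.
have mf1E : measurable_fun setT (EFin \o f1) by exact/measurable_EFinP.
have mf2E : measurable_fun setT (EFin \o f2) by exact/measurable_EFinP.
have mFf : measurable_fun setT (fun t => F t * (f1 t)%:E).
  exact: emeasurable_funM.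
have Ff0 t : 0 <= F t * (f1 t)%:E by rewrite mule_ge0// lee_fin.
have f20' t : 0 <= (EFin \o f2) t by rewrite lee_fin.
rewrite (@integral_glue (fun t => F t * (f1 t)%:E) (EFin \o f2))// f1E//.
rewrite [RHS]fubini_tonelli2//.
apply: ge0_ae_eq_integral => //.
- apply: emeasurable_funM.
  + exact: (measurable_fun_fubini_tonelli_G (m1 := mu) (fun t => F t * (f1 t)%:E)).
  + exact: (measurable_fun_fubini_tonelli_G (m1 := nu) (EFin \o f2)).
- exact: measurable_fun_fubini_tonelli_G.
- by move=> z _; rewrite mule_ge0//; apply: integral_ge0 => t _ //; exact: f20'.
- by move=> z _; apply: integral_ge0 => t _ //.
- have := coupling_density_marginal pi2c pi2f; apply: filterS => z + _.
  by move=> /(_ I) /= ->; rewrite mule1.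
Qed.

Lemma integral_glue2 (F : Y * Z -> \bar R) :
  measurable_fun setT F -> (forall t, 0 <= F t) ->
  \int[base]_t (F (t.1.2, t.2) * (f1 (t.1.1, t.2) * f2 (t.1.2, t.2))%:E) =
  \int[pi2]_t F t.
Proof.
move=> mF F0; have [mf1 f10 _] := pi1f; have [mf2 f20 f2E] := pi2f.
under eq_integral do rewrite EFinM muleCA.
have mf1E : measurable_fun setT (EFin \o f1) by exact/measurable_EFinP.
have mf2E : measurable_fun setT (EFin \o f2) by exact/measurable_EFinP.
have mFf : measurable_fun setT (fun t => F t * (f2 t)%:E).
  exact: emeasurable_funM.
have Ff0 t : 0 <= F t * (f2 t)%:E by rewrite mule_ge0// lee_fin.
have f10' t : 0 <= (EFin \o f1) t by rewrite lee_fin.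
rewrite (@integral_glue (EFin \o f1) (fun t => F t * (f2 t)%:E))// f2E//.
rewrite [RHS]fubini_tonelli2//.
apply: ge0_ae_eq_integral => //.
- apply: emeasurable_funM.
  + exact: (measurable_fun_fubini_tonelli_G (m1 := mu) (EFin \o f1)).
  + exact: (measurable_fun_fubini_tonelli_G (m1 := nu) (fun t => F t * (f2 t)%:E)).
- exact: measurable_fun_fubini_tonelli_G.
- by move=> z _; rewrite mule_ge0//; apply: integral_ge0 => t _ //; exact: f10'.
- by move=> z _; apply: integral_ge0 => t _ //.
- have := coupling_density_marginal pi1c pi1f; apply: filterS => z + _.
  by move=> /(_ I) /= ->; rewrite mul1e.
Qed.

Lemma integral_glue_density :
  \int[base]_t (f1 (t.1.1, t.2) * f2 (t.1.2, t.2))%:E = 1.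
Proof.
rewrite -(integral1 pi1) -(@integral_glue1 (cst 1))//.
by apply: eq_integral => t _; rewrite /= mul1e.
Qed.

End gluing.

Section objective.
Local Open Scope ereal_scope.
Context d1 d2 (T1 : measurableType d1) (T2 : measurableType d2) (R : realType).
Variables (eps : R) (mu : probability T1 R) (eta : probability T2 R).
Variables (b : T1 -> T2 -> R) (pi : probability (T1 * T2)%type R).
Hypothesis eps0 : (0 < eps)%R.

Lemma KL_lty_dominates d (T : measurableType d) (P Q : probability T R) :
  KL P Q < +oo -> P `<< Q.
Proof. by rewrite /KL; case: pselect. Qed.

(** In the addition where [+oo] absorbs [-oo], a sum below [+oo] has both terms below [+oo];
    otherwise an infinite entropy could hide behind a cost integral equal to [-oo]. *)
Lemma OT_objective_lty : OT_objective eps mu eta b pi < +oo ->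
  \int[pi]_p (b p.1 p.2)%:E < +oo /\
  KL pi (product_probability mu eta) < +oo.
Proof.
rewrite /OT_objective; set x := (\int[pi]_p _); set k := KL _ _ => xk.
split; rewrite ltey; apply/eqP.
- by move=> xE; move: xk; rewrite xE; case: (_ * _).
- move=> kE; move: xk; rewrite kE gt0_muley ?lte_fin//.
  by case: x.
Qed.

End objective.

Lemma integrable_of_max d (T : measurableType d) (R : realType)
    (P : {measure set T -> \bar R}) (f : T -> R) :
  measurable_fun setT f ->
  P.-integrable setT (fun t => (Num.max (- f t) 0)%:E) ->
  (\int[P]_t (f t)%:E < +oo)%E ->
  P.-integrable setT (EFin \o f).
Proof.
move=> mf iN fy.
have mfE : measurable_fun setT (EFin \o f) by exact/measurable_EFinP.
have fnE : (EFin \o f)^\-%E = fun t => (Num.max (- f t) 0)%:E.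
  by apply/funext => t; rewrite funenegE /= -EFin_max.
have ip : P.-integrable setT ((EFin \o f)^\+)%E.
  apply/integrableP; split; first exact: measurable_funepos.
  under eq_integral do rewrite gee0_abs//.
  rewrite ltey; apply/eqP => py; move: fy.
  rewrite integralE py fnE.
  have /fineK <- := integrable_fin_num measurableT iN.
  by rewrite addye.
rewrite (funeposneg (EFin \o f)) fnE; exact: integrableB.
Qed.

Lemma integrable_EFinD d (T : measurableType d) (R : realType)
    (P : {measure set T -> \bar R}) (f g : T -> R) :
  P.-integrable setT (EFin \o f) -> P.-integrable setT (EFin \o g) ->
  P.-integrable setT (EFin \o (fun t => f t + g t)).
Proof. by move=> fi gi; exact: (integrableD measurableT fi gi). Qed.

Lemma integrable_EFinZ d (T : measurableType d) (R : realType)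
    (P : {measure set T -> \bar R}) (k : R) (f : T -> R) :
  P.-integrable setT (EFin \o f) ->
  P.-integrable setT (EFin \o (fun t => k * f t)).
Proof. by move=> fi; exact: (integrableZl measurableT k fi). Qed.

Lemma integrable_EFinN d (T : measurableType d) (R : realType)
    (P : {measure set T -> \bar R}) (f : T -> R) :
  P.-integrable setT (EFin \o f) ->
  P.-integrable setT (EFin \o (fun t => - f t)).
Proof. by move=> fi; exact: (integrableN fi). Qed.

Lemma ge0_integrable d (T : measurableType d) (R : realType)
    (P : {measure set T -> \bar R}) (f : T -> R) :
  measurable_fun setT f -> (forall t, 0 <= f t) ->
  (\int[P]_t (f t)%:E < +oo)%E -> P.-integrable setT (EFin \o f).
Proof.
move=> mf f0 fy; apply/integrableP; split; first exact/measurable_EFinP.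
by under eq_integral do rewrite gee0_abs ?lee_fin//.
Qed.

Lemma EFin_Rintegral d (T : measurableType d) (R : realType)
    (P : {measure set T -> \bar R}) (f : T -> R) :
  P.-integrable setT (EFin \o f) ->
  (\int[P]_t (f t)%:E)%E = (\int[P]_t f t)%:E.
Proof. by move=> fi; rewrite fineK//; exact: integrable_fin_num. Qed.

(** The [P]-mean of [1 / f] is the [Q]-measure of the set where [f] is positive; at the zeros of [f]
    the default [ln 0 = 0] is harmless because the factor [f] vanishes. With
    [expR_moment_integrable_max], the negative part of [ln f] is [P]-integrable, so relative
    entropies are well-defined integrals. *)
Lemma density_expRN_ln d (T : measurableType d) (R : realType)
    (P Q : probability T R) f :
  has_density P Q f -> (\int[P]_t (expR (- ln (f t)))%:E <= 1)%E.
Proof.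
move=> [mf f0 fE]; rewrite fE; last 2 first.
- by apply/measurable_EFinP; apply: measurableT_comp => //;
    apply: measurable_funN; exact: measurableT_comp.
- by move=> t; rewrite lee_fin expR_ge0.
rewrite -(integral1 Q); apply: ge0_le_integral => //.
- by move=> t _; rewrite mule_ge0 ?lee_fin ?expR_ge0.
- apply: emeasurable_funM; apply/measurable_EFinP => //.
  by apply: measurableT_comp => //; apply: measurable_funN; exact: measurableT_comp.
- move=> t _; rewrite -EFinM lee_fin.
  have := f0 t; rewrite le_eqVlt => /predU1P[<-|ft]; first by rewrite mulr0.
  by rewrite expRN lnK ?posrE// mulVf// gt_eqF.
Qed.

Section objective_of_density.
Local Open Scope ereal_scope.
Context d1 d2 (T1 : measurableType d1) (T2 : measurableType d2) (R : realType).
Variables (eps : R) (mu : probability T1 R) (eta : probability T2 R).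
Variables (b : T1 -> T2 -> R) (pi : probability (T1 * T2)%type R).
Hypotheses (eps0 : (0 < eps)%R)
  (mb : measurable_fun setT (fun p : T1 * T2 => b p.1 p.2)).

Lemma OT_objective_density f :
  has_density pi (product_probability mu eta) f ->
  pi.-integrable setT (fun p => (b p.1 p.2)%:E) ->
  pi.-integrable setT (fun p => (ln (f p))%:E) ->
  OT_objective eps mu eta b pi =
  (\int[pi]_p b p.1 p.2 + eps * \int[pi]_p ln (f p))%:E.
Proof.
move=> pif ib il; rewrite /OT_objective (KL_density pif).
rewrite (EFin_Rintegral (f := fun p => b p.1 p.2))//.
by rewrite (EFin_Rintegral (f := fun p => ln (f p))).
Qed.

Lemma OT_objective_integrable :
  OT_objective eps mu eta b pi < +oo ->
  \int[pi]_p (Num.max (- b p.1 p.2) 0)%:E < +oo ->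
  exists f, [/\ has_density pi (product_probability mu eta) f,
    pi.-integrable setT (fun p => (b p.1 p.2)%:E) &
    pi.-integrable setT (fun p => (ln (f p))%:E)].
Proof.
move=> /(OT_objective_lty eps0)[by_ ky] bN.
have [f pif] := has_density_exists (KL_lty_dominates ky).
exists f; split => //.
- apply: integrable_of_max => //.
  apply: (ge0_integrable (f := fun p => Num.max (- b p.1 p.2) 0)%R) => //.
  + by apply: measurable_maxr => //; exact: measurable_funN.
  + by move=> t; rewrite le_max lexx orbT.
- have mln : measurable_fun setT (fun p => ln (f p)).
    by case: pif => mf _ _; exact: measurableT_comp.
  apply: integrable_of_max => //; last by rewrite -(KL_density pif).
  by apply: expR_moment_integrable_max; [exact: measurable_funN|
    exact: density_expRN_ln pif].
Qed.

End objective_of_density.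

Section image_measure.
Local Open Scope ereal_scope.
Context d d' (T : measurableType d) (T' : measurableType d') (R : realType).
Variables (P : probability T R) (phi : T -> T') (P' : probability T' R).
Hypothesis mphi : measurable_fun setT phi.

Definition is_image := forall A, measurable A -> P' A = P (phi @^-1` A).

Lemma is_imageP : is_image <->
  forall F : T' -> \bar R, measurable_fun setT F -> (forall t, 0 <= F t) ->
    \int[P']_t F t = \int[P]_t F (phi t).
Proof.
have [Q [QE QF _]] := pushforward_probability P mphi; split.
- move=> im F mF F0; rewrite -QF//; apply: eq_measure_integral => A mA _.
  by apply: (etrans (im _ mA)); apply/esym; exact: QE.
- move=> imF A mA.
  have mI : measurable_fun setT (EFin \o \1_A : T' -> \bar R).
    exact/measurable_EFinP/measurable_indic.
  have mpA : measurable (phi @^-1` A) by rewrite -[X in measurable X]setTI; exact: mphi.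
  transitivity (\int[P']_t (EFin \o \1_A) t).
    by rewrite integral_indic// setIT.
  rewrite imF//; last by move=> t; rewrite lee_fin.
  rewrite (_ : (fun t => _) = EFin \o \1_(phi @^-1` A))//.
  by rewrite integral_indic// setIT.
Qed.

Hypothesis im : is_image.

Lemma image_ae (A : set T') : {ae P', forall t, A t} -> {ae P, forall t, A (phi t)}.
Proof.
move=> [N [mN N0 AN]]; exists (phi @^-1` N); split.
- by rewrite -[X in measurable X]setTI; exact: mphi.
- by rewrite -[RHS]N0; apply/esym; exact: im.
- by move=> t /= At; exact: AN.
Qed.

Lemma image_integrable (f : T' -> R) : measurable_fun setT f ->
  P'.-integrable setT (EFin \o f) <-> P.-integrable setT (fun t => (f (phi t))%:E).
Proof.
move=> mf.
have E : \int[P']_t `|(f t)%:E| = \int[P]_t `|(f (phi t))%:E|.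
  move/is_imageP : im => imF.
  apply: (imF (fun t => `|(f t)%:E|)) => //.
  by apply: measurableT_comp => //; exact/measurable_EFinP.
split=> /integrableP[m fy]; apply/integrableP; split.
- by apply/measurable_EFinP; exact: measurableT_comp.
- by rewrite -E.
- exact/measurable_EFinP.
- by rewrite E.
Qed.

Lemma image_Rintegral (f : T' -> R) : measurable_fun setT f ->
  P.-integrable setT (fun t => (f (phi t))%:E) ->
  (\int[P']_t f t = \int[P]_t f (phi t))%R.
Proof.
move=> mf fi; rewrite /Rintegral; congr fine.
have [Q [QE _ QF]] := pushforward_probability P mphi.
have [|_ <-] := QF (EFin \o f) _ fi; first exact/measurable_EFinP.
by apply: eq_measure_integral => A mA _; rewrite [LHS]im//; exact/esym/QE.
Qed.

End image_measure.

Lemma image_exists d d' (T : measurableType d) (T' : measurableType d')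
    (R : realType) (P : probability T R) (phi : T -> T') :
  measurable_fun setT phi -> exists P', is_image P phi P'.
Proof.
by move=> /(pushforward_probability P)[P' [? _ _]]; exists P'.
Qed.

Lemma expRN_ln_mul_le1 (R : realType) (f : R) :
  0 <= f -> 0 <= expR (- ln f) * f <= 1.
Proof.
move=> f0; rewrite mulr_ge0 ?expR_ge0//=.
move: f0; rewrite le_eqVlt => /predU1P[<-|ft]; first by rewrite mulr0.
by rewrite expRN lnK ?posrE// mulVf// gt_eqF.
Qed.

Lemma density_expRN d (T : measurableType d) (R : realType)
    (P Q : {measure set T -> \bar R}) (L : T -> R) :
  has_density P Q (fun t => expR (L t)) -> measurable_fun setT L ->
  has_density Q P (fun t => expR (- L t)).
Proof.
move=> [_ _ PE] mL.
have mN : measurable_fun setT (fun t => expR (- L t)).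
  by apply: measurableT_comp => //; exact: measurable_funN.
split => // F mF F0; rewrite PE; last 2 first.
- by apply: emeasurable_funM => //; exact/measurable_EFinP.
- by move=> t; rewrite mule_ge0// lee_fin expR_ge0.
apply: eq_integral => t _.
by rewrite -muleA -EFinM -expRD addNr expR0 mule1.
Qed.

(** * The decomposition formula *)

Section gibbs_plans.
Local Open Scope ereal_scope.
Context dX dY dZ (X : measurableType dX) (Y : measurableType dY)
  (Z : measurableType dZ) (R : realType).
Variables (eps : R) (c : X -> Y -> R) (psi1 : X -> Z -> R) (psi2 : Y -> Z -> R).
Variables (mu : probability X R) (nu : probability Y R) (lambda : probability Z R).
Hypotheses (eps0 : (0 < eps)%R)
  (mc : measurable_fun setT (fun p : X * Y => c p.1 p.2))
  (mpsi1 : measurable_fun setT (fun p : X * Z => psi1 p.1 p.2))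
  (mpsi2 : measurable_fun setT (fun p : Y * Z => psi2 p.1 p.2)).

Let T := ((X * Y) * Z)%type.
Let pxz (t : T) := (t.1.1, t.2).
Let pyz (t : T) := (t.1.2, t.2).
(** Logarithm of the Gibbs density; [gibbs1] below makes it a probability kernel from [X * Y] to
    [Z]. *)
Let lg (t : T) : R := ((c t.1.1 t.1.2 - psi1 t.1.1 t.2 - psi2 t.1.2 t.2) / eps)%R.

Hypothesis gibbs1 : forall x y, \int[lambda]_z (expR (lg (x, y, z)))%:E = 1.

Let mpxz : measurable_fun setT pxz.
Proof. by apply: measurable_fun_pair => //; exact: measurableT_comp. Qed.

Let mpyz : measurable_fun setT pyz.
Proof. by apply: measurable_fun_pair => //; exact: measurableT_comp. Qed.

Let mlg : measurable_fun setT lg.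
Proof.
apply: measurable_funM => //; apply: measurable_funB; first apply: measurable_funB.
- exact: (measurableT_comp mc (@measurable_fst _ _ (X * Y)%type Z)).
- exact: (measurableT_comp mpsi1 mpxz).
- exact: (measurableT_comp mpsi2 mpyz).
Qed.

Let mG : measurable_fun setT (fun t : T => expR (lg t)).
Proof. exact: measurableT_comp. Qed.

Section gibbs_plan.
Variable pi : probability (X * Y)%type R.
Hypothesis pic : couplings mu nu pi.

Lemma integral_gibbs_fst (F : X * Y -> \bar R) :
  measurable_fun setT F -> (forall t, 0 <= F t) ->
  \int[product_probability pi lambda]_t (F t.1 * (expR (lg t))%:E) =
  \int[pi]_t F t.
Proof.
move=> mF F0; rewrite [LHS]fubini_tonelli1//=; last 2 first.
- apply: emeasurable_funM; last exact/measurable_EFinP.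
  exact: (measurableT_comp mF (@measurable_fst _ _ (X * Y)%type Z)).
- by move=> t; rewrite mule_ge0// lee_fin expR_ge0.
apply: eq_integral => -[x y] _; rewrite /fubini_F /= ge0_integralZl//.
- by rewrite gibbs1 mule1.
- by apply/measurable_EFinP; exact: (measurable_fun_pair2 (x, y) mG).
Qed.

Lemma gibbs_plan_exists : exists gam : probability T R,
  has_density gam (product_probability pi lambda) (fun t => expR (lg t)) /\
  is_image gam fst pi.
Proof.
have [||gam gamg] := @probability_of_density _ _ _
    (product_probability pi lambda) (fun t => expR (lg t)) mG.
- by move=> t; rewrite expR_ge0.
- rewrite -(integral1 pi) -(@integral_gibbs_fst (cst 1))//.
  by apply: eq_integral => t _; rewrite mul1e.
exists gam; split => //; apply/(is_imageP _ _ (@measurable_fst _ _ (X * Y)%type Z)).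
move=> F mF F0; have [_ _ ->] := gamg; last 2 first.
- exact: (measurableT_comp mF (@measurable_fst _ _ (X * Y)%type Z)).
- by move=> t; exact: F0.
by rewrite integral_gibbs_fst.
Qed.

Lemma gibbs_plan_couplings (gam : probability T R) (eta : probability Z R)
    (pi1 : probability (X * Z)%type R) (pi2 : probability (Y * Z)%type R) :
  is_image gam fst pi -> is_image gam snd eta ->
  is_image gam pxz pi1 -> is_image gam pyz pi2 ->
  couplings mu eta pi1 /\ couplings nu eta pi2.
Proof.
move=> ipi ieta ipi1 ipi2; have [pic1 pic2] := pic; split; split => A mA.
- rewrite ipi1; last exact: measurableX.
  rewrite -pic1// ipi; last exact: measurableX.
  by congr (gam _); apply/seteqP; split => -[[x y] z].
- rewrite ipi1; last exact: measurableX.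
  rewrite ieta//.
  by congr (gam _); apply/seteqP; split => -[[x y] z] //= [].
- rewrite ipi2; last exact: measurableX.
  rewrite -pic2// ipi; last exact: measurableX.
  by congr (gam _); apply/seteqP; split => -[[x y] z] /= [].
- rewrite ipi2; last exact: measurableX.
  rewrite ieta//.
  by congr (gam _); apply/seteqP; split => -[[x y] z] //= [].
Qed.

(** The Gibbs density is positive, so [gam] and the product of [pi] and [lambda] are equivalent, and
    hence so are [eta] and [lambda]. The image of the product on [X * Z] is [mu] times [lambda],
    which is dominated by [mu] times [eta]. *)
Lemma gibbs_plan_dominates (gam : probability T R) (eta : probability Z R)
    (pi1 : probability (X * Z)%type R) (pi2 : probability (Y * Z)%type R) :
  has_density gam (product_probability pi lambda) (fun t => expR (lg t)) ->
  is_image gam snd eta -> is_image gam pxz pi1 -> is_image gam pyz pi2 ->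
  [/\ eta `<< lambda, pi1 `<< product_probability mu eta &
      pi2 `<< product_probability nu eta].
Proof.
move=> gamg ieta ipi1 ipi2.
have gdom : gam `<< product_probability pi lambda by exact: density_dominates gamg.
have domg : product_probability pi lambda `<< gam.
  exact: density_dominates (density_expRN gamg mlg).
have snd0 B : measurable B ->
    product_probability pi lambda (snd @^-1` B) = lambda B.
  move=> mB; rewrite -[RHS]mul1e -(probability_setT pi).
  rewrite -product_measure1E//.
  by congr (product_probability _ _ _); apply/seteqP; split => -[x y] //= [].
have msnd B : measurable B -> measurable (@snd (X * Y)%type Z @^-1` B).
  by move=> mB; rewrite -[X in measurable X]setTI; exact: measurable_snd.
have lambdaeta : lambda `<< eta.
  apply/null_content_dominatesP => B mB eB; rewrite -[LHS]snd0//.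
  move/null_content_dominatesP : domg; apply; first exact: msnd.
  by rewrite -[RHS]eB; apply/esym; exact: ieta.
have [k lk] := has_density_exists lambdaeta.
split.
- apply/null_content_dominatesP => B mB lB; rewrite [LHS]ieta//.
  move/null_content_dominatesP : gdom; apply; first exact: msnd.
  by rewrite [LHS]snd0.
- apply/null_content_dominatesP => A mA A0; rewrite [LHS]ipi1//.
  have mA' : measurable (pxz @^-1` A).
    by rewrite -[X in measurable X]setTI; exact: mpxz.
  move/null_content_dominatesP : gdom; apply => //.
  have /null_content_dominatesP := density_dominates (density_snd mu lk).
  move=> /(_ _ mA A0) <-.
  suff : is_image (product_probability pi lambda) pxz (product_probability mu lambda).
    by move=> im; rewrite [RHS]im.
  apply/is_imageP => // F mF F0; rewrite [LHS]fubini_tonelli1//.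
  rewrite [RHS]fubini_tonelli1//; last exact: (measurableT_comp mF mpxz).
  rewrite -(coupling_integral_fst pic (F := fubini_F lambda F))//.
  + exact: measurable_fun_fubini_tonelli_F.
  + by move=> x; apply: integral_ge0.
- apply/null_content_dominatesP => A mA A0; rewrite [LHS]ipi2//.
  have mA' : measurable (pyz @^-1` A).
    by rewrite -[X in measurable X]setTI; exact: mpyz.
  move/null_content_dominatesP : gdom; apply => //.
  have /null_content_dominatesP := density_dominates (density_snd nu lk).
  move=> /(_ _ mA A0) <-.
  suff : is_image (product_probability pi lambda) pyz (product_probability nu lambda).
    by move=> im; rewrite [RHS]im.
  apply/is_imageP => // F mF F0; rewrite [LHS]fubini_tonelli1//.
  rewrite [RHS]fubini_tonelli1//; last exact: (measurableT_comp mF mpyz).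
  rewrite -(coupling_integral_snd pic (F := fubini_F lambda F))//.
  + exact: measurable_fun_fubini_tonelli_F.
  + by move=> x; apply: integral_ge0.
Qed.

(** The witness [eta] is the law of [z] under the Gibbs plan [gam]. The images [pi1] and [pi2] of
    [gam] are only shown to be admissible, which is enough to bound [OT] from above. *)
Lemma gibbs_plan_optimal :
  OT_objective eps mu nu c pi < +oo ->
  \int[pi]_p (Num.max (- c p.1 p.2) 0)%:E < +oo ->
  \int[pi]_p \int[lambda]_z
    (Num.max (- psi1 p.1 z) 0 * expR (lg (p.1, p.2, z)))%:E < +oo ->
  \int[pi]_p \int[lambda]_z
    (Num.max (- psi2 p.2 z) 0 * expR (lg (p.1, p.2, z)))%:E < +oo ->
  exists eta : probability Z R,
    (OT eps mu eta psi1 + OT eps nu eta psi2 + (eps%:E * KL eta lambda)%E)%dE <=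
    OT_objective eps mu nu c pi.
Proof.
move=> Hobj cN N1 N2.
have [p [pip ic ia]] := OT_objective_integrable eps0 mc Hobj cN.
have [gam [gamg ipi]] := gibbs_plan_exists.
have mfst := @measurable_fst _ _ (X * Y)%type Z.
have msnd := @measurable_snd _ _ (X * Y)%type Z.
have [eta ieta] := image_exists gam msnd.
have [pi1 ipi1] := image_exists gam mpxz.
have [pi2 ipi2] := image_exists gam mpyz.
have [c1 c2] := gibbs_plan_couplings ipi ieta ipi1 ipi2.
have [de d1 d2] := gibbs_plan_dominates gamg ieta ipi1 ipi2.
have [h eh] := has_density_exists de.
have [f1 pf1] := has_density_exists d1.
have [f2 pf2] := has_density_exists d2.
exists eta.
have [mp p0 _] := pip; have [mh h0 _] := eh.
have [mf1 f10 _] := pf1; have [mf2 f20 _] := pf2.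
pose a t := ln (p t); pose b1 t := ln (f1 t); pose b2 t := ln (f2 t).
pose bh t := ln (h t).
have ma : measurable_fun setT a by exact: measurableT_comp.
have mb1 : measurable_fun setT b1 by exact: measurableT_comp.
have mb2 : measurable_fun setT b2 by exact: measurableT_comp.
have mbh : measurable_fun setT bh by exact: measurableT_comp.
pose I (f : T -> R) := gam.-integrable setT (EFin \o f).
have Ic : I (fun t => c t.1.1 t.1.2) by exact: (image_integrable mfst ipi mc).1 ic.
have Ia : I (fun t => a t.1) by exact: (image_integrable mfst ipi ma).1 ia.
have In1 : I (fun t => (Num.max (- psi1 t.1.1 t.2) 0)%R).
  have mn : measurable_fun setT (fun t : T => (Num.max (- psi1 t.1.1 t.2) 0)%R).
    apply: measurable_maxr => //; apply: measurable_funN.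
    exact: (measurableT_comp mpsi1 mpxz).
  apply: ge0_integrable => //; first by move=> t; rewrite le_max lexx orbT.
  have [_ _ ->] := gamg; last 2 first.
  - exact/measurable_EFinP.
  - by move=> t; rewrite lee_fin le_max lexx orbT.
  rewrite [ltLHS]fubini_tonelli1//.
  - apply: emeasurable_funM; exact/measurable_EFinP.
  - by move=> t; rewrite mule_ge0// lee_fin ?expR_ge0// le_max lexx orbT.
have In2 : I (fun t => (Num.max (- psi2 t.1.2 t.2) 0)%R).
  have mn : measurable_fun setT (fun t : T => (Num.max (- psi2 t.1.2 t.2) 0)%R).
    apply: measurable_maxr => //; apply: measurable_funN.
    exact: (measurableT_comp mpsi2 mpyz).
  apply: ge0_integrable => //; first by move=> t; rewrite le_max lexx orbT.
  have [_ _ ->] := gamg; last 2 first.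
  - exact/measurable_EFinP.
  - by move=> t; rewrite lee_fin le_max lexx orbT.
  rewrite [ltLHS]fubini_tonelli1//.
  - apply: emeasurable_funM; exact/measurable_EFinP.
  - by move=> t; rewrite mule_ge0// lee_fin ?expR_ge0// le_max lexx orbT.
(* [expR (- lg)] cancels the density of [gam], so its mean is 1. *)
have Jlg : I (fun t => (Num.max (- lg t) 0)%R).
  apply: expR_moment_integrable_max; first exact: measurable_funN.
  have [_ _ ->] := gamg; last 2 first.
  - apply/measurable_EFinP; apply: measurableT_comp => //.
    exact: measurable_funN.
  - by move=> t; rewrite lee_fin expR_ge0.
  under eq_integral do rewrite -EFinM -expRD addNr expR0.
  by rewrite integral1.
have Jb1 : I (fun t => (Num.max (- b1 (pxz t)) 0)%R).
  apply/(image_integrable mpxz ipi1 (f := fun t => (Num.max (- b1 t) 0)%R)).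
    by apply: measurable_maxr => //; exact: measurable_funN.
  apply: expR_moment_integrable_max; first exact: measurable_funN.
  exact: density_expRN_ln pf1.
have Jb2 : I (fun t => (Num.max (- b2 (pyz t)) 0)%R).
  apply/(image_integrable mpyz ipi2 (f := fun t => (Num.max (- b2 t) 0)%R)).
    by apply: measurable_maxr => //; exact: measurable_funN.
  apply: expR_moment_integrable_max; first exact: measurable_funN.
  exact: density_expRN_ln pf2.
have Jbh : I (fun t => (Num.max (- bh t.2) 0)%R).
  apply/(image_integrable msnd ieta (f := fun t => (Num.max (- bh t) 0)%R)).
    by apply: measurable_maxr => //; exact: measurable_funN.
  apply: expR_moment_integrable_max; first exact: measurable_funN.
  exact: density_expRN_ln eh.
(* [exp L] is the density of the glued plan with respect to [gam], so that
   [\int L <= 0]; this is the inequality to prove, divided by [eps]. *)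
pose L t := (b1 (pxz t) + b2 (pyz t) + bh t.2 - a t.1 - lg t)%R.
have mL : measurable_fun setT L.
  apply: measurable_funB => //; apply: measurable_funB; first apply: measurable_funD;
    first apply: measurable_funD; exact: measurableT_comp.
have expL : \int[gam]_t (expR (L t))%:E <= 1.
  pose K (t : T) := (f1 (pxz t) * f2 (pyz t) * h t.2 * expR (- a t.1))%R.
  have mf12 : measurable_fun setT (fun t : T => f1 (pxz t) * f2 (pyz t))%R.
    by apply: measurable_funM; exact: measurableT_comp.
  have mf12h : measurable_fun setT (fun t : T => f1 (pxz t) * f2 (pyz t) * h t.2)%R.
    by apply: measurable_funM => //; exact: measurableT_comp.
  have mK : measurable_fun setT K.
    apply: measurable_funM => //; apply: measurableT_comp => //.
    by apply: measurable_funN; exact: measurableT_comp.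
  have mexpN : measurable_fun setT (fun t => expR (- lg t)).
    by apply: measurableT_comp => //; exact: measurable_funN.
  have K0 t : (0 <= K t)%R by rewrite !mulr_ge0// expR_ge0.
  have -> : \int[gam]_t (expR (L t))%:E = \int[gam]_t (K t * expR (- lg t))%:E.
    apply: ge0_ae_eq_integral => //.
    - by apply/measurable_EFinP; exact: measurableT_comp.
    - by apply/measurable_EFinP; exact: measurable_funM.
    - by move=> t _; rewrite lee_fin mulr_ge0// expR_ge0.
    have := image_ae mpxz ipi1 (density_gt0 pf1).
    have := image_ae mpyz ipi2 (density_gt0 pf2).
    have := image_ae msnd ieta (density_gt0 eh).
    apply: filterS3 => t h_gt0 f2_gt0 f1_gt0 _.
    by congr EFin; rewrite /L /K /b1 /b2 /bh !expRD !lnK ?posrE.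
  have [_ _ ->] := gamg; last 2 first.
  - by apply/measurable_EFinP; exact: measurable_funM.
  - by move=> t; rewrite lee_fin mulr_ge0// expR_ge0.
  under eq_integral do rewrite -EFinM -mulrA -expRD addNr expR0 mulr1.
  have [_ _ ->] := density_fst lambda pip; last 2 first.
  - exact/measurable_EFinP.
  - by move=> t; rewrite lee_fin.
  rewrite -(integral_glue_density c2 pf1 pf2).
  have [_ _ ->] := density_snd (product_probability mu nu) eh; last 2 first.
  - exact/measurable_EFinP.
  - by move=> t; rewrite lee_fin mulr_ge0.
  apply: ge0_le_integral => //.
  - by move=> t _; rewrite mule_ge0 ?lee_fin//; exact: p0.
  - apply: emeasurable_funM; first exact/measurable_EFinP.
    by apply/measurable_EFinP; exact: measurableT_comp.
  - by apply: emeasurable_funM; apply/measurable_EFinP => //; exact: measurableT_comp.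
  (* The factor [expR (- a) * p] is 1 where [p > 0] and 0 elsewhere; hence an inequality only. *)
  - move=> t _; rewrite -!EFinM lee_fin /K -[leLHS]mulrA ler_piMr ?mulr_ge0//.
    by have /andP[] := expRN_ln_mul_le1 (p0 t.1).
have JL : I (fun t => (Num.max (L t) 0)%R) by exact: expR_moment_integrable_max.
have max0 (x : R) : (x <= Num.max x 0)%R /\ (0 <= Num.max x 0)%R.
  by rewrite !le_max !lexx orbT.
have lgE t : (eps * lg t = c t.1.1 t.1.2 - psi1 t.1.1 t.2 - psi2 t.1.2 t.2)%R.
  by rewrite mulrC divfK// gt_eqF.
have epsM x y : (x <= y -> eps * x <= eps * y)%R by rewrite ler_pM2l.
(* Solved for [psi1], the definition of [lg] reads [psi1 = c - eps * lg - psi2]; the upper bound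
   involves only the negative parts of [lg] and [psi2]. *)
have Ipsi1 : I (fun t => psi1 t.1.1 t.2).
  apply: (@integrable_sandwich _ _ _ _
    (fun t => - Num.max (- psi1 t.1.1 t.2) 0)%R _
    (fun t => c t.1.1 t.1.2 + (eps * Num.max (- lg t) 0 + Num.max (- psi2 t.1.2 t.2) 0))%R).
  - exact: (measurableT_comp mpsi1 mpxz).
  - exact: integrable_EFinN.
  - by apply: integrable_EFinD => //; apply: integrable_EFinD => //; exact: integrable_EFinZ.
  - move=> t; have := lgE t; have [/epsM A1 A2] := max0 (- lg t)%R.
    have [B1 B2] := max0 (- psi1 t.1.1 t.2)%R.
    by have [C1 C2] := max0 (- psi2 t.1.2 t.2)%R; lra.
have Ipsi2 : I (fun t => psi2 t.1.2 t.2).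
  apply: (@integrable_sandwich _ _ _ _
    (fun t => - Num.max (- psi2 t.1.2 t.2) 0)%R _
    (fun t => c t.1.1 t.1.2 + (eps * Num.max (- lg t) 0 + Num.max (- psi1 t.1.1 t.2) 0))%R).
  - exact: (measurableT_comp mpsi2 mpyz).
  - exact: integrable_EFinN.
  - by apply: integrable_EFinD => //; apply: integrable_EFinD => //; exact: integrable_EFinZ.
  - move=> t; have := lgE t; have [/epsM A1 A2] := max0 (- lg t)%R.
    have [B1 B2] := max0 (- psi1 t.1.1 t.2)%R.
    by have [C1 C2] := max0 (- psi2 t.1.2 t.2)%R; lra.
have Ilg : I lg.
  have : I (fun t => eps^-1 * (c t.1.1 t.1.2 + (- psi1 t.1.1 t.2 + - psi2 t.1.2 t.2)))%R.
    apply: integrable_EFinZ; apply: integrable_EFinD => //.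
    by apply: integrable_EFinD; exact: integrable_EFinN.
  by apply: eq_integrable => // t _; rewrite /lg /= mulrC addrA.
(* Likewise [b1 = L + a + lg - b2 - bh], with [a] and [lg] integrable, the positive part of [L]
   controlled by Jensen and the negative parts of [b2] and [bh] by their densities. The two other
   logarithms are symmetric. *)
have Ib1 : I (b1 \o pxz).
  apply: (@integrable_sandwich _ _ _ _
    (fun t => - Num.max (- b1 (pxz t)) 0)%R _
    (fun t => Num.max (L t) 0 + (a t.1 + (lg t + (Num.max (- b2 (pyz t)) 0 +
       Num.max (- bh t.2) 0))))%R).
  - exact: measurableT_comp.
  - exact: integrable_EFinN.
  - by do 4 apply: integrable_EFinD => //.
  - move=> t /=; have [A1 A2] := max0 (L t); have [B1 B2] := max0 (- b1 (pxz t))%R.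
    have [C1 C2] := max0 (- b2 (pyz t))%R; have [D1 D2] := max0 (- bh t.2)%R.
    by rewrite {1 3}/L in A1 *; lra.
have Ib2 : I (b2 \o pyz).
  apply: (@integrable_sandwich _ _ _ _
    (fun t => - Num.max (- b2 (pyz t)) 0)%R _
    (fun t => Num.max (L t) 0 + (a t.1 + (lg t + (Num.max (- b1 (pxz t)) 0 +
       Num.max (- bh t.2) 0))))%R).
  - exact: measurableT_comp.
  - exact: integrable_EFinN.
  - by do 4 apply: integrable_EFinD => //.
  - move=> t /=; have [A1 A2] := max0 (L t); have [B1 B2] := max0 (- b1 (pxz t))%R.
    have [C1 C2] := max0 (- b2 (pyz t))%R; have [D1 D2] := max0 (- bh t.2)%R.
    by rewrite {1 3}/L in A1 *; lra.
have Ibh : I (bh \o snd).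
  apply: (@integrable_sandwich _ _ _ _
    (fun t => - Num.max (- bh t.2) 0)%R _
    (fun t => Num.max (L t) 0 + (a t.1 + (lg t + (Num.max (- b1 (pxz t)) 0 +
       Num.max (- b2 (pyz t)) 0))))%R).
  - exact: measurableT_comp.
  - exact: integrable_EFinN.
  - by do 4 apply: integrable_EFinD => //.
  - move=> t /=; have [A1 A2] := max0 (L t); have [B1 B2] := max0 (- b1 (pxz t))%R.
    have [C1 C2] := max0 (- b2 (pyz t))%R; have [D1 D2] := max0 (- bh t.2)%R.
    by rewrite {1 3}/L in A1 *; lra.
have lee : (\int[gam]_t L t <= 0)%R.
  rewrite -lee_fin -EFin_Rintegral ?expR_moment_integral_le0//;
    do 4 (apply: integrable_EFinD => //; try exact: integrable_EFinN).
have IL : (\int[gam]_t L t = \int[gam]_t b1 (pxz t) + \int[gam]_t b2 (pyz t) +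
    \int[gam]_t bh t.2 - \int[gam]_t a t.1 - \int[gam]_t lg t)%R.
  have I1 : I (fun t => b1 (pxz t) + b2 (pyz t))%R by exact: integrable_EFinD.
  have I2 : I (fun t => b1 (pxz t) + b2 (pyz t) + bh t.2)%R by exact: integrable_EFinD.
  have I3 : I (fun t => b1 (pxz t) + b2 (pyz t) + bh t.2 - a t.1)%R.
    by apply: integrable_EFinD => //; exact: integrable_EFinN.
  by rewrite RintegralB// RintegralB// RintegralD// RintegralD.
have Elg : (eps * \int[gam]_t lg t = \int[gam]_t c t.1.1 t.1.2 -
    \int[gam]_t psi1 t.1.1 t.2 - \int[gam]_t psi2 t.1.2 t.2)%R.
  have I1 : I (fun t => c t.1.1 t.1.2 - psi1 t.1.1 t.2)%R.
    by apply: integrable_EFinD => //; exact: integrable_EFinN.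
  rewrite -RintegralZl// -RintegralB// -RintegralB//.
  by apply: eq_Rintegral => t _; rewrite lgE.
rewrite (OT_objective_density eps pip ic ia).
have -> : KL eta lambda = (\int[gam]_t bh t.2)%:E.
  rewrite (KL_density eh) -(image_Rintegral msnd ieta mbh Ibh).
  by rewrite EFin_Rintegral//; exact/(image_integrable msnd ieta mbh).
rewrite -(image_Rintegral mfst ipi mc Ic) -(image_Rintegral mfst ipi ma Ia) in Elg IL.
have i1 : pi1.-integrable setT (fun t => (psi1 t.1 t.2)%:E).
  exact/(image_integrable mpxz ipi1 mpsi1).
have i2 : pi2.-integrable setT (fun t => (psi2 t.1 t.2)%:E).
  exact/(image_integrable mpyz ipi2 mpsi2).
have l1 : pi1.-integrable setT (fun t => (ln (f1 t))%:E).
  exact/(image_integrable mpxz ipi1 mb1).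
have l2 : pi2.-integrable setT (fun t => (ln (f2 t))%:E).
  exact/(image_integrable mpyz ipi2 mb2).
have O1 : OT eps mu eta psi1 <= (\int[gam]_t psi1 t.1.1 t.2 + eps * \int[gam]_t b1 (pxz t))%:E.
  apply: ereal_inf_lbound; exists pi1 => //.
  rewrite (OT_objective_density eps pf1)// (image_Rintegral mpxz ipi1 mpsi1)//.
  by rewrite (image_Rintegral mpxz ipi1 mb1).
have O2 : OT eps nu eta psi2 <= (\int[gam]_t psi2 t.1.2 t.2 + eps * \int[gam]_t b2 (pyz t))%:E.
  apply: ereal_inf_lbound; exists pi2 => //.
  rewrite (OT_objective_density eps pf2)// (image_Rintegral mpyz ipi2 mpsi2)//.
  by rewrite (image_Rintegral mpyz ipi2 mb2).
apply: le_trans (DualAddTheoryRealDomain.lee_dD (DualAddTheoryRealDomain.lee_dD O1 O2) (lexx _)) _.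
rewrite -EFinM -!DualAddTheoryNumDomain.dEFinD lee_fin.
have := ler_wpM2l (ltW eps0) lee; rewrite IL mulr0; lra.
Qed.

End gibbs_plan.

(** The witness is the marginal on [X * Y] of the glued plan [gam]. The negative part of [c] is
    controlled for couplings of finite entropy only, so the entropy of [pi] has to be bounded before
    [c] enters. *)
Lemma latent_plan_glue (eta : probability Z R)
    (pi1 : probability (X * Z)%type R) (pi2 : probability (Y * Z)%type R) :
  couplings mu eta pi1 -> couplings nu eta pi2 -> KL eta lambda < +oo ->
  OT_objective eps mu eta psi1 pi1 < +oo ->
  OT_objective eps nu eta psi2 pi2 < +oo ->
  \int[pi1]_p (Num.max (- psi1 p.1 p.2) 0)%:E < +oo ->
  \int[pi2]_p (Num.max (- psi2 p.1 p.2) 0)%:E < +oo ->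
  (forall pi, couplings mu nu pi ->
    KL pi (product_probability mu nu) < +oo ->
    \int[pi]_p (Num.max (- c p.1 p.2) 0)%:E < +oo) ->
  exists2 pi, couplings mu nu pi &
    OT_objective eps mu nu c pi <=
    (OT_objective eps mu eta psi1 pi1 + OT_objective eps nu eta psi2 pi2 +
     (eps%:E * KL eta lambda)%E)%dE.
Proof.
move=> c1 c2 kfin o1 o2 N1 N2 Hc.
have [f1 [pf1 i1 l1]] := OT_objective_integrable eps0 mpsi1 o1 N1.
have [f2 [pf2 i2 l2]] := OT_objective_integrable eps0 mpsi2 o2 N2.
have [h eh] := has_density_exists (KL_lty_dominates kfin).
have mfst := @measurable_fst _ _ (X * Y)%type Z.
have msnd := @measurable_snd _ _ (X * Y)%type Z.
have [mh h0 _] := eh; have [mf1 f10 _] := pf1; have [mf2 f20 _] := pf2.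
pose base := product_probability (product_probability mu nu) eta.
have mf12 : measurable_fun setT (fun t : T => f1 (pxz t) * f2 (pyz t))%R.
  by apply: measurable_funM; exact: measurableT_comp.
have f120 (t : T) : (0 <= f1 (pxz t) * f2 (pyz t))%R by rewrite mulr_ge0.
have [gam gamf] := probability_of_density mf12 f120
  (integral_glue_density c2 pf1 pf2).
have ipi1 : is_image gam pxz pi1.
  apply/is_imageP => // F mF F0; have [_ _ ->] := gamf.
  - by rewrite -(integral_glue1 c2 pf1 pf2).
  - exact: measurableT_comp.
  - by move=> t; exact: F0.
have ipi2 : is_image gam pyz pi2.
  apply/is_imageP => // F mF F0; have [_ _ ->] := gamf.
  - by rewrite -(integral_glue2 c1 pf1 pf2).
  - exact: measurableT_comp.
  - by move=> t; exact: F0.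
have [c11 c12] := c1; have [c21 c22] := c2.
have ieta : is_image gam snd eta.
  move=> A mA; rewrite -c12// ipi1; last exact: measurableX.
  by congr (gam _); apply/seteqP; split => -[[x y] z] //= [].
have [pi ipi] := image_exists gam mfst.
have pic : couplings mu nu pi.
  split => A mA.
  - rewrite ipi; last exact: measurableX.
    rewrite -c11// ipi1; last exact: measurableX.
    by congr (gam _); apply/seteqP; split => -[[x y] z].
  - rewrite ipi; last exact: measurableX.
    rewrite -c21// ipi2; last exact: measurableX.
    by congr (gam _); apply/seteqP; split => -[[x y] z] /= [].
have pidom : pi `<< product_probability mu nu.
  apply/null_content_dominatesP => A mA A0; rewrite [LHS]ipi//.
  have mA' : measurable (@fst (X * Y)%type Z @^-1` A).
    by rewrite -[X in measurable X]setTI; exact: mfst.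
  have /null_content_dominatesP := density_dominates gamf; apply => //.
  rewrite (_ : fst @^-1` A = A `*` setT); last first.
    by apply/seteqP; split => -[x y]//= [].
  by rewrite [LHS]product_measure1E//= A0 mul0e.
have [p pip] := has_density_exists pidom.
have [mp p0 _] := pip.
exists pi => //.
pose a t := ln (p t); pose b1 t := ln (f1 t); pose b2 t := ln (f2 t).
pose bh t := ln (h t).
have ma : measurable_fun setT a by exact: measurableT_comp.
have mb1 : measurable_fun setT b1 by exact: measurableT_comp.
have mb2 : measurable_fun setT b2 by exact: measurableT_comp.
have mbh : measurable_fun setT bh by exact: measurableT_comp.
pose I (f : T -> R) := gam.-integrable setT (EFin \o f).
have Ipsi1 : I (fun t => psi1 t.1.1 t.2) by exact: (image_integrable mpxz ipi1 mpsi1).1 i1.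
have Ipsi2 : I (fun t => psi2 t.1.2 t.2) by exact: (image_integrable mpyz ipi2 mpsi2).1 i2.
have Ib1 : I (fun t => b1 (pxz t)) by exact: (image_integrable mpxz ipi1 mb1).1 l1.
have Ib2 : I (fun t => b2 (pyz t)) by exact: (image_integrable mpyz ipi2 mb2).1 l2.
have lh : eta.-integrable setT (fun t => (bh t)%:E).
  apply: integrable_of_max => //; last by rewrite -(KL_density eh).
  apply: expR_moment_integrable_max; first exact: measurable_funN.
  exact: density_expRN_ln eh.
have Ibh : I (fun t => bh t.2) by exact: (image_integrable msnd ieta mbh).1 lh.
have Ja : I (fun t => (Num.max (- a t.1) 0)%R).
  apply/(image_integrable mfst ipi (f := fun t => (Num.max (- a t) 0)%R)).
    by apply: measurable_maxr => //; exact: measurable_funN.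
  apply: expR_moment_integrable_max; first exact: measurable_funN.
  exact: density_expRN_ln pip.
have max0 (x : R) : (x <= Num.max x 0)%R /\ (0 <= Num.max x 0)%R.
  by rewrite !le_max !lexx orbT.
have mexpNb12 : measurable_fun setT
    (fun t : T => expR (- b1 (pxz t)) * expR (- b2 (pyz t)))%R.
  by apply: measurable_funM; apply: measurableT_comp => //;
    apply: measurable_funN; exact: measurableT_comp.
have le12 (t : T) : (expR (- b1 (pxz t)) * expR (- b2 (pyz t)) *
    (f1 (pxz t) * f2 (pyz t)) <= 1)%R.
  have /andP[x0 x1] := expRN_ln_mul_le1 (f10 (pxz t)).
  have /andP[y0 y1] := expRN_ln_mul_le1 (f20 (pyz t)).
  by rewrite mulrACA mulr_ile1.
have p_gt0 := image_ae mfst ipi (density_gt0 pip).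
(* A first application of Jensen's inequality shows that [pi] has finite entropy,
   which makes the negative part of the cost integrable. *)
pose L1 t := (a t.1 - b1 (pxz t) - b2 (pyz t))%R.
have mL1 : measurable_fun setT L1.
  by do 2 (apply: measurable_funB; last exact: measurableT_comp);
    exact: measurableT_comp.
have expL1 : \int[gam]_t (expR (L1 t))%:E <= 1.
  pose K (t : T) := (p t.1 * (expR (- b1 (pxz t)) * expR (- b2 (pyz t))))%R.
  have mK : measurable_fun setT K.
    by apply: measurable_funM => //; exact: measurableT_comp.
  have K0 t : (0 <= K t)%R by rewrite !mulr_ge0// expR_ge0.
  have -> : \int[gam]_t (expR (L1 t))%:E = \int[gam]_t (K t)%:E.
    apply: ge0_ae_eq_integral => //.
    - by apply/measurable_EFinP; exact: measurableT_comp.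
    - exact/measurable_EFinP.
    - by move=> t _; rewrite lee_fin.
    apply: filterS p_gt0 => t p_gt0 _.
    by congr EFin; rewrite /L1 /K /a !expRD lnK ?posrE// mulrA.
  have [_ _ ->] := gamf; last 2 first.
  - exact/measurable_EFinP.
  - by move=> t; rewrite lee_fin.
  (* The plan compared with [gam] is the product of [pi] and [eta], of density [p] with respect to
     [base]. *)
  have <- : \int[base]_t (p t.1)%:E = 1.
    rewrite -(integral1 (product_probability pi eta)).
    have [_ _ ->] := density_fst eta pip => //.
    by under [RHS]eq_integral do rewrite mul1e.
  apply: ge0_le_integral => //.
  - by move=> t _; rewrite mule_ge0 ?lee_fin.
  - by apply: emeasurable_funM; exact/measurable_EFinP.
  - by apply/measurable_EFinP; exact: measurableT_comp.
  - by move=> t _; rewrite -EFinM lee_fin /K -mulrA ler_piMr.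
have JL1 : I (fun t => (Num.max (L1 t) 0)%R) by exact: expR_moment_integrable_max.
have Ia : I (fun t => a t.1).
  apply: (@integrable_sandwich _ _ _ _
    (fun t => - Num.max (- a t.1) 0)%R _
    (fun t => Num.max (L1 t) 0 + (b1 (pxz t) + b2 (pyz t)))%R).
  - exact: measurableT_comp.
  - exact: integrable_EFinN.
  - by do 2 apply: integrable_EFinD => //.
  - move=> t /=; have [A1 A2] := max0 (L1 t); have [B1 B2] := max0 (- a t.1)%R.
    by rewrite {1}/L1 in A1; lra.
have la : pi.-integrable setT (fun t => (a t)%:E).
  exact/(image_integrable mfst ipi ma).
have cN : \int[pi]_p (Num.max (- c p.1 p.2) 0)%:E < +oo.
  by apply: Hc => //; rewrite (KL_density pip) EFin_Rintegral// ltry.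
have Icn : I (fun t => (Num.max (- c t.1.1 t.1.2) 0)%R).
  have mn : measurable_fun setT (fun t : X * Y => (Num.max (- c t.1 t.2) 0)%R).
    by apply: measurable_maxr => //; exact: measurable_funN.
  apply/(image_integrable mfst ipi mn); apply: ge0_integrable => //.
  by move=> t; rewrite le_max lexx orbT.
(* Where [f1], [f2] and [h] are positive, [expR L] is the density with respect to [gam] of [pi]
   completed by the Gibbs kernel. Multiplied by [eps], the inequality [\int L <= 0] is the
   conclusion, the three costs entering through [lg]. *)
pose L t := (a t.1 + lg t - b1 (pxz t) - b2 (pyz t) - bh t.2)%R.
have mL : measurable_fun setT L.
  do 3 (apply: measurable_funB; last exact: measurableT_comp).
  by apply: measurable_funD => //; exact: measurableT_comp.
have expL : \int[gam]_t (expR (L t))%:E <= 1.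
  pose K0 (t : T) := (p t.1 * expR (lg t) * (expR (- b1 (pxz t)) * expR (- b2 (pyz t))))%R.
  pose K (t : T) := (K0 t * expR (- bh t.2))%R.
  have mpg : measurable_fun setT (fun t => p t.1 * expR (lg t))%R.
    by apply: measurable_funM => //; exact: measurableT_comp.
  have mK0 : measurable_fun setT K0 by exact: measurable_funM.
  have mexpNbh : measurable_fun setT (fun t : T => expR (- bh t.2)).
    by apply: measurableT_comp => //; apply: measurable_funN; exact: measurableT_comp.
  have mK : measurable_fun setT K by exact: measurable_funM.
  have pg_ge0 t : (0 <= p t.1 * expR (lg t))%R by rewrite mulr_ge0// expR_ge0.
  have K00 t : (0 <= K0 t)%R by rewrite mulr_ge0// mulr_ge0// expR_ge0.
  have K_ge0 t : (0 <= K t)%R by rewrite mulr_ge0// expR_ge0.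
  have -> : \int[gam]_t (expR (L t))%:E = \int[gam]_t (K t)%:E.
    apply: ge0_ae_eq_integral => //.
    - by apply/measurable_EFinP; exact: measurableT_comp.
    - exact/measurable_EFinP.
    - by move=> t _; rewrite lee_fin.
    apply: filterS p_gt0 => t p_gt0 _.
    by congr EFin; rewrite /L /K /K0 /a !expRD lnK ?posrE// !mulrA.
  have [_ _ ->] := gamf; last 2 first.
  - exact/measurable_EFinP.
  - by move=> t; rewrite lee_fin.
  have [_ _ ->] := density_snd (product_probability mu nu) eh; last 2 first.
  - by apply: emeasurable_funM; exact/measurable_EFinP.
  - by move=> t; rewrite mule_ge0// lee_fin.
  have <- : \int[product_probability (product_probability mu nu) lambda]_t
      (p t.1 * expR (lg t))%:E = 1.
    rewrite -(integral1 pi) -(@integral_gibbs_fst pi (cst 1))//.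
    have [_ _ ->] := density_fst lambda pip; last 2 first.
    - by apply: emeasurable_funM => //; exact/measurable_EFinP.
    - by move=> t; rewrite mul1e lee_fin expR_ge0.
    by apply: eq_integral => t _; rewrite mul1e -EFinM mulrC.
  apply: ge0_le_integral => //.
  - by move=> t _; rewrite !mule_ge0 ?lee_fin//; exact: h0.
  - apply: emeasurable_funM; last by apply/measurable_EFinP; exact: measurableT_comp.
    by apply: emeasurable_funM; exact/measurable_EFinP.
  - exact/measurable_EFinP.
  - move=> t _; rewrite -!EFinM lee_fin /K /K0 /=.
    have /andP[z0 z1] := expRN_ln_mul_le1 (h0 t.2).
    rewrite [leLHS](_ : _ = p t.1 * expR (lg t) *
      ((expR (- b1 (pxz t)) * expR (- b2 (pyz t)) * (f1 (pxz t) * f2 (pyz t))) *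
       (expR (- bh t.2) * h t.2)))%R; last by ring.
    by rewrite ler_piMr// mulr_ile1// ?mulr_ge0 ?expR_ge0.
have JL : I (fun t => (Num.max (L t) 0)%R) by exact: expR_moment_integrable_max.
have lgE t : (eps * lg t = c t.1.1 t.1.2 - psi1 t.1.1 t.2 - psi2 t.1.2 t.2)%R.
  by rewrite mulrC divfK// gt_eqF.
have epsM x y : (x <= y -> eps * x <= eps * y)%R by rewrite ler_pM2l.
(* The lower bound is the hypothesis just obtained from finite entropy; the upper one solves the
   definitions of [L] and [lg] for [c]. *)
have Ic : I (fun t => c t.1.1 t.1.2).
  apply: (@integrable_sandwich _ _ _ _
    (fun t => - Num.max (- c t.1.1 t.1.2) 0)%R _
    (fun t => eps * (Num.max (L t) 0 + (- a t.1 + (b1 (pxz t) + (b2 (pyz t) + bh t.2)))) +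
      (psi1 t.1.1 t.2 + psi2 t.1.2 t.2))%R).
  - exact: (measurableT_comp mc mfst).
  - exact: integrable_EFinN.
  - apply: integrable_EFinD; last exact: integrable_EFinD.
    apply: integrable_EFinZ; apply: integrable_EFinD => //.
    apply: integrable_EFinD; first exact: integrable_EFinN.
    by do 2 apply: integrable_EFinD => //.
  - move=> t /=; have [A1 A2] := max0 (L t); have [B1 B2] := max0 (- c t.1.1 t.1.2)%R.
    rewrite {1}/L in A1.
    have : (lg t <= Num.max (L t) 0 + (- a t.1 + (b1 (pxz t) + (b2 (pyz t) + bh t.2))))%R by lra.
    by move=> /epsM; rewrite lgE; lra.
have Ilg : I lg.
  have : I (fun t => eps^-1 * (c t.1.1 t.1.2 + (- psi1 t.1.1 t.2 + - psi2 t.1.2 t.2)))%R.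
    apply: integrable_EFinZ; apply: integrable_EFinD => //.
    by apply: integrable_EFinD; exact: integrable_EFinN.
  by apply: eq_integrable => // t _; rewrite /lg /= mulrC addrA.
have lee : (\int[gam]_t L t <= 0)%R.
  rewrite -lee_fin -EFin_Rintegral ?expR_moment_integral_le0//;
    do 4 (apply: integrable_EFinD => //; try exact: integrable_EFinN).
have IL : (\int[gam]_t L t = \int[gam]_t a t.1 + \int[gam]_t lg t -
    \int[gam]_t b1 (pxz t) - \int[gam]_t b2 (pyz t) - \int[gam]_t bh t.2)%R.
  have I1 : I (fun t => a t.1 + lg t)%R by exact: integrable_EFinD.
  have I2 : I (fun t => a t.1 + lg t - b1 (pxz t))%R.
    by apply: integrable_EFinD => //; exact: integrable_EFinN.
  have I3 : I (fun t => a t.1 + lg t - b1 (pxz t) - b2 (pyz t))%R.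
    by apply: integrable_EFinD => //; exact: integrable_EFinN.
  by rewrite RintegralB// RintegralB// RintegralB// RintegralD.
have Elg : (eps * \int[gam]_t lg t = \int[gam]_t c t.1.1 t.1.2 -
    \int[gam]_t psi1 t.1.1 t.2 - \int[gam]_t psi2 t.1.2 t.2)%R.
  have I1 : I (fun t => c t.1.1 t.1.2 - psi1 t.1.1 t.2)%R.
    by apply: integrable_EFinD => //; exact: integrable_EFinN.
  rewrite -RintegralZl// -RintegralB// -RintegralB//.
  by apply: eq_Rintegral => t _; rewrite lgE.
have ic : pi.-integrable setT (fun p => (c p.1 p.2)%:E).
  exact/(image_integrable mfst ipi mc).
rewrite (OT_objective_density eps pip ic la) (OT_objective_density eps pf1 i1 l1).
rewrite (OT_objective_density eps pf2 i2 l2) (KL_density eh) EFin_Rintegral//.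
rewrite (image_Rintegral mfst ipi mc)// (image_Rintegral mfst ipi ma)//.
rewrite (image_Rintegral mpxz ipi1 mpsi1)// (image_Rintegral mpxz ipi1 mb1)//.
rewrite (image_Rintegral mpyz ipi2 mpsi2)// (image_Rintegral mpyz ipi2 mb2)//.
rewrite (image_Rintegral msnd ieta mbh)//.
rewrite -EFinM -!DualAddTheoryNumDomain.dEFinD lee_fin.
have := ler_wpM2l (ltW eps0) lee; rewrite IL mulr0; lra.
Qed.

End gibbs_plans.

Lemma latent_decomposition dX dZ (X : measurableType dX)
    (Z : measurableType dZ) (R : realType) (eps : R) (c : X -> X -> R)
    (psi : X -> Z -> R) (mu nu : probability X R) (lambda : probability Z R) :
  0 < eps ->
  measurable_fun setT (fun p : X * X => c p.1 p.2) ->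
  measurable_fun setT (fun p : X * Z => psi p.1 p.2) ->
  (forall x y,
    (\int[lambda]_z (expR ((c x y - psi x z - psi y z) / eps))%:E = 1)%E) ->
  OT_well_defined eps mu nu c ->
  (forall eta : probability Z R, (KL eta lambda < +oo)%E ->
    OT_well_defined eps mu eta psi /\ OT_well_defined eps nu eta psi) ->
  (forall pi, couplings mu nu pi -> (OT_objective eps mu nu c pi < +oo)%E ->
    (\int[pi]_p \int[lambda]_z (Num.max (- psi p.1 z) 0 *
       expR ((c p.1 p.2 - psi p.1 z - psi p.2 z) / eps))%:E < +oo)%E /\
    (\int[pi]_p \int[lambda]_z (Num.max (- psi p.2 z) 0 *
       expR ((c p.1 p.2 - psi p.1 z - psi p.2 z) / eps))%:E < +oo)%E) ->
  OT eps mu nu c = ereal_inf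
    [set (OT eps mu eta psi + OT eps nu eta psi + (eps%:E * KL eta lambda)%E)%dE
    | eta in [set: probability Z R]].
Proof.
move=> eps0 mc mpsi gibbs1 [wc _] wpsi wgibbs.
apply/eqP; rewrite eq_le; apply/andP; split; last first.
  apply: le_ereal_inf_tmp => _ [pi pic <-].
  have [oy|] := eqVneq (OT_objective eps mu nu c pi) +oo%E.
    by rewrite oy leey.
  rewrite -ltey => oy; have [N1 N2] := wgibbs _ pic oy.
  have [_ ky] := OT_objective_lty eps0 oy.
  have [eta le_eta] := gibbs_plan_optimal eps0 mc mpsi mpsi gibbs1 pic oy
    (wc _ pic ky) N1 N2.
  by apply: le_trans le_eta; apply: ereal_inf_lbound; exists eta.
apply: le_ereal_inf_tmp => _ [eta _ <-].
(* An infinite entropy makes the sum [+oo] whatever the two transport terms are, even [-oo]; this is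
   why well-definedness is asked at finite entropy only. *)
have [ky|] := eqVneq (KL eta lambda) +oo%E.
  rewrite ky gt0_muley ?lte_fin//.
  by rewrite DualAddTheoryNumDomain.daddey leey.
rewrite -ltey => ky; have [[w1 g1] [w2 g2]] := wpsi _ ky.
have [oy1|] := eqVneq (OT eps mu eta psi) +oo%E.
  by rewrite oy1 !DualAddTheoryNumDomain.daddye leey.
rewrite -ltey => oy1.
have [oy2|] := eqVneq (OT eps nu eta psi) +oo%E.
  rewrite oy2 DualAddTheoryNumDomain.daddey.
  by rewrite DualAddTheoryNumDomain.daddye leey.
rewrite -ltey => oy2.
have fin1 : OT eps mu eta psi \is a fin_num by rewrite fin_real// g1 oy1.
have fin2 : OT eps nu eta psi \is a fin_num by rewrite fin_real// g2 oy2.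
have [h eh] := has_density_exists (KL_lty_dominates ky).
have kfin : KL eta lambda \is a fin_num.
  rewrite (KL_density eh).
  have mh : measurable_fun setT (fun t => ln (h t)).
    by case: eh => mh _ _; exact: measurableT_comp.
  apply: (integrable_fin_num measurableT).
  apply: integrable_of_max => //; last by rewrite -(KL_density eh).
  apply: expR_moment_integrable_max; first exact: measurable_funN.
  exact: density_expRN_ln eh.
(* Couplings optimal up to [e / 2] are glued, one for each transport term. *)
apply/lee_addgt0Pr => e e0.
have e20 : 0 < e / 2 by rewrite divr_gt0.
have [_ [pi1 c1 <-] lt1] := lb_ereal_inf_adherent e20 fin1.
have [_ [pi2 c2 <-] lt2] := lb_ereal_inf_adherent e20 fin2.
have [r1 r1E] : exists r, OT eps mu eta psi = r%:E
  by exists (fine (OT eps mu eta psi)); rewrite (fineK fin1).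
have [r2 r2E] : exists r, OT eps nu eta psi = r%:E
  by exists (fine (OT eps nu eta psi)); rewrite (fineK fin2).
have [k kE] : exists r, KL eta lambda = r%:E
  by exists (fine (KL eta lambda)); rewrite (fineK kfin).
have le1 : (OT_objective eps mu eta psi pi1 <= (r1 + e / 2)%:E)%E.
  by apply: (le_trans (ltW lt1)); rewrite -/(OT eps mu eta psi) r1E -EFinD lexx.
have le2 : (OT_objective eps nu eta psi pi2 <= (r2 + e / 2)%:E)%E.
  by apply: (le_trans (ltW lt2)); rewrite -/(OT eps nu eta psi) r2E -EFinD lexx.
have o1 : (OT_objective eps mu eta psi pi1 < +oo)%E by exact: le_lt_trans le1 (ltry _).
have o2 : (OT_objective eps nu eta psi pi2 < +oo)%E by exact: le_lt_trans le2 (ltry _).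
have [_ ky1] := OT_objective_lty eps0 o1.
have [_ ky2] := OT_objective_lty eps0 o2.
have [pi pic le_pi] := latent_plan_glue eps0 mc mpsi mpsi gibbs1 c1 c2 ky o1 o2
  (w1 _ c1 ky1) (w2 _ c2 ky2) wc.
apply: (@le_trans _ _ (OT_objective eps mu nu c pi)).
  by apply: ereal_inf_lbound; exists pi.
apply: (le_trans le_pi).
rewrite r1E r2E kE -EFinM.
apply: (le_trans (DualAddTheoryRealDomain.lee_dD
  (DualAddTheoryRealDomain.lee_dD le1 le2) (lexx _))).
rewrite -!DualAddTheoryNumDomain.dEFinD -EFinD lee_fin.
lra.
Qed.

(** * Binary digits and independent uniform variables *)

(** Intervals []a, b]] are stable under intersection and generate the Borel sets; each is a
    difference of half-lines, and finiteness permits the subtraction. *)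
Lemma finite_measure_unique_Nyc (R : realType)
    (m1 m2 : {measure set R -> \bar R}) :
  (m1 setT < +oo)%E ->
  (forall t, m1 `]-oo, t]%classic = m2 `]-oo, t]%classic) ->
  forall A, measurable A -> m1 A = m2 A.
Proof.
move=> m1y m12 A mA.
have m1fin B : measurable B -> (m1 B < +oo)%E.
  by move=> mB; apply: le_lt_trans m1y; apply: le_measure; rewrite ?inE.
apply: (@measure_unique _ _ R (@ocitv R) (fun n => `]- n%:R, n%:R]%classic)) => //.
- exact: ocitvI.
- by move=> n; exact: is_ocitv.
- rewrite -subTset => x _.
  exists (Num.truncn `|x|).+1 => //=; rewrite in_itv/=.
  have /(le_lt_trans (ler_norm _)) xn := truncnS_gt `|x|.
  rewrite (ltW xn) andbT ltrNl.
  by apply: le_lt_trans (truncnS_gt `|x|); rewrite -normrN ler_norm.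
- move=> _ [[a b] _ <-] /=; have [ab|ba] := leP a b; last first.
    by rewrite set_itv_ge ?measure0// bnd_simp -leNgt ltW.
  have -> : `]a, b]%classic = `]-oo, b] `\` `]-oo, a].
    by rewrite -[RHS]setCK setCD setCitvl setUC -[LHS]setCK setCitv.
  have sab : (`]-oo, a]%classic : set R) `<=` `]-oo, b]%classic by exact: subset_itvl.
  rewrite [LHS]measureD//; last exact: m1fin.
  rewrite [RHS]measureD//; last first.
    by have := m1fin `]-oo, b]%classic; rewrite m12; apply.
  by rewrite !setIidr//; congr (_ - _)%E; exact: m12.
- by move=> n; exact: m1fin.
Qed.

(** With [E = setT] and [k = 1] this identifies the law of [f]; with a general [E] of probability
    [k] it expresses that [f] is independent of [E] and has law [mu]. *)
Lemma restricted_law_unique d (T : measurableType d) (R : realType)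
    (P : probability T R) (E : set T) (f : T -> R) (k : R)
    (mu : probability R R) :
  measurable E -> measurable_fun setT f -> 0 <= k ->
  (forall t, P (E `&` f @^-1` `]-oo, t]) = k%:E * mu `]-oo, t]%classic)%E ->
  forall A, measurable A -> P (E `&` f @^-1` A) = (k%:E * mu A)%E.
Proof.
move=> mE mf k0 PE A mA.
have [m1 m1E] : exists m : {measure set R -> \bar R},
    forall B, m B = P (E `&` f @^-1` B).
  pose m : {measure set R -> \bar R} := pushforward (mrestr P mE) f.
  by exists (m mf) => B; rewrite /m /pushforward /= /mrestr setIC.
pose m2 : {measure set R -> \bar R} := mscale (NngNum k0) mu.
rewrite -m1E.
apply: (@finite_measure_unique_Nyc R m1 m2) => //.
- by rewrite m1E preimage_setT setIT (le_lt_trans (probability_le1 P mE)) ?ltry.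
- by move=> t; rewrite m1E PE.
Qed.

Section binary_shift.
Context {R : realType}.

Lemma uniform_law_exists : exists U : probability R R,
  forall A, measurable A -> U A = lebesgue_measure (A `&` `[0, 1]%classic).
Proof.
have m01 : measurable (`[0, 1]%classic : set R) by [].
have [||U UE] := @probability_of_density _ (measurableTypeR R) R lebesgue_measure
    (\1_(`[0%R, 1%R]%classic)) (measurable_indic m01).
- by [].
- rewrite integral_indic// setIT.
  transitivity (lebesgue_measure (`[0%R, 1%R]%classic : set R)) => //.
  by rewrite lebesgue_measure_itv/= lte_fin ltr01 sube0.
(* The identity transports the law from [measurableTypeR R], where the Lebesgue measure lives, to
   [R]. *)
have [U' U'E] := image_exists U (@measurable_id _ (measurableTypeR R) setT :
  measurable_fun setT (idfun : measurableTypeR R -> R)).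
exists U' => A mA; rewrite U'E// (density_measurable_cond UE)//.
by rewrite integral_indic// setIC.
Qed.

Definition upper_half (x : R) : bool := 2^-1 <= x.

(** Shift of the binary digits; it fixes the endpoint 1, in accordance with the expansion
    0.111... *)
Definition doubling (x : R) : R := 2 * x - (upper_half x)%:R.

Variable U : probability R R.
Hypothesis UE : forall A, measurable A ->
  U A = lebesgue_measure (A `&` `[0, 1]%classic).

Lemma uniform_le0 t : t <= 0 -> U `]-oo, t]%classic = 0%E.
Proof.
move=> t0; rewrite UE//.
apply/eqP; rewrite eq_le measure_ge0 andbT.
apply: (@le_trans _ _ (lebesgue_measure ([set 0%R] : set R))).
  apply: le_measure; rewrite ?inE//; first exact: measurableI.
  by move=> x /=; rewrite !in_itv/= => -[xt /andP[x0 _]]; lra.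
by rewrite lebesgue_measure_set1.
Qed.

Lemma uniform_ge1 t : 1 <= t -> U `]-oo, t]%classic = 1%E.
Proof.
move=> t1; rewrite UE// setIidr; last first.
  by move=> x /=; rewrite !in_itv/= => /andP[_]; lra.
by rewrite lebesgue_measure_itv/= lte_fin ltr01 sube0.
Qed.

Lemma uniform_01 t : 0 <= t <= 1 -> U `]-oo, t]%classic = t%:E.
Proof.
move=> /andP[t0 t1]; rewrite UE//.
have -> : `]-oo, t]%classic `&` `[0, 1]%classic = `[0, t]%classic.
  by apply/seteqP; split => x /=; rewrite !in_itv/=;
    [move=> [xt /andP[-> _]]|move=> /andP[-> xt]; rewrite xt; split => //; lra].
rewrite lebesgue_measure_itv/= lte_fin.
by case: ltP => [_|t0']; rewrite ?sube0//; congr EFin; lra.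
Qed.

Lemma measurable_upper_half : measurable_fun setT upper_half.
Proof. exact: measurable_fun_ler. Qed.

Lemma measurable_bool_fiber (f : R -> bool) (b : bool) :
  measurable_fun setT f -> measurable [set x | f x = b].
Proof.
move=> mf; rewrite (_ : [set x | f x = b] = setT `&` f @^-1` [set b]).
  exact: mf.
by rewrite setTI.
Qed.

Lemma measurable_doubling : measurable_fun setT doubling.
Proof.
apply: measurable_funB; first exact: measurable_funM.
rewrite (_ : (fun x => _) = fun x => if upper_half x then 1 else 0 : R); last first.
  by apply/funext => x; case: upper_half.
by apply: measurable_fun_ifT => //; exact: measurable_upper_half.
Qed.

(** The first digit is a fair coin, independent of the shifted point, which is again uniform. It
    suffices to compare lengths of intervals on half-lines. *)
Lemma uniform_binary_shift (b : bool) A : measurable A ->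
  U ([set x | upper_half x = b] `&` doubling @^-1` A) = (2^-1%:E * U A)%E.
Proof.
have mb := measurable_bool_fiber b measurable_upper_half.
apply: restricted_law_unique => //; first exact: measurable_doubling.
move=> t; rewrite UE; last first.
  apply: measurableI => //; rewrite -[X in measurable X]setTI.
  exact: measurable_doubling.
have [t0|t0] := ltP t 0.
  rewrite uniform_le0 ?ltW// mule0 (_ : _ `&` _ = set0) ?measure0//.
  rewrite -subset0 => x [[/= xb]]; rewrite !in_itv/= /doubling xb => xt.
  by move: xb xt; rewrite /upper_half; case: b {mb} => /= xb xt; lra.
have [t1|t1] := ltP t 1.
  rewrite uniform_01 ?t0 ?ltW//.
  case: b {mb}.
    rewrite (_ : _ `&` _ = `[2^-1, 2^-1 * (t + 1)]%classic).
      rewrite lebesgue_measure_itv/= lte_fin; case: ltP => [_|t0'].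
        by rewrite -EFinB -EFinM; congr EFin; lra.
      by rewrite -EFinM; congr EFin; lra.
    apply/seteqP; split => x /=; rewrite !in_itv/= /doubling /upper_half.
      by move=> [[-> /= xt] _]; lra.
    move=> /andP[x1 x2]; rewrite x1/=; split; first split => //.
      lra.
    lra.
  rewrite (_ : _ `&` _ = `[0, 2^-1 * t]%classic).
    rewrite lebesgue_measure_itv/= lte_fin; case: ltP => [_|t0'].
      by rewrite sube0 -EFinM.
    by rewrite -EFinM; congr EFin; lra.
  apply/seteqP; split => x /=; rewrite !in_itv/= /doubling /upper_half.
    by move=> [[-> /= xt] /andP[-> _]]/=; lra.
  move=> /andP[x1 x2].
  have -> : (2^-1 <= x) = false by apply/negbTE; rewrite -ltNge; lra.
  by split; first split => //=; lra.
rewrite uniform_ge1// mule1.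
case: b {mb}.
  rewrite (_ : _ `&` _ = `[2^-1, 1]%classic).
    rewrite lebesgue_measure_itv/= lte_fin; case: ltP => [_|t0'].
      by rewrite -EFinB; congr EFin; lra.
    by exfalso; lra.
  apply/seteqP; split => x /=; rewrite !in_itv/= /doubling /upper_half.
    by move=> [[-> /= xt] /andP[_ ->]].
  by move=> /andP[x1 x2]; rewrite x1/=; split; first split => //; lra.
rewrite (_ : _ `&` _ = `[0, 2^-1[%classic).
  rewrite lebesgue_measure_itv/= lte_fin; case: ltP => [_|t0'].
    by rewrite sube0.
  by exfalso; move: t0'; rewrite leNgt invr_gt0 ltr0n.
apply/seteqP; split => x /=; rewrite !in_itv/= /doubling /upper_half.
  by move=> [[xb /= xt] /andP[-> _]]/=; rewrite ltNge xb.
move=> /andP[x1 x2]; have -> : (2^-1 <= x) = false by apply/negbTE; rewrite -ltNge.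
by split; first split => //=; lra.
Qed.

Lemma uniform_doubling A : measurable A -> U (doubling @^-1` A) = U A.
Proof.
move=> mA; have mD : measurable (doubling @^-1` A).
  by rewrite -[X in measurable X]setTI; exact: measurable_doubling.
rewrite (_ : doubling @^-1` A =
  ([set x | upper_half x = true] `&` doubling @^-1` A) `|`
  ([set x | upper_half x = false] `&` doubling @^-1` A)); last first.
  by rewrite -setIUl setIC; apply/seteqP; split => x /= => [Ax|[]//];
    split => //; case: upper_half; [left|right].
rewrite measureU//.
- transitivity (2^-1%:E * U A + 2^-1%:E * U A)%E.
    by congr (_ + _)%E; exact: uniform_binary_shift.
  have /fineK <- := fin_num_measure U A mA.
  by rewrite -!EFinM -EFinD; congr EFin; lra.
- by apply: measurableI => //; exact: measurable_bool_fiber measurable_upper_half.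
- by apply: measurableI => //; exact: measurable_bool_fiber measurable_upper_half.
- by apply/seteqP; split => x //= [[->]] _ [].
Qed.

End binary_shift.

Section even_bits.
Context {R : realType}.
Let D := @doubling R.
Let b (x : R) : R := (upper_half x)%:R.

(** Ranks are counted from 0, so the first digit is an even one. Composing the limit with [doubling]
    yields the digits of odd rank, and no second series is needed. *)
Definition even_bits_sum (n : nat) (x : R) : R :=
  \sum_(0 <= j < n) 2^-1 ^+ j.+1 * (upper_half (iter j (D \o D) x))%:R.

Definition even_bits (x : R) : R := limn (even_bits_sum ^~ x).

Let even_bits_sum_le n x : even_bits_sum n x <= 1 - 2^-1 ^+ n.
Proof.
elim: n => [|n IH]; first by rewrite /even_bits_sum big_nil expr0 subrr.
rewrite /even_bits_sum big_nat_recr//= -/(even_bits_sum n x) exprS.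
have : 2^-1 * 2^-1 ^+ n * (upper_half (iter n (D \o D) x))%:R <= 2^-1 * 2^-1 ^+ n :> R.
  by rewrite ler_piMr ?mulr_ge0 ?exprn_ge0 ?invr_ge0// lern1 leq_b1.
lra.
Qed.

Let even_bits_sum_cvg x : even_bits_sum ^~ x @ \oo --> even_bits x.
Proof.
apply: nondecreasing_is_cvgn.
- apply/nondecreasing_seqP => n.
  rewrite /even_bits_sum [leRHS]big_nat_recr//= lerDl.
  by rewrite mulr_ge0 ?exprn_ge0 ?invr_ge0 ?ler0n.
- exists 1 => _ [n _ <-]; apply: le_trans (even_bits_sum_le n x) _.
  by rewrite gerBl exprn_ge0 ?invr_ge0.
Qed.

(** Together with measurability and the bounds [even_bits_01], this self-similarity is all that the
    computation of the laws uses. *)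
Lemma even_bits_shift x : even_bits x = 2^-1 * (b x + even_bits (D (D x))).
Proof.
apply/cvg_lim => //; rewrite -(cvg_shiftS (even_bits_sum ^~ x)).
rewrite [X in X @ \oo --> _](_ : _ =
    (fun n => 2^-1 * (b x + even_bits_sum n (D (D x))))); last first.
  apply/funext => n; rewrite /= /even_bits_sum big_nat_recl// expr1 mulrDr.
  congr (_ + _); rewrite mulr_sumr; apply: eq_bigr => j _.
  by rewrite iterSr exprS mulrA.
apply: cvgM; first exact: cvg_cst.
by apply: cvgD; [exact: cvg_cst|exact: even_bits_sum_cvg].
Qed.

Lemma even_bits_01 x : 0 <= even_bits x <= 1.
Proof.
apply/andP; split.
- apply: limr_ge; first exact: even_bits_sum_cvg.
  apply: nearW => n; apply: sumr_ge0 => j _.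
  by rewrite mulr_ge0 ?exprn_ge0 ?invr_ge0 ?ler0n.
- apply: limr_le; first exact: even_bits_sum_cvg.
  apply: nearW => n; apply: le_trans (even_bits_sum_le n x) _.
  by rewrite gerBl exprn_ge0 ?invr_ge0.
Qed.

Lemma measurable_even_bits : measurable_fun setT even_bits.
Proof.
apply: (@measurable_fun_cvg _ _ _ _ (fun n x => even_bits_sum n x)); last first.
  by move=> x _; exact: even_bits_sum_cvg.
move=> n; apply: measurable_sum => j; apply: measurable_funM => //.
have mD2 : measurable_fun setT (iter j (D \o D)).
  elim: j => [|j IH]; first exact: measurable_id.
  by rewrite /=; apply: (measurableT_comp (f := D \o D)) => //;
    apply: measurableT_comp; exact: measurable_doubling.
rewrite (_ : (fun x => _) =
  (fun x => if upper_half (iter j (D \o D) x) then 1 else 0 : R)); last first.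
  by apply/funext => x; case: upper_half.
apply: measurable_fun_ifT => //.
exact: (measurableT_comp (@measurable_upper_half R)).
Qed.

End even_bits.

Lemma le_expr_half_le0 (R : realType) (x : R) :
  (forall n, x <= 2^-1 ^+ n) -> x <= 0.
Proof.
move=> xn; have h : (fun n => 2^-1 ^+ n : R) @ \oo --> (0 : R).
  by apply: cvg_expr; rewrite ger0_norm ?invr_ge0// invf_lt1// ltr1n.
rewrite -(cvg_lim _ h)//; apply: limr_ge; first by apply/cvg_ex; exists 0.
exact: nearW.
Qed.

Section dyadic_contraction.
Context {R : realType}.

(** Meant for a difference of distribution functions of laws on [[0, 1]]. For [0 <= t < 1] only one
    of [2 * t] and [2 * t - 1] lies in [[0, 1[], so one term vanishes and each use of the equation
    halves the bound on [f]. *)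
Lemma dyadic_contraction1 (f : R -> R) :
  (forall t, `|f t| <= 1) -> (forall t, t < 0 -> f t = 0) ->
  (forall t, 1 <= t -> f t = 0) ->
  (forall t, f t = 2^-1 * (f (2 * t) + f (2 * t - 1))) ->
  forall t, f t = 0.
Proof.
move=> f1 fneg fge1 fE t; apply/eqP; rewrite -normr_le0.
apply: le_expr_half_le0 => n; elim: n t => [|n IH] t; first by rewrite expr0.
have n0 : 0 <= 2^-1 ^+ n.+1 :> R by rewrite exprn_ge0 ?invr_ge0.
have [t0|t0] := ltP t 0; first by rewrite fneg ?normr0.
have [t1|t1] := leP 1 t; first by rewrite fge1 ?normr0.
rewrite fE normrM ger0_norm ?invr_ge0// exprS ler_wpM2l ?invr_ge0//.
have [th|th] := ltP (2 * t - 1) 0; first by rewrite (fneg (2 * t - 1))// addr0.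
by rewrite (fge1 (2 * t)) ?add0r//; lra.
Qed.

(** In the unit square three of the four terms vanish, which would give a factor 1/4; a factor 1/2
    is enough and is what the induction keeps. *)
Lemma dyadic_contraction2 (f : R -> R -> R) :
  (forall s t, `|f s t| <= 1) ->
  (forall s t, s < 0 -> f s t = 0) -> (forall s t, 1 <= s -> f s t = 0) ->
  (forall s t, t < 0 -> f s t = 0) -> (forall s t, 1 <= t -> f s t = 0) ->
  (forall s t, f s t = 2^-1 * (
     2^-1 * (f (2 * s) (2 * t) + f (2 * s) (2 * t - 1)) +
     2^-1 * (f (2 * s - 1) (2 * t) + f (2 * s - 1) (2 * t - 1)))) ->
  forall s t, f s t = 0.
Proof.
move=> f1 sneg sge1 tneg tge1 fE s t; apply/eqP; rewrite -normr_le0.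
apply: le_expr_half_le0 => n; elim: n s t => [|n IH] s t; first by rewrite expr0.
have n0 : 0 <= 2^-1 ^+ n.+1 :> R by rewrite exprn_ge0 ?invr_ge0.
have [t0|t0] := ltP t 0; first by rewrite tneg ?normr0.
have [t1|t1] := leP 1 t; first by rewrite tge1 ?normr0.
have half a b : `|2^-1 * (f a (2 * b) + f a (2 * b - 1))| <= 2^-1 ^+ n.
  have n1 : 0 <= 2^-1 ^+ n :> R by rewrite exprn_ge0 ?invr_ge0.
  rewrite normrM ger0_norm ?invr_ge0//.
  have [th|th] := ltP (2 * b - 1) 0.
    by rewrite (tneg a (2 * b - 1))// addr0; have := IH a (2 * b); lra.
  rewrite (tge1 a (2 * b)) ?add0r; last by lra.
  by have := IH a (2 * b - 1); lra.
have [s0|s0] := ltP s 0; first by rewrite sneg ?normr0.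
have [s1|s1] := leP 1 s; first by rewrite sge1 ?normr0.
rewrite fE normrM ger0_norm ?invr_ge0// exprS ler_wpM2l ?invr_ge0//.
have [th|th] := ltP (2 * s - 1) 0.
  by rewrite !(sneg (2 * s - 1))// addr0 mulr0 addr0.
by rewrite !(sge1 (2 * s)) ?addr0 ?mulr0 ?add0r//; lra.
Qed.

End dyadic_contraction.

Section joint_law.
Context {R : realType}.
Variable U : probability R R.
Hypothesis UE : forall A, measurable A ->
  U A = lebesgue_measure (A `&` `[0, 1]%classic).

Let D := @doubling R.
Let W := @even_bits R.
Let V := W \o D.
Let M (A : set R) : R := fine (U A).

Let mD : measurable_fun setT D. Proof. exact: measurable_doubling. Qed.
Let mW : measurable_fun setT W. Proof. exact: measurable_even_bits. Qed.
Let mV : measurable_fun setT V. Proof. exact: measurableT_comp. Qed.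

Let mpre (f : R -> R) A : measurable_fun setT f -> measurable A ->
  measurable (f @^-1` A).
Proof. by move=> mf mA; rewrite -[X in measurable X]setTI; exact: mf. Qed.

Let UM A : measurable A -> U A = (M A)%:E.
Proof. by move=> mA; rewrite fineK// fin_num_measure. Qed.

Let M01 A : measurable A -> 0 <= M A <= 1.
Proof.
move=> mA; rewrite fine_ge0//= -lee_fin -UM//; exact: probability_le1.
Qed.

(** Conditioning on the first digit: [E i] is the event seen from the shifted point when that digit
    is [i]. *)
Let M_split A (E : bool -> set R) : measurable A ->
  (forall i, measurable (E i)) ->
  (forall x, A x <-> E (upper_half x) (D x)) ->
  M A = 2^-1 * (M (E false) + M (E true)).
Proof.
move=> mA mE AE; apply: EFin_inj; rewrite -UM//.
have mb i := @measurable_bool_fiber R _ i (@measurable_upper_half R).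
have -> : A = ([set x | upper_half x = false] `&` D @^-1` (E false)) `|`
  ([set x | upper_half x = true] `&` D @^-1` (E true)).
  apply/seteqP; split => x /= => [/AE|].
    by case: (upper_half x) => Ex; [right|left].
  by move=> [|] [bx Ex]; apply/AE; rewrite bx.
rewrite measureU//.
- transitivity (2^-1%:E * U (E false) + 2^-1%:E * U (E true))%E.
    by congr (_ + _)%E; exact: uniform_binary_shift.
  by rewrite !UM// -!EFinM -EFinD mulrDr.
- by apply: measurableI => //; exact: mpre.
- by apply: measurableI => //; exact: mpre.
- by apply/seteqP; split => x //= [[->]] _ [].
Qed.

Let c t := M `]-oo, t]%classic.

Let cE t : c t = 2^-1 * (c (2 * t) + c (2 * t - 1)).
Proof.
rewrite /c (@M_split _ (fun i => `]-oo, 2 * t - i%:R]%classic))//=.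
  by rewrite subr0.
by move=> x /=; rewrite !in_itv/= /D /doubling; split; case: upper_half => /=; lra.
Qed.

Let c_lt0 t : t < 0 -> c t = 0.
Proof. by move=> t0; rewrite /c /M uniform_le0// ltW. Qed.

Let c_ge1 t : 1 <= t -> c t = 1.
Proof. by move=> t0; rewrite /c /M uniform_ge1. Qed.

Lemma even_bits_law A : measurable A -> U (W @^-1` A) = U A.
Proof.
have F t : M (W @^-1` `]-oo, t]) = c t.
  apply/eqP; rewrite -subr_eq0; apply/eqP; move: t.
  apply: (@dyadic_contraction1 R (fun t => M (W @^-1` `]-oo, t]) - c t)).
  - move=> t; have /andP[a0 a1] : 0 <= M (W @^-1` `]-oo, t]) <= 1.
      by apply: M01; exact: mpre.
    have /andP[b0 b1] : 0 <= c t <= 1 by exact: M01.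
    by rewrite ler_norml; apply/andP; split; lra.
  - move=> t t0; rewrite c_lt0// subr0 (_ : _ @^-1` _ = set0) ?/M ?measure0//.
    rewrite -subset0 => x /=; rewrite in_itv/= /W.
    by have /andP[w0 _] := even_bits_01 x; lra.
  - move=> t t1; rewrite c_ge1// (_ : _ @^-1` _ = setT) ?/M ?probability_setT ?subrr//.
    rewrite -subTset => x _ /=; rewrite in_itv/= /W.
    by have /andP[_ w1] := even_bits_01 x; lra.
  (* The digit of rank 1 does not affect [W]; after the split it is removed by the invariance of [U]
     under [D]. *)
  - move=> t; rewrite (@M_split _ (fun i => D @^-1` (W @^-1` `]-oo, 2 * t - i%:R]))).
    + rewrite /M !uniform_doubling//; try exact: mpre.
      by rewrite -!/(M _) cE subr0/=; lra.
    + exact: mpre.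
    + by move=> i; apply: mpre => //; exact: mpre.
    + move=> x /=; rewrite !in_itv/= /W even_bits_shift -/D.
      by split; case: upper_half => /=; lra.
move=> mA; rewrite -[X in U X = _]setTI -[RHS]mul1e.
apply: restricted_law_unique => // t; rewrite setTI mul1e UM; last exact: mpre.
by rewrite F UM.
Qed.

Lemma even_odd_bits_law A B : measurable A -> measurable B ->
  U (W @^-1` A `&` V @^-1` B) = (U A * U B)%E.
Proof.
pose Q s t := W @^-1` `]-oo, s]%classic `&` V @^-1` `]-oo, t]%classic.
have mQ s t : measurable (Q s t) by apply: measurableI; exact: mpre.
have V01 x : 0 <= V x <= 1 by exact: even_bits_01.
have cW t : M (W @^-1` `]-oo, t]) = c t by rewrite /M even_bits_law.
have cV t : M (V @^-1` `]-oo, t]) = c t.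
  rewrite /M /V (_ : _ @^-1` _ = D @^-1` (W @^-1` `]-oo, t]))//.
  by rewrite uniform_doubling ?even_bits_law//; exact: mpre.
have F s t : M (Q s t) = c s * c t.
  apply/eqP; rewrite -subr_eq0; apply/eqP; move: s t.
  apply: (@dyadic_contraction2 R (fun s t => M (Q s t) - c s * c t)).
  - move=> s t; have /andP[a0 a1] : 0 <= M (Q s t) <= 1 by exact: M01.
    have /andP[b0 b1] : 0 <= c s <= 1 by exact: M01.
    have /andP[d0 d1] : 0 <= c t <= 1 by exact: M01.
    have e0 : 0 <= c s * c t by rewrite mulr_ge0.
    have e1 : c s * c t <= 1 by rewrite mulr_ile1.
    by rewrite ler_norml; apply/andP; split; lra.
  - move=> s t s0; rewrite c_lt0// mul0r subr0 (_ : Q s t = set0) ?/M ?measure0//.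
    rewrite -subset0 => x [] /=; rewrite !in_itv/= /W.
    by have /andP[w0 _] := even_bits_01 x; lra.
  - move=> s t s1; rewrite c_ge1// mul1r.
    rewrite (_ : Q s t = V @^-1` `]-oo, t]) ?cV ?subrr//.
    apply/seteqP; split => x /= => [[]//|vx]; split => //=.
    rewrite in_itv/= /W; have /andP[_ w1] := even_bits_01 x; lra.
  - move=> s t t0; rewrite (c_lt0 t0) mulr0 subr0.
    rewrite (_ : Q s t = set0) ?/M ?measure0//.
    rewrite -subset0 => x [] _ /=; rewrite !in_itv/=.
    by have /andP[w0 _] := V01 x; lra.
  - move=> s t t1; rewrite (c_ge1 t1) mulr1.
    rewrite (_ : Q s t = W @^-1` `]-oo, s]) ?cW ?subrr//.
    apply/seteqP; split => x /= => [[]//|wx]; split => //=.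
    rewrite in_itv/=; have /andP[_ w1] := V01 x; lra.
  - move=> s t.
    (* Two digits are peeled off, one for each coordinate. After the first shift [V] turns into [W]
       and the remainder of [W] into [W \o D], whence the intermediate event [E r]; the second shift
       restores the form [Q]. *)
    pose E r := D @^-1` (W @^-1` `]-oo, r]) `&` W @^-1` `]-oo, t].
    have mE r : measurable (E r).
      by apply: measurableI; apply: mpre => //; exact: mpre.
    have ME r : M (E r) = 2^-1 * (M (Q r (2 * t)) + M (Q r (2 * t - 1))).
      rewrite (@M_split _ (fun i => Q r (2 * t - i%:R)))//= ?subr0//.
      move=> x; rewrite /E /Q /= !in_itv/= {2}/W even_bits_shift -/D /V /=.
      split=> -[-> h]; split=> //; move: h; rewrite /W;
        case: upper_half => /=; lra.
    rewrite (@M_split _ (fun i => E (2 * s - i%:R)))//=; last first.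
      move=> x; rewrite /E /Q /= !in_itv/= {1}/W even_bits_shift -/D /V /=.
      split=> -[h ->]; split=> //; move: h; rewrite /W;
        case: upper_half => /=; lra.
    rewrite !subr0 !ME (cE s) (cE t); lra.
(* The product formula passes from half-lines to Borel sets in one coordinate at a time. *)
have half t B' : measurable B' ->
    U (V @^-1` `]-oo, t] `&` W @^-1` B') = ((c t)%:E * U B')%E.
  apply: restricted_law_unique => //; first exact: mpre.
    by have /andP[] : 0 <= c t <= 1 by exact: M01.
  move=> r; rewrite setIC UM; last exact: mQ.
  by rewrite F UM// -EFinM mulrC.
move=> mA mB; rewrite (UM mA).
apply: restricted_law_unique => //; first exact: mpre.
  by have /andP[] := M01 mA.
by move=> t; rewrite setIC half// !UM// muleC.
Qed.

End joint_law.

Lemma measurable_cst_set d (T : measurableType d) (b : bool) :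
  measurable ([set _ | b] : set T).
Proof.
case: b.
- by rewrite (_ : [set _ | _] = setT)//; apply/seteqP; split => x.
- by rewrite (_ : [set _ | _] = set0)//; apply/seteqP; split => x.
Qed.

(** * Independent normal variables *)

Section quantile.
Context {R : realType}.
Variables (U mu : probability R R).
Hypothesis UE : forall A, measurable A ->
  U A = lebesgue_measure (A `&` `[0, 1]%classic).

Let Phi t := fine (mu `]-oo, t]%classic).

Let PhiE t : mu `]-oo, t]%classic = (Phi t)%:E.
Proof. by rewrite fineK// fin_num_measure. Qed.

Let id_rv : {RV mu >-> R} :=
  HB.pack (idfun : R -> R) (isMeasurableFun.Build _ _ R R _ (@measurable_id _ R setT)).

Let cdfE t : cdf id_rv t = (Phi t)%:E.
Proof. by rewrite -PhiE. Qed.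

Let Phi_nd s t : s <= t -> Phi s <= Phi t.
Proof. by move=> st; rewrite -lee_fin -!cdfE; exact: cdf_nondecreasing. Qed.

Let Phi_01 t : 0 <= Phi t <= 1.
Proof. by rewrite -!lee_fin -cdfE cdf_le1 cdf_ge0. Qed.

Let Phi_ge u : u < 1 -> exists t, u <= Phi t.
Proof.
move=> u1; have /fine_cvg : cdf id_rv @ +oo%R --> (1 : R)%:E by exact: cvg_cdfy1.
move=> /cvgr_ge /(_ u u1) [t [_ ut]]; exists (t + 1).
by have := ut (t + 1); rewrite /= cdfE; apply; rewrite ltrDl.
Qed.

Let Phi_lt u : 0 < u -> exists t, Phi t < u.
Proof.
move=> u0; have /fine_cvg : cdf id_rv @ -oo%R --> (0 : R)%:E by exact: cvg_cdfNy0.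
move=> /cvgr_lt /(_ u u0) [t [_ ut]]; exists (t - 1).
by have := ut (t - 1); rewrite /= cdfE; apply; rewrite gtrBl.
Qed.

Let Phi_rc u t : (forall s, t < s -> u <= Phi s) -> u <= Phi t.
Proof.
move=> us; have /fine_cvg : cdf id_rv x @[x --> t^'+] --> (Phi t)%:E.
  by rewrite -cdfE; exact: cdf_right_continuous.
move=> h; rewrite -(cvg_lim _ h)//; apply: limr_ge; first by apply/cvg_ex; exists (Phi t).
by near=> s; rewrite /= cdfE; apply: us; near: s; exact: nbhs_right_gt.
Unshelve. all: by end_near. Qed.

Let q (u : R) : R := if 0 < u < 1 then inf [set x | u <= Phi x] else 0.

(** Galois connection between the quantile and the distribution function; by right continuity of
    [Phi] the infimum is attained. *)
Let q_le u t : 0 < u < 1 -> (q u <= t) = (u <= Phi t).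
Proof.
move=> u01; rewrite /q u01; have /andP[u0 u1] := u01.
have ne : [set x | u <= Phi x] !=set0 by have [x ux] := Phi_ge u1; exists x.
have lb : has_lbound [set x | u <= Phi x].
  have [x xu] := Phi_lt u0; exists x => y /= uy; rewrite leNgt; apply/negP => yx.
  by have := le_lt_trans (le_trans uy (Phi_nd (ltW yx))) xu; rewrite ltxx.
apply/idP/idP => [qt|ut]; last exact: (ge_inf lb).
apply: Phi_rc => s ts.
have : inf [set x | u <= Phi x] < s by exact: le_lt_trans ts.
by move=> /(inf_lt ne)[x /= ux /ltW /Phi_nd]; exact: le_trans.
Qed.

Let m01 : measurable (`]0, 1[%classic : set R). Proof. by []. Qed.

(** The second piece accounts for the default value 0 of [q] off []0, 1[], a null set for [U]. *)
Let q_set t : q @^-1` `]-oo, t] =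
  (`]0, 1[%classic `&` `]-oo, Phi t]%classic) `|`
  (~` `]0, 1[%classic `&` [set _ | 0 <= t]).
Proof.
apply/seteqP; split => u /=; rewrite !in_itv/=.
- case: (boolP (0 < u < 1)) => u01; first by rewrite q_le//; left.
  by rewrite /q (negbTE u01) => t0; right.
- case: (boolP (0 < u < 1)) => u01 => [[[_]|[]//]|[[]//|[_]]].
    by rewrite q_le.
  by rewrite /q (negbTE u01).
Qed.

Let mq_set t : measurable (q @^-1` `]-oo, t]).
Proof.
rewrite q_set; apply: measurableU; first exact: measurableI.
apply: measurableI; first exact: measurableC.
exact: measurable_cst_set.
Qed.

Lemma quantile_exists : exists g : R -> R, measurable_fun setT g /\
  forall A, measurable A -> U (g @^-1` A) = mu A.
Proof.
have mq : measurable_fun setT q.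
  apply: (measurability (@RGenOInfty.G R)).
    exact: RGenOInfty.measurableE.
  move=> _ [_ [r -> <-]]; rewrite setTI.
  by rewrite -setCitvl -preimage_setC; apply: measurableC; exact: mq_set.
exists q; split => // A mA; rewrite -[X in U X = _]setTI -[RHS]mul1e.
apply: restricted_law_unique => // t; rewrite setTI mul1e q_set.
have null : U (~` `]0, 1[%classic) = 0%E.
  rewrite UE; last exact: measurableC.
  apply/eqP; rewrite eq_le measure_ge0 andbT.
  apply: (@le_trans _ _ (lebesgue_measure ([set 0%R; 1%R] : set R))).
    apply: le_measure; rewrite ?inE.
    - by apply: measurableI => //; exact: measurableC.
    - by apply: measurableU.
    - move=> x /=; rewrite !in_itv/= => -[/negP].
      by rewrite negb_and -!leNgt => /orP[x0|x1] /andP[x0' x1'];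
        [left|right]; apply/eqP; rewrite eq_le; apply/andP.
  by rewrite countable_lebesgue_measure0//; exact: finite_set_countable.
have -> : mu `]-oo, t]%classic = U `]-oo, Phi t]%classic.
  by rewrite PhiE uniform_01.
have m0t : measurable ([set _ | 0 <= t] : set R) by exact: measurable_cst_set.
have U0 (B : set R) : measurable B -> U (~` `]0, 1[%classic `&` B) = 0%E.
  move=> mB; apply/eqP; rewrite eq_le measure_ge0 andbT -null.
  apply: le_measure; rewrite ?inE; last by apply: subIsetl.
    by apply: measurableI => //; exact: measurableC.
  exact: measurableC.
rewrite measureU//.
- rewrite [X in (_ + X)%E]U0// adde0.
  have {2}-> : `]-oo, Phi t]%classic = (`]0, 1[%classic `&` `]-oo, Phi t]%classic)
     `|` (~` `]0, 1[%classic `&` `]-oo, Phi t]%classic) :> set R.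
    by rewrite -setIUl setUv setTI.
  rewrite measureU//.
  + by rewrite [X in (_ + X)%E]U0// adde0.
  + exact: measurableI.
  + by apply: measurableI => //; exact: measurableC.
  + by apply/seteqP; split => x //= [[? _] []].
- exact: measurableI.
- by apply: measurableI => //; exact: measurableC.
- by apply/seteqP; split => x //= [[? _] []].
Qed.

End quantile.

(** The pair [(G, V)] sends [P] to the product of [N] and [P]: one normal variable is extracted and
    the remaining randomness is distributed as before. Iterating [V] therefore gives an independent
    sequence without constructing an infinite product measure. *)
Lemma normal_shift_exists (R : realType) :
  exists (P N : probability R R) (G V : R -> R),
  [/\ measurable_fun setT G, measurable_fun setT V,
      forall A, measurable A -> N A = normal_prob 0 1 A &
      forall A B, measurable A -> measurable B ->
        P (G @^-1` A `&` V @^-1` B) = (N A * P B)%E].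
Proof.
have [U UE] := @uniform_law_exists R.
have [N NE] := image_exists (normal_prob 0 1 : probability (measurableTypeR R) R)
  (@measurable_id _ (measurableTypeR R) setT :
  measurable_fun setT (idfun : measurableTypeR R -> R)).
have [g [mg gE]] := quantile_exists N UE.
have mW := @measurable_even_bits R.
exists U, N, (g \o even_bits), (even_bits \o doubling); split.
- exact: measurableT_comp.
- by apply: measurableT_comp => //; exact: measurable_doubling.
- by move=> A mA; rewrite NE.
- move=> A B mA mB; rewrite -gE//.
  rewrite -(even_odd_bits_law UE) //.
  by rewrite -[X in measurable X]setTI; exact: mg.
Qed.

Lemma normal_mgf (R : realType) (N : probability R R) :
  (forall A, measurable A -> N A = normal_prob 0 1 A) ->
  forall a : R, (\int[N]_x (expR (a * x))%:E)%E = (expR (a ^+ 2 / 2))%:E.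
Proof.
move=> NE a.
have imN : is_image (normal_prob 0 1 : probability (measurableTypeR R) R)
    (idfun : measurableTypeR R -> R) N.
  by move=> A mA; rewrite NE.
have mid : measurable_fun setT (idfun : measurableTypeR R -> R).
  exact: (@measurable_id _ (measurableTypeR R) setT).
have mexp : measurable_fun setT (fun x : R => (expR (a * x))%:E).
  by apply/measurable_EFinP; apply: measurableT_comp => //; exact: measurable_funM.
have e0 (x : R) : (0 <= (expR (a * x))%:E)%E by rewrite lee_fin expR_ge0.
move/(is_imageP _ _ mid) : (imN) => ->//.
have [_ _ ->] : has_density (normal_prob 0 1 : probability (measurableTypeR R) R)
    lebesgue_measure (normal_pdf (0 : R) 1).
- apply: density_of_measurable_sets => //.
  + exact: measurable_normal_pdf.
  + by move=> t; exact: normal_pdf_ge0.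
(* Completing the square: [expR (a * x)] times the standard density is [expR (a ^+ 2 / 2)] times the
   normal density centred at [a], which integrates to 1. *)
- have -> : (expR (a ^+ 2 / 2))%:E =
      ((expR (a ^+ 2 / 2))%:E * \int[lebesgue_measure]_x (normal_pdf a 1 x)%:E)%E.
    by rewrite integral_normal_pdf mule1.
  rewrite -ge0_integralZl//.
  + apply: eq_integral => x _; rewrite -!EFinM; congr EFin.
    rewrite !normal_pdfE ?oner_neq0//= /normal_fun.
    rewrite mulrCA [RHS]mulrCA; congr (_ * _); rewrite -!expRD; congr expR.
    by field.
  + by apply/measurable_EFinP; exact: measurable_normal_pdf.
  + by move=> x _; rewrite lee_fin normal_pdf_ge0.
- exact: (measurableT_comp mexp mid).
- by move=> t; exact: e0.
Qed.

(** * The independent sequence generated by a measure-preserving shift *)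

Section shift_sequence.
Local Open Scope ereal_scope.
Context d (S : measurableType d) (R : realType).
Variables (P : probability S R) (N : probability R R) (G : S -> R) (V : S -> S).
Hypotheses (mG : measurable_fun setT G) (mV : measurable_fun setT V).
Hypothesis GV : forall A B, measurable A -> measurable B ->
  P (G @^-1` A `&` V @^-1` B) = N A * P B.

Definition shift_seq (k : nat) (w : S) : R := G (iter k V w).

Lemma measurable_iter_shift k : measurable_fun setT (iter k V).
Proof.
elim: k => [|k IH]; first exact: measurable_id.
exact: (measurableT_comp mV IH).
Qed.

Lemma measurable_shift_seq k : measurable_fun setT (shift_seq k).
Proof. exact: (measurableT_comp mG (measurable_iter_shift k)). Qed.

Lemma shift_image : is_image P (fun w => (G w, V w)) (product_probability N P).
Proof.
have mGV : measurable_fun setT (fun w => (G w, V w)) by exact: measurable_fun_pair.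
have [Q QE] := image_exists P mGV.
move=> A mA; rewrite -QE//.
apply: (@product_measure_unique _ _ _ _ R N P Q) => // B C mB mC.
by rewrite [LHS]QE ?GV//; exact: measurableX.
Qed.

Lemma shift_integral (F : R * S -> \bar R) : measurable_fun setT F ->
  (forall t, 0 <= F t) ->
  \int[P]_w F (G w, V w) = \int[product_probability N P]_t F t.
Proof.
move=> mF F0.
have mGV : measurable_fun setT (fun w => (G w, V w)) by exact: measurable_fun_pair.
by move/(is_imageP _ _ mGV) : shift_image => ->.
Qed.

Lemma shift_measure_preserving B : measurable B -> P (V @^-1` B) = P B.
Proof.
by move=> mB; rewrite -[RHS]mul1e -(probability_setT N) -GV// preimage_setT setTI.
Qed.

(** [shift_seq k.+1] is [shift_seq k] after [V], so all factors but the first are functions of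
    [V w], which is independent of [G w] and has law [P] again. *)
Lemma shift_seq_integral_prod n (F : nat -> R -> R) :
  (forall k, measurable_fun setT (F k)) -> (forall k t, (0 <= F k t)%R) ->
  \int[P]_w (\prod_(k < n) F k (shift_seq k w))%:E =
  \prod_(k < n) \int[N]_x (F k x)%:E.
Proof.
move=> + + ; elim: n F => [|n IH] F mF F0.
  under eq_integral do rewrite big_ord0.
  by rewrite big_ord0 integral1.
have mprod : measurable_fun setT (fun w => \prod_(k < n) F k.+1 (shift_seq k w))%R.
  apply: measurable_prod => k _.
  exact: (measurableT_comp (mF k.+1) (measurable_shift_seq k)).
have prod0 w : (0 <= \prod_(k < n) F k.+1 (shift_seq k w))%R.
  by apply: prodr_ge0.
rewrite big_ord_recl -(IH (fun k => F k.+1))//.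
have mF0 : measurable_fun setT (EFin \o F 0%N) by exact/measurable_EFinP.
have mFS : measurable_fun setT (fun w => (\prod_(k < n) F k.+1 (shift_seq k w))%:E).
  exact/measurable_EFinP.
have F00 t : 0 <= (EFin \o F 0%N) t by rewrite lee_fin.
have FS0 w : 0 <= (\prod_(k < n) F k.+1 (shift_seq k w))%:E by rewrite lee_fin.
rewrite -(integral_product_mul N P mF0 mFS F00 FS0).
rewrite -(shift_integral (F := fun t => ((EFin \o F 0%N) t.1 *
    (\prod_(k < n) F k.+1 (shift_seq k t.2))%:E)))//; last 2 first.
- apply: emeasurable_funM.
  + exact: (measurableT_comp mF0 (@measurable_fst _ _ R S)).
  + exact: (measurableT_comp mFS (@measurable_snd _ _ R S)).
- by move=> t; rewrite mule_ge0.
apply: eq_integral => w _; rewrite big_ord_recl EFinM; congr (_ * _%:E).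
by apply: eq_bigr => k _; rewrite /shift_seq /= -iterSr.
Qed.

End shift_sequence.

(** The quantifiers of the Cauchy criterion are made countable, so that the set of convergence of
    measurable functions is measurable. *)
Lemma cvgn_cauchyP (R : realType) (u : R^nat) :
  cvgn u <-> forall j, exists m, forall k, `|u (m + k)%N - u m| < j.+1%:R^-1.
Proof.
split=> [cu j|cu].
- have e0 : 0 < (j.+1%:R^-1 : R) / 2 by rewrite divr_gt0.
  have /cvgrPdist_lt/(_ _ e0)[m _ um] := cu.
  exists m => k; have h1 := um m (leqnn m).
  have h2 := um (m + k)%N (leq_addr _ _); rewrite /= in h1 h2.
  rewrite (_ : _ - _ = (limn u - u m) - (limn u - u (m + k)%N)); last by ring.
  apply: le_lt_trans (ler_normB _ _) _.
  by rewrite [ltRHS]splitr ltrD.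
- apply/cauchy_cvgP; apply: cauchy_exP => e e0.
  have [j je] : exists j, j.+1%:R^-1 < e.
    exists (Num.truncn e^-1); rewrite invf_plt ?posrE//.
    exact: truncnS_gt.
  have [m um] := cu j; exists (u m); exists m => // n /= mn.
  rewrite /ball /= distrC; apply: lt_trans je.
  by rewrite -(subnKC mn); exact: um.
Qed.

Lemma measurable_pred_set d (T : measurableType d) (p : T -> bool) :
  measurable_fun setT p -> measurable [set t | p t].
Proof.
move=> mp; rewrite (_ : [set t | p t] = setT `&` p @^-1` [set true]).
  exact: mp.
by rewrite setTI.
Qed.

(** Off the set of convergence [limn] is the default value 0, which is also the limit of [f n] times
    the indicator of that set. *)
Lemma measurable_limn d (T : measurableType d) (R : realType)
    (f : nat -> T -> R) : (forall n, measurable_fun setT (f n)) ->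
  measurable [set t | cvgn (f ^~ t)] /\
  measurable_fun setT (fun t => limn (f ^~ t)).
Proof.
move=> mf.
have mC : measurable [set t | cvgn (f ^~ t)].
  rewrite (_ : [set t | _] = \bigcap_j \bigcup_m \bigcap_k
      [set t | `|f (m + k)%N t - f m t| < j.+1%:R^-1]); last first.
    apply/seteqP; split => t /= => [/cvgn_cauchyP ct j _|ct].
      by have [m mt] := ct j; exists m => // k _; exact: mt.
    by apply/cvgn_cauchyP => j; have [m _ mt] := ct j I; exists m => k; exact: mt.
  apply: bigcapT_measurable => j; apply: bigcupT_measurable => m.
  apply: bigcapT_measurable => k.
  apply: measurable_pred_set; apply: measurable_fun_ltr => //.
  by apply: measurableT_comp => //; exact: measurable_funB.
split => //.
apply: (@measurable_fun_cvg _ _ _ _ (fun n t => f n t * \1_[set t | cvgn (f ^~ t)] t)).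
  by move=> n; apply: measurable_funM => //; exact: measurable_indic.
move=> t _; rewrite indicE; have [/set_mem/= ct|/negP ct] := boolP (t \in _).
  by under eq_fun do rewrite mulr1.
under eq_fun do rewrite mulr0.
by rewrite dvgP; [exact: cvg_cst|move=> ct'; apply: ct; rewrite inE].
Qed.

(** * Gaussian random series: maximal inequality, almost sure convergence, exponential moment *)

Section shift_gaussian.
Local Open Scope ereal_scope.
Context d (S : measurableType d) (R : realType).
Variables (P : probability S R) (N : probability R R) (G : S -> R) (V : S -> S).
Hypotheses (mG : measurable_fun setT G) (mV : measurable_fun setT V).
Hypothesis GV : forall A B, measurable A -> measurable B ->
  P (G @^-1` A `&` V @^-1` B) = N A * P B.
Hypothesis mgf : forall a : R,
  \int[N]_x (expR (a * x))%:E = (expR (a ^+ 2 / 2))%:E.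

Let xi := shift_seq G V.

Definition shift_sum (a : nat -> R) (n : nat) (w : S) : R :=
  (\sum_(0 <= k < n) a k * xi k w)%R.

Let mxi k : measurable_fun setT (xi k).
Proof. exact: measurable_shift_seq. Qed.

Lemma measurable_shift_sum a n : measurable_fun setT (shift_sum a n).
Proof. by apply: measurable_sum => k; exact: measurable_funM. Qed.

Lemma shift_cylinder (J : seq nat) (A : nat -> set R) : uniq J ->
  (forall k, measurable (A k)) ->
  P [set w | forall k, k \in J -> A k (xi k w)] = \prod_(k <- J) N (A k).
Proof.
move=> uJ mA; pose n := (\max_(k <- J) k).+1.
have Jn k : k \in J -> (k < n)%N by move=> kJ; rewrite ltnS; exact: leq_bigmax_seq.
pose F k : R -> R := if k \in J then \1_(A k) else cst 1%R.
have mF k : measurable_fun setT (F k).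
  by rewrite /F; case: ifP => _ //; exact: measurable_indic.
have F0 k t : (0 <= F k t)%R by rewrite /F; case: ifP.
have := @shift_seq_integral_prod _ S R P N G V mG mV GV n F mF F0.
rewrite -(big_mkord xpredT (fun k => \int[N]_x (F k x)%:E)).
have -> : \prod_(0 <= k < n) \int[N]_x (F k x)%:E = \prod_(k <- J) N (A k).
  rewrite (bigID (fun k => k \in J))/= [X in _ * X]big1 ?mule1; last first.
    by move=> k /negbTE kJ; rewrite /F kJ integral1.
  rewrite -big_filter.
  have pJ : perm_eq J [seq i <- index_iota 0 n | i \in J].
    apply: uniq_perm => //; first by rewrite filter_uniq ?iota_uniq.
    move=> k; rewrite mem_filter mem_index_iota leq0n /=.
    by case: (boolP (k \in J)) => //= /Jn ->.
  rewrite -(perm_big _ pJ)/=.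
  apply: eq_big_seq => k kJ; rewrite /F kJ.
  by rewrite integral_indic// setIT.
move=> <-.
have mE : measurable [set w | forall k, k \in J -> A k (xi k w)].
  rewrite (_ : [set w | _] = \bigcap_(k in [set k | k \in J]) xi k @^-1` A k)//.
  apply: bigcap_measurableType => k _.
  by rewrite -[X in measurable X]setTI; exact: mxi.
transitivity (\int[P]_w (\1_[set w | forall k, k \in J -> A k (xi k w)] w)%:E).
  by rewrite integral_indic// setIT.
apply: eq_integral => w _; congr EFin; rewrite indicE.
have [/set_mem/= h|/negP h] := boolP (w \in _).
  rewrite big1// => k _; rewrite /F; case: ifPn => // kJ.
  by rewrite indicE mem_set//; exact: h.
apply/esym/eqP/prodf_eq0.
have [k kJ Ak] : exists2 k, k \in J & ~ A k (xi k w).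
  apply: contrapT => h'; apply: h; rewrite inE => k kJ.
  by apply: contrapT => Ak; apply: h'; exists k.
exists (Ordinal (Jn _ kJ)) => //=; rewrite /F kJ indicE.
by rewrite memNset.
Qed.

Lemma shift_sum_mgf (a : nat -> R) n :
  \int[P]_w (expR (shift_sum a n w))%:E =
  (expR ((\sum_(0 <= k < n) a k ^+ 2) / 2))%:E.
Proof.
pose F k (x : R) := expR (a k * x).
have mF k : measurable_fun setT (F k).
  by apply: measurableT_comp => //; exact: measurable_funM.
have F0 k t : (0 <= F k t)%R by rewrite expR_ge0.
have := @shift_seq_integral_prod _ S R P N G V mG mV GV n F mF F0.
under eq_integral do rewrite -expR_sum -(big_mkord xpredT (fun k => a k * xi k _)%R).
move=> ->; under eq_bigr do rewrite mgf.
rewrite mulr_suml expR_sum big_mkord.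
by elim/big_ind2 : _ => // x1 x2 y1 y2 -> ->.
Qed.

Lemma shift_sum_recl (a : nat -> R) n w :
  shift_sum a n.+1 w = (a 0%N * G w + shift_sum (fun k => a k.+1) n (V w))%R.
Proof.
rewrite /shift_sum big_nat_recl//; congr (_ + _)%R.
by apply: eq_bigr => k _; rewrite /xi /shift_seq iterSr.
Qed.

Lemma sum_nat_addn_sub (u : nat -> R) m k :
  (\sum_(0 <= i < m + k) u i - \sum_(0 <= i < m) u i =
   \sum_(0 <= i < k) u (m + i)%N)%R.
Proof.
elim: k => [|k IH]; first by rewrite addn0 subrr big_nil.
by rewrite addnS !big_nat_recr//= -IH addrAC.
Qed.

Lemma shift_sum_addn (a : nat -> R) m k w :
  (shift_sum a (m + k) w - shift_sum a m w)%R =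
  shift_sum (fun j => a (m + j)%N) k (iter m V w).
Proof.
elim: k => [|k IH]; first by rewrite addn0 subrr /shift_sum big_nil.
rewrite addnS /shift_sum !big_nat_recr//= -/(shift_sum _ _ _) -/(shift_sum _ _ _).
rewrite -/(shift_sum (fun j => a (m + j)%N) k (iter m V w)) -IH addrAC.
by congr (_ + _ * _)%R; rewrite /xi /shift_seq addnC iterD.
Qed.

Let exceeds (t : R) a n x := [set w | exists2 k, (k <= n)%N & (t <= `|x + shift_sum a k w|)%R].

Let measurable_exceeds d' (T : measurableType d') (t : R) n (f : nat -> T -> R) :
  (forall k, measurable_fun setT (f k)) ->
  measurable [set w | exists2 k, (k <= n)%N & (t <= `|f k w|)%R].
Proof.
move=> mf.
rewrite (_ : [set w | _] = \bigcup_(k in [set k | (k <= n)%N]) [set w | (t <= `|f k w|)%R])//.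
apply: bigcup_measurable => k _; apply: measurable_pred_set.
by apply: measurable_fun_ler => //; exact: measurableT_comp.
Qed.

(* The exponential [expR (theta * y) + expR (- (theta * y))] of the walk,
   suitably discounted, is a martingale; conditioning on the first step turns
   Doob's inequality into an induction on the number of steps. *)
Lemma shift_sum_maximal (theta t : R) (n : nat) (a : nat -> R) (x : R) :
  (0 <= theta)%R ->
  P (exceeds t a n x) <=
  ((expR (theta * x) + expR (- (theta * x))) *
   expR (theta ^+ 2 / 2 * \sum_(0 <= k < n) a k ^+ 2) * expR (- (theta * t)))%:E.
Proof.
move=> theta0.
have mexc n' a' x' : measurable (exceeds t a' n' x').
  apply: (@measurable_exceeds _ _ t n' (fun k w => x' + shift_sum a' k w)%R) => k.
  by apply: measurable_funD => //; exact: measurable_shift_sum.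
(* For a starting point already at distance [t] from 0 the right-hand side is at least 1. *)
have big n' a' x' : (t <= `|x'|)%R -> P (exceeds t a' n' x') <=
  ((expR (theta * x') + expR (- (theta * x'))) *
   expR (theta ^+ 2 / 2 * \sum_(0 <= k < n') a' k ^+ 2) * expR (- (theta * t)))%:E.
  move=> tx; apply: (le_trans (probability_le1 P (mexc _ _ _))).
  rewrite lee_fin -mulrA mulrCA -[leLHS]mulr1 ler_pM//.
    rewrite -expR0 ler_expR mulr_ge0//; first by rewrite divr_ge0 ?sqr_ge0.
    by apply: sumr_ge0 => k _; exact: sqr_ge0.
  rewrite mulrDl -!expRD.
  have [x0|x0] := leP 0%R x'.
    rewrite ger0_norm// in tx.
    apply: (@le_trans _ _ (expR (theta * x' + - (theta * t)))); last by rewrite lerDl expR_ge0.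
    by rewrite -[leLHS]expR0 ler_expR subr_ge0 ler_wpM2l.
  rewrite ltr0_norm// in tx.
  apply: (@le_trans _ _ (expR (- (theta * x') + - (theta * t)))); last by rewrite lerDr expR_ge0.
  by rewrite -[leLHS]expR0 ler_expR subr_ge0 -mulrN ler_wpM2l.
elim: n a x => [|n IH] a x.
  have [tx|tx] := leP t `|x|%R; first exact: big.
  rewrite (_ : exceeds t a 0 x = set0) ?measure0 ?lee_fin ?mulr_ge0 ?addr_ge0 ?expR_ge0//.
  rewrite -subset0 => w /= [k]; rewrite leqn0 => /eqP ->.
  by rewrite /shift_sum big_nil addr0 leNgt tx.
have [tx|tx] := leP t `|x|%R; first exact: big.
pose a' k := a k.+1.
pose E := [set p : R * S | exists2 k, (k <= n)%N &
  (t <= `|x + a 0%N * p.1 + shift_sum a' k p.2|)%R].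
have mE : measurable E.
  apply: (@measurable_exceeds _ _ t n
    (fun k p => x + a 0%N * p.1 + shift_sum a' k p.2)%R) => k.
  apply: measurable_funD.
    by apply: measurable_funD => //; exact: measurable_funM.
  exact: (measurableT_comp (measurable_shift_sum a' k) (@measurable_snd _ _ R S)).
have -> : exceeds t a n.+1 x = (fun w => (G w, V w)) @^-1` E.
  apply/seteqP; split => w /=.
    move=> [[|k]]; first by move=> _; rewrite /shift_sum big_nil addr0 leNgt tx.
    by rewrite ltnS => kn; rewrite shift_sum_recl addrA; exists k.
  move=> [k kn]; exists k.+1 => //.
  by rewrite shift_sum_recl addrA.
have /= <- := shift_image mG mV GV mE.
pose C := (expR (theta ^+ 2 / 2 * \sum_(0 <= k < n) a' k ^+ 2) * expR (- (theta * t)))%R.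
have C0 : (0 <= C)%R by rewrite mulr_ge0 ?expR_ge0.
apply: (@le_trans _ _ (\int[N]_y ((expR (theta * (x + a 0%N * y)) +
   expR (- (theta * (x + a 0%N * y)))) * C)%:E)).
  apply: ge0_le_integral => //.
  - exact: measurable_fun_xsection.
  - apply/measurable_EFinP; apply: measurable_funM => //; apply: measurable_funD;
    apply: measurableT_comp => //; last apply: measurable_funN;
    apply: measurable_funM => //; apply: measurable_funD => //; exact: measurable_funM.
  - move=> y _; rewrite [leLHS](_ : _ = P (exceeds t a' n (x + a 0%N * y)%R)).
      by rewrite mulrA; exact: IH.
    congr (P _); apply/seteqP; split => w /=; rewrite /xsection /=.
      by rewrite inE.
    by rewrite inE.
(* Averaging both exponentials over the first normal step produces [expR ((theta * a 0) ^+ 2 / 2)],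
   the missing term of the sum of squares. *)
have -> : (fun y => ((expR (theta * (x + a 0%N * y)) +
   expR (- (theta * (x + a 0%N * y)))) * C)%:E) =
  (fun y => (C * expR (theta * x))%:E * (expR (theta * a 0%N * y))%:E +
            (C * expR (- (theta * x)))%:E * (expR (- (theta * a 0%N) * y))%:E).
  apply/funext => y; rewrite -!EFinM -EFinD; congr EFin.
  have -> : (theta * (x + a 0%N * y) = theta * x + theta * a 0%N * y)%R by ring.
  by rewrite opprD !expRD mulNr; ring.
have me b : measurable_fun setT (fun y : R => (expR (b * y))%:E).
  by apply/measurable_EFinP; apply: measurableT_comp => //; exact: measurable_funM.
have e0 b r y : 0 <= (C * expR b)%:E * (expR (r * y))%:E.
  by rewrite -EFinM lee_fin !mulr_ge0 ?expR_ge0.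
rewrite ge0_integralD//; try by apply: emeasurable_funM.
rewrite !ge0_integralZl//; try by rewrite lee_fin ?mulr_ge0 ?expR_ge0.
rewrite !mgf -!EFinM -EFinD lee_fin sqrrN -mulrDl -mulrDr.
rewrite big_nat_recl// -/(a' _).
rewrite (_ : theta ^+ 2 / 2 * (a 0%N ^+ 2 + \sum_(0 <= k < n) a k.+1 ^+ 2) =
  (theta * a 0%N) ^+ 2 / 2 + theta ^+ 2 / 2 * \sum_(0 <= k < n) a' k ^+ 2)%R; last first.
  by rewrite /a'; field.
by rewrite expRD /C le_eqVlt; apply/orP; left; apply/eqP; ring.
Qed.

Lemma iter_shift_measure_preserving m B : measurable B ->
  P (iter m V @^-1` B) = P B.
Proof.
elim: m B => [//|m IH] B mB.
have mVB : measurable (V @^-1` B) by rewrite -[X in measurable X]setTI; exact: mV.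
by rewrite -[RHS](shift_measure_preserving GV mB) -(IH _ mVB).
Qed.

Lemma shift_sum_ever_exceeds (theta t eta : R) (a : nat -> R) :
  (0 <= theta)%R -> (forall n, \sum_(0 <= k < n) a k ^+ 2 <= eta)%R ->
  P [set w | exists k, (t <= `|shift_sum a k w|)%R] <=
  (2 * expR (theta ^+ 2 / 2 * eta) * expR (- (theta * t)))%:E.
Proof.
move=> theta0 a_eta.
have mexc n : measurable (exceeds t a n 0).
  apply: (@measurable_exceeds _ _ t n (fun k w => 0 + shift_sum a k w)%R) => k.
  by apply: measurable_funD => //; exact: measurable_shift_sum.
have -> : [set w | exists k, (t <= `|shift_sum a k w|)%R] = \bigcup_n exceeds t a n 0.
  apply/seteqP; split => w /=.
    by move=> [k tk]; exists k => //; exists k => //; rewrite add0r.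
  by move=> [n _ [k _]]; rewrite add0r => tk; exists k.
have h : P (exceeds t a n 0%R) @[n --> \oo] --> P (\bigcup_n exceeds t a n 0).
  apply: nondecreasing_cvg_mu => //; first exact: bigcupT_measurable.
  move=> m n mn; apply/subsetPset => w /= [k km tk]; exists k => //.
  exact: leq_trans mn.
rewrite -(cvg_lim _ h)//; apply: lime_le; first by apply/cvg_ex; eexists; exact: h.
apply: nearW => n; apply: le_trans (shift_sum_maximal t n a 0 theta0) _.
rewrite lee_fin mulr0 oppr0 expR0 ler_pM2r ?expR_gt0// ler_pM2l// ler_expR.
by rewrite ler_wpM2l// divr_ge0// sqr_ge0.
Qed.

(** After time [m] the walk moves like a walk with coefficients [a (m + i)], and [bad j m] is the
    event that it ever gets [1 / (j + 1)] away from its position at time [m]. The maximal inequality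
    makes this event unlikely once the tail of the squares is small. *)
Lemma shift_sum_cvg (a : nat -> R) :
  cvgn (fun n => \sum_(0 <= k < n) a k ^+ 2)%R ->
  {ae P, forall w, cvgn (shift_sum a ^~ w)}.
Proof.
move=> /cvgn_cauchyP ca.
pose bad j m := [set w | exists k, ((j.+1%:R : R)^-1 <= `|shift_sum a (m + k) w - shift_sum a m w|)%R].
have mever t a' : measurable [set w | exists k, (t <= `|shift_sum a' k w|)%R].
  rewrite (_ : [set w | _] = \bigcup_k [set w | (t <= `|shift_sum a' k w|)%R]); last first.
    by apply/seteqP; split => w /= [k]; [exists k|exists k].
  apply: bigcupT_measurable => k; apply: measurable_pred_set.
  apply: measurable_fun_ler => //; apply: measurableT_comp => //.
  exact: measurable_shift_sum.
have badE j m : bad j m = iter m V @^-1` [set w | exists k,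
    ((j.+1%:R : R)^-1 <= `|shift_sum (fun i => a (m + i)%N) k w|)%R].
  by apply/seteqP; split => w /= [k jk]; exists k; rewrite shift_sum_addn in jk *.
have mbad j m : measurable (bad j m).
  rewrite badE -[X in measurable X]setTI; exact: measurable_iter_shift.
(* By the Cauchy criterion, divergence means that some [j] is bad for every [m]. *)
apply: (@negligibleS _ _ _ P (\bigcup_j \bigcap_m bad j m)).
  move=> w /= /cvgn_cauchyP/existsNP[j /forallNP nj]; exists j => // m _.
  by have /existsNP[k /negP] := nj m; rewrite -leNgt => ?; exists k.
apply: negligible_bigcup => j; apply/negligibleP.
  by apply: bigcapT_measurable => m.
apply/eqP; rewrite eq_le measure_ge0 andbT.
apply/lee_addgt0Pr => e e0; rewrite add0e.
set t := (j.+1%:R^-1 : R)%R; have t0 : (0 < t)%R by rewrite invr_gt0.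
(* The level [t] is fixed while the tail of the squares is at our disposal: [theta] is chosen first,
   with [expR (1 - theta * t) <= e / 2], and then [m] so that [theta ^+ 2 / 2] times the tail sum is
   at most 1. *)
pose theta : R := (Num.max 0 ((1 - ln (e / 2)) / t))%R.
have theta0 : (0 <= theta)%R by rewrite le_max lexx.
have theta_e : (expR (1 - theta * t) <= e / 2)%R.
  rewrite -[leRHS]lnK ?posrE ?divr_gt0// ler_expR lerBlDr -lerBlDl.
  by rewrite -ler_pdivrMr// le_max lexx orbT.
have [m mk] := ca (Num.truncn (theta ^+ 2 / 2)%R).
apply: (@le_trans _ _ (P (bad j m))).
  by apply: le_measure; rewrite ?inE//; [exact: bigcapT_measurable|exact: bigcap_inf].
rewrite badE iter_shift_measure_preserving//.
apply: le_trans (@shift_sum_ever_exceeds theta t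
   (Num.truncn (theta ^+ 2 / 2)%R).+1%:R^-1 _ theta0 _) _.
  move=> n; rewrite -(sum_nat_addn_sub (fun k => a k ^+ 2)%R); apply: le_trans (ler_norm _) _.
  exact/ltW/mk.
rewrite lee_fin; apply: (@le_trans _ _ (2 * expR (1 - theta * t))%R); last first.
  by rewrite mulrC -ler_pdivlMr.
rewrite expRD mulrA ler_pM2r ?expR_gt0// ler_pM2l// ler_expR.
by rewrite ler_pdivrMr// mul1r ltW// truncnS_gt.
Qed.

(* Fatou's lemma applied to the squares [(M_n - t) ^ 2], for all real [t], is
   enough to pass to the limit in the expectation of [M_n := expR S_n]. *)
Lemma shift_sum_lim_mgf (a : nat -> R) :
  cvgn (fun n => \sum_(0 <= k < n) a k ^+ 2)%R ->
  \int[P]_w (expR (limn (shift_sum a ^~ w)))%:E =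
  (expR (limn (fun n => \sum_(0 <= k < n) a k ^+ 2)%R / 2))%:E.
Proof.
pose s n := (\sum_(0 <= k < n) a k ^+ 2)%R.
move=> ca; rewrite -/s; pose sigma := limn s.
pose M n w := expR (shift_sum a n w).
pose M' w := expR (limn (shift_sum a ^~ w)).
have mM n : measurable_fun setT (M n).
  by apply: measurableT_comp => //; exact: measurable_shift_sum.
have mM' : measurable_fun setT M'.
  apply: measurableT_comp => //.
  by have [] := measurable_limn (measurable_shift_sum a).
have iM n : \int[P]_w (M n w)%:E = (expR (s n / 2))%:E by exact: shift_sum_mgf.
have iM2 n : \int[P]_w (M n w ^+ 2)%:E = (expR (2 * s n))%:E.
  transitivity (\int[P]_w (expR (shift_sum (fun k => 2 * a k)%R n w))%:E).
    apply: eq_integral => w _; congr EFin; rewrite /M -expRM_natl; congr expR.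
    by rewrite /shift_sum mulr_sumr; apply: eq_bigr => k _; rewrite mulrA.
  rewrite shift_sum_mgf; congr (_ %:E); congr expR.
  rewrite /s mulr_suml mulr_sumr; apply: eq_bigr => k _.
  by rewrite /=; lra.
have IM n : P.-integrable setT (EFin \o M n).
  apply: ge0_integrable => //; first by move=> w; exact: expR_ge0.
  by rewrite iM ltry.
have IM2 n : P.-integrable setT (EFin \o (fun w => M n w ^+ 2)%R).
  apply: ge0_integrable; [exact: measurable_funX|by move=> w; exact: sqr_ge0|].
  by rewrite iM2 ltry.
have Icst (t : R) : P.-integrable setT (EFin \o cst t).
  exact: finite_measure_integrable_cst.
have sqrE (f : S -> R) t : P.-integrable setT (EFin \o f) ->
    P.-integrable setT (EFin \o (fun w => f w ^+ 2)%R) ->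
    \int[P]_w ((f w - t) ^+ 2)%:E =
    (\int[P]_w f w ^+ 2 + (- (2 * t) * \int[P]_w f w + t ^+ 2))%:E.
  move=> If If2.
  rewrite (_ : (fun w => ((f w - t) ^+ 2)%:E) =
     EFin \o (fun w => f w ^+ 2 + (- (2 * t) * f w + t ^+ 2))%R); last first.
    by apply/funext => w /=; congr EFin; ring.
  have If1 := integrable_EFinZ (- (2 * t))%R If.
  have If0 := integrable_EFinD If1 (Icst (t ^+ 2)%R).
  rewrite [LHS]EFin_Rintegral; last exact: integrable_EFinD.
  rewrite (RintegralD measurableT If2 If0).
  rewrite (RintegralD measurableT If1 (Icst _)) (RintegralZl _ measurableT If).
  rewrite (_ : (\int[P]_w cst (t ^+ 2) w)%R = t ^+ 2)%R//.
  rewrite Rintegral_cst// (_ : fine _ = 1%R) ?mulr1//.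
  by rewrite (_ : _ setT = 1)//; exact: probability_setT.
have fat t : \int[P]_w ((M' w - t) ^+ 2)%:E <=
    (expR (2 * sigma) + (- (2 * t) * expR (sigma / 2) + t ^+ 2))%:E.
  have mMt n : measurable_fun setT (fun w => ((M n w - t) ^+ 2)%:E).
    by apply/measurable_EFinP; apply: measurable_funX; exact: measurable_funB.
  have lim_ : \int[P]_w ((M n w - t) ^+ 2)%:E @[n --> \oo] -->
      (expR (2 * sigma) + (- (2 * t) * expR (sigma / 2) + t ^+ 2))%:E.
    under eq_fun do rewrite sqrE// /Rintegral iM iM2/=.
    apply: cvg_EFin; first exact: nearW.
    apply: cvgD.
      by apply: (cvg_comp _ expR); [apply: cvgMl_tmp|exact: continuous_expR].
    apply: cvgD; last exact: cvg_cst.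
    apply: cvgMl_tmp.
    by apply: (cvg_comp _ expR); [apply: cvgMr_tmp|exact: continuous_expR].
  have := @fatou _ _ _ P _ measurableT _ mMt (fun n w _ => sqr_ge0 _).
  rewrite (cvg_limn_einf_sup lim_).1; apply: le_trans.
  rewrite le_eqVlt; apply/orP; left; apply/eqP.
  apply: ae_eq_integral => //.
  - by apply/measurable_EFinP; apply: measurable_funX; exact: measurable_funB.
  - apply: measurableT_comp => //; apply: measurable_fun_limn_esup => n.
    exact: measurableT_comp.
  have := shift_sum_cvg ca; apply: filterS => w cw _; apply/esym.
  have /cvg_limn_einf_sup[] // : ((M n w - t) ^+ 2)%:E @[n --> \oo] --> ((M' w - t) ^+ 2)%:E.
  apply: cvg_EFin; first exact: nearW.
  rewrite expr2; under eq_fun do rewrite /= expr2.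
  have h : (M n w - t)%R @[n --> \oo] --> (M' w - t)%R.
    apply: cvgB; last exact: cvg_cst.
    by apply: (cvg_comp _ expR); [exact: cw|exact: continuous_expR].
  exact: cvgM.
have IM2' : P.-integrable setT (EFin \o (fun w => M' w ^+ 2)%R).
  apply: ge0_integrable; [exact: measurable_funX|by move=> w; exact: sqr_ge0|].
  under eq_integral do rewrite -[X in (X ^+ 2)%:E]subr0.
  by apply: le_lt_trans (fat 0%R) _; exact: ltry.
have IM' : P.-integrable setT (EFin \o M').
  apply: (@integrable_sandwich _ _ _ _ (cst 0%R) _ (fun w => 1 + M' w ^+ 2)%R) => //.
  - exact: (integrable_EFinD (Icst 1%R)).
  - move=> w /=; rewrite expR_ge0/=.
    have := sqr_ge0 (M' w - 1); have := expR_ge0 (limn (shift_sum a ^~ w)).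
    rewrite -/(M' w); nra.
rewrite [LHS]EFin_Rintegral//; congr EFin.
set E := (\int[P]_w M' w)%R; apply/eqP; rewrite -subr_eq0; apply/negP => /negP Em.
pose Q := (\int[P]_w M' w ^+ 2)%R.
(* Expanded, [fat t] says [Q - expR (2 * sigma) <= 2 * t * (E - expR (sigma / 2))]. If the last
   factor were nonzero, this [t] would make the right-hand side smaller than the left-hand side by
   1. *)
have := fat ((Q - expR (2 * sigma) - 1) / (2 * (E - expR (sigma / 2))))%R.
rewrite sqrE// lee_fin -/E -/Q; set t := (_ / _)%R.
have tE : (2 * t * (E - expR (sigma / 2)) = Q - expR (2 * sigma) - 1)%R.
  by rewrite /t; field.
lra.
Qed.

End shift_gaussian.

(** * Countable products of lines *)

Lemma continuous_borel_measurable (R : realType) (T : ptopologicalType) (f : T -> R) :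
  continuous f -> measurable_fun setT (f : borel T -> R).
Proof.
move=> cf; apply: (@measurability _ _ (borel T) R setT f _ (RGenOInfty.measurableE R)).
move=> _ [_ [a ->] <-]; rewrite setTI; apply: sub_sigma_algebra.
by apply: open_comp => // z _; exact: cf.
Qed.

Section real_product_topology.
Context (R : realType) (I : countType).
Local Notation RI := (real_product R I).

Lemma real_product_coord_continuous i : continuous (fun y : RI => y i).
Proof. exact: (@proj_continuous I (fun=> R) i). Qed.

Lemma real_product_cvgP (F : set_system RI) (z : RI) : Filter F ->
  F --> z <-> forall i, (fun y : RI => y i) @ F --> z i.
Proof.
move=> FF; split=> [Fz i|Fz].
  apply: (cvg_trans (cvg_app (fun y : RI => y i) Fz)).
  exact: real_product_coord_continuous.
apply/cvg_sup => i A [B [[C oC <-] Cz CA]].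
apply: filterS CA _; apply: (Fz i); exact: open_nbhs_nbhs.
Qed.

(** A supremum rather than a series: a closed ball is then an intersection of conditions on single
    coordinates, as [product_dist_le] shows, and its measurability is immediate. *)
Definition product_dist (x y : RI) : R :=
  sup (range (fun i : I => Num.min `|x i - y i| (2^-1 ^+ pickle i))).

Let half_gt0 n : 0 < 2^-1 ^+ n :> R.
Proof. by rewrite exprn_gt0. Qed.

Let half_le1 n : 2^-1 ^+ n <= 1 :> R.
Proof. by apply: exprn_ile1 => //; rewrite invf_le1 ?ler1n. Qed.

Let half_pow_small (r : R) : 0 < r -> exists n, 2^-1 ^+ n <= r.
Proof.
move=> r0.
have [n _] := near_infty_natSinv_lt (PosNum r0).
move=> /(_ _ (leqnn n)) /= nr; exists n.
apply: ltW; apply: le_lt_trans nr.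
have n2 : n.+1%:R <= 2 ^+ n :> R by rewrite -natrX ler_nat; exact: ltn_expl.
rewrite exprVn; have n0 : 0 < n.+1%:R :> R by [].
have n1 : 0 < 2 ^+ n :> R by exact: exprn_gt0.
by rewrite (lef_pV2 n1 n0).
Qed.

Let term_ge0 (x y : RI) i : 0 <= Num.min `|x i - y i| (2^-1 ^+ pickle i).
Proof. by rewrite le_min normr_ge0 ltW. Qed.

Let has_ub (x y : RI) :
  has_ubound (range (fun i : I => Num.min `|x i - y i| (2^-1 ^+ pickle i) : R)).
Proof. by exists 1 => _ [i _ <-]; rewrite ge_min half_le1 orbT. Qed.

Lemma product_dist_ge (x y : RI) i :
  Num.min `|x i - y i| (2^-1 ^+ pickle i) <= product_dist x y.
Proof. by apply: ub_le_sup; [exact: has_ub|exists i]. Qed.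

(** The condition [0 <= r] covers an empty [I], for which the supremum is 0. *)
Lemma product_dist_le (x y : RI) r : 0 <= r ->
  product_dist x y <= r <->
  forall i, Num.min `|x i - y i| (2^-1 ^+ pickle i) <= r.
Proof.
move=> r0; split=> [dr i|dr]; first exact: le_trans (product_dist_ge _ _ _) dr.
rewrite /product_dist; have [->|/set0P A0] := eqVneq
    (range (fun i : I => Num.min `|x i - y i| (2^-1 ^+ pickle i))) set0.
  by rewrite sup0.
by apply: ge_sup => // _ [i _ <-].
Qed.

Lemma product_dist_ge0 (x y : RI) : 0 <= product_dist x y.
Proof.
rewrite /product_dist; have [->|/set0P[r Ar]] := eqVneq
    (range (fun i : I => Num.min `|x i - y i| (2^-1 ^+ pickle i))) set0.
  by rewrite sup0.
by case: Ar => i _ _; exact: le_trans (term_ge0 x y i) (product_dist_ge x y i).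
Qed.

Lemma near_product_dist (z : RI) r : 0 < r -> nbhs z [set y | product_dist z y < r].
Proof.
move=> r0; have r20 : 0 < r / 2 by rewrite divr_gt0.
have [n nr] := half_pow_small r20.
have H m : nbhs z [set y : RI | forall i, (pickle i < m)%N -> `|z i - y i| < r / 2].
  elim: m => [|m IH]; first exact: filterE.
  pose A := [set y : RI | forall i, pickle i = m -> `|z i - y i| < r / 2].
  suff nA : nbhs z A.
    apply: filterS2 IH nA => y y1 y2 i; rewrite ltnS leq_eqVlt.
    by move=> /orP[/eqP|]; [exact: y2|exact: y1].
  have [[i im]|ni] := pselect (exists i : I, pickle i = m); last first.
    by apply: filterE => y i im; exfalso; apply: ni; exists i.
  move: (@real_product_coord_continuous i z) => /cvgrPdist_lt/(_ _ r20); apply: filterS => y yi j jm.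
  by rewrite (pcan_inj pickleK (etrans jm (esym im))).
apply: filterS (H n) => y yz /=.
apply: (@le_lt_trans _ _ (r / 2)); last by rewrite ltr_pdivrMr// ltr_pMr// ltr1n.
apply/product_dist_le => [|i]; first exact: ltW.
have [/yz/ltW|ni] := ltnP (pickle i) n; first by rewrite ge_min => ->.
suff q : 2^-1 ^+ pickle i <= r / 2 by rewrite ge_min q orbT.
by apply: le_trans nr; apply: ler_wiXn2l => //; rewrite invf_le1 ?ler1n.
Qed.

Lemma lt_product_dist (z : RI) i r : 0 < r ->
  exists2 e, 0 < e & forall y, product_dist z y < e -> `|z i - y i| < r.
Proof.
move=> r0; exists (Num.min r (2^-1 ^+ pickle i)); first by rewrite lt_min r0 half_gt0.
move=> y ye; have := le_lt_trans (product_dist_ge z y i) ye.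
rewrite lt_min => /andP[]; rewrite gt_min => /orP[//|] rI.
by rewrite gt_min ltxx orbF => /lt_trans; apply.
Qed.

Lemma product_dist_complete_compatible : complete_compatible_metric product_dist.
Proof.
split.
- move=> x y; split=> [d0|->].
    apply/funext => i; apply/eqP; rewrite -subr_eq0 -normr_eq0.
    have := product_dist_ge x y i; rewrite d0 ge_min.
    rewrite [X in _ || X]leNgt half_gt0 orbF => n0.
    by rewrite eq_le n0 normr_ge0.
  apply/eqP; rewrite eq_le product_dist_ge0 andbT.
  by apply/product_dist_le => // i; rewrite ge_min subrr normr0 lexx.
- move=> x y; rewrite /product_dist; congr (sup (_ @` setT)).
  by apply/funext => i; rewrite distrC.
- move=> x y z; apply/product_dist_le => [|i].
    by rewrite addr_ge0// product_dist_ge0.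
  apply: le_trans (lerD (product_dist_ge x y i) (product_dist_ge y z i)).
  have := ler_distD (y i) (x i) (z i).
  set a := `|x i - y i|; set b := `|y i - z i|; set q := (2^-1 : R) ^+ pickle i.
  have q0 : 0 < q by exact: half_gt0.
  have a0 : 0 <= a by exact: normr_ge0.
  have b0 : 0 <= b by exact: normr_ge0.
  move=> ab; rewrite ge_min.
  have [aq|qa] := leP a q; have [bq|qb] := leP b q; apply/orP;
    [by left|right; lra..].
- move=> x A; split=> [xA|[r r0 rA]]; last exact: filterS rA (near_product_dist x r0).
  (* [F] is the filter of metric neighbourhoods of [x]. Its convergence to [x] in the product
     topology is the inclusion sought, and convergence can be checked on coordinates. *)
  pose F : set_system RI := [set B | exists2 r : R, 0 < r & [set y | product_dist x y < r] `<=` B].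
  suff : F --> x by exact.
  have FF : Filter F.
    split; first by exists 1.
    - move=> P Q [r1 r10 r1P] [r2 r20 r2Q]; exists (Num.min r1 r2).
        by rewrite lt_min r10.
      by move=> y /=; rewrite lt_min => /andP[/r1P ? /r2Q].
    - by move=> P Q PQ [r r0 rP]; exists r => //; exact: subset_trans rP PQ.
  apply/real_product_cvgP => i; apply/cvgrPdist_lt => r r0.
  by have [e e0 he] := lt_product_dist x i r0; exists e.
- move=> u uC.
  have uc i : cvgn (fun n => u n i).
    apply/cvgn_cauchyP => j.
    have j0 : 0 < j.+1%:R^-1 :> R by rewrite invr_gt0.
    pose q := Num.min (j.+1%:R^-1 : R) (2^-1 ^+ pickle i).
    have q0 : 0 < q by rewrite lt_min j0 half_gt0.
    have [N uN] := uC _ q0; exists N => k.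
    have := uN _ _ (leq_addr k N) (leqnn N).
    move=> /(le_lt_trans (product_dist_ge _ _ i)).
    rewrite lt_min => /andP[]; rewrite gt_min => /orP[//|] rI.
    by rewrite gt_min ltxx orbF => /lt_trans; apply.
  exists (fun i => limn (fun n => u n i)).
  by apply/real_product_cvgP => i; exact: uc.
Qed.

(** Finite rational sequences are enough, since a coordinate of rank at least [n] contributes at
    most [2^-n] to the distance. *)
Lemma real_product_dense : exists v : seq rat -> RI, dense (range v).
Proof.
pose v (q : seq rat) : RI := fun i => ratr (nth 0 q (pickle i)).
exists v.
move=> O [z Oz] oO.
have [_ _ _ nb _] := product_dist_complete_compatible.
have [r r0 rO] := (nb z O).1 (open_nbhs_nbhs (conj oO Oz)).
have r20 : 0 < r / 2 by rewrite divr_gt0.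
have [n nr] := half_pow_small r20.
have /choice[q qP] (k : nat) : exists a : rat, forall i, pickle i = k ->
    `|z i - ratr a| < r / 2.
  have [[i ik]|ni] := pselect (exists i : I, pickle i = k); last first.
    by exists 0 => i ik; exfalso; apply: ni; exists i.
  have [|a] := @rat_in_itvoo R (z i - r / 2) (z i + r / 2); first by lra.
  rewrite in_itv/= => /andP[a1 a2]; exists a => j jk.
  rewrite (pcan_inj pickleK (etrans jk (esym ik))) ltr_norml.
  by apply/andP; split; lra.
exists (v (mkseq q n)); split; last by exists (mkseq q n).
apply: rO => /=; apply: (@le_lt_trans _ _ (r / 2)); last by rewrite ltr_pdivrMr// ltr_pMr// ltr1n.
apply/product_dist_le => [|i]; first exact: ltW.
have [ni|ni] := ltnP (pickle i) n.
  by rewrite ge_min /v nth_mkseq// ltW// qP.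
suff qr : 2^-1 ^+ pickle i <= r / 2 by rewrite ge_min qr orbT.
by apply: le_trans nr; apply: ler_wiXn2l => //; rewrite invf_le1 ?ler1n.
Qed.

Lemma polish_real_product : polish R RI.
Proof.
split; first by exists product_dist; exact: product_dist_complete_compatible.
have [v vD] := real_product_dense; exists (range v) => //.
exact: (card_le_trans (card_image_le v setT) (countableP _)).
Qed.

Lemma measurable_real_product_coord i :
  measurable_fun setT (fun z : borel RI => z i).
Proof.
by apply: continuous_borel_measurable; exact: real_product_coord_continuous.
Qed.

(** The coordinates generate the Borel sets: an open set is the countable union of the closed balls
    of radii [2^-n] around the dense sequence that it contains, and such balls are countable
    intersections of coordinate conditions. *)
Lemma measurable_fun_real_product d (T : measurableType d) (f : T -> RI) :
  (forall i, measurable_fun setT (fun t => f t i)) ->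
  measurable_fun setT (f : T -> borel RI).
Proof.
move=> mf; apply: (@measurability _ _ T (borel RI) setT f (@open RI)) => //.
move=> _ [ O oO <-]; rewrite setTI.
have [v vD] := real_product_dense.
have [_ dC dT' nb _] := product_dist_complete_compatible.
pose B q n := [set y | product_dist (v q) y <= 2^-1 ^+ n].
have mB q n : measurable (f @^-1` B q n).
  pose C i := [set t | Num.min `|v q i - f t i| (2^-1 ^+ pickle i) <= 2^-1 ^+ n :> R].
  rewrite (_ : f @^-1` B q n = ~` (\bigcup_i ~` C i)).
    apply: measurableC; apply: countable_bigcupT_measurable => // i.
    apply: measurableC; rewrite -[X in measurable X]setTI.
    apply: (measurable_fun_ler (f := fun t => Num.min `|v q i - f t i| (2^-1 ^+ pickle i))) => //.
    apply: measurable_minr => //; apply: measurableT_comp => //.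
    by apply: measurable_funB => //; exact: mf.
  rewrite setC_bigcup; apply/seteqP; split => t.
    by move=> /product_dist_le H i _; rewrite setCK; apply: H; exact: ltW.
  move=> H; apply/product_dist_le => [|i]; first exact: ltW.
  by have := H i Logic.I; rewrite setCK.
pose F (k : seq rat * nat) :=
  if pselect (B k.1 k.2 `<=` O) then f @^-1` B k.1 k.2 else set0.
rewrite (_ : f @^-1` O = \bigcup_k F k).
  apply: countable_bigcupT_measurable => // -[q n]; rewrite /F /=.
  by case: pselect => BO /=; [exact: mB|exact: measurable0].
apply/seteqP; split => t /=; last by rewrite /F => -[[q n] _ /=]; case: pselect => //= qO; apply: qO.
move=> Ot; have [r r0 rO] := (nb (f t) O).1 (open_nbhs_nbhs (conj oO Ot)).
have r20 : 0 < r / 2 by rewrite divr_gt0.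
have [n nr] := half_pow_small r20.
(* A dense point within [2^-n <= r / 2] of [f t] centres a closed ball of radius [2^-n] that
   contains [f t] and stays inside [O]. *)
pose W := interior [set y : RI | product_dist (f t) y < 2^-1 ^+ n].
have W0 : W !=set0 by exists (f t); exact: near_product_dist.
have [w [wt [q _ qE]]] := vD W W0 (open_interior _).
move: wt => /interior_subset /= qt; exists (q, n) => //; rewrite /F /=.
rewrite -qE in qt; case: pselect => [BO|[]] /=; first by rewrite /B /= dC ltW.
move=> y /= qy; apply: rO => /=; apply: le_lt_trans (dT' _ (v q) _) _.
by rewrite [ltRHS]splitr; apply: ltr_leD; [exact: lt_le_trans qt _|exact: le_trans qy _].
Qed.

End real_product_topology.

(** [lambda] is the law of a shift sequence relabelled by [pickle]. Convergence and exponential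
    moment of the series are transported with it; the representation below relies on these two facts
    alone. *)
Lemma gaussian_product_exists (R : realType) (I : countType) :
  exists lambda : probability (borel (real_product R I)) R,
  [/\ standard_gaussian_product lambda,
      forall a : I -> R, cvgn (psum (fun i => a i ^+ 2)) ->
        {ae lambda, forall z : real_product R I, cvgn (psum (fun i => a i * z i))}
    & forall a : I -> R, cvgn (psum (fun i => a i ^+ 2)) ->
        (\int[lambda]_z (expR (csum (fun i => a i * (z : real_product R I) i)))%:E =
         (expR (csum (fun i => a i ^+ 2) / 2))%:E)%E].
Proof.
have [P [N [G [V [mG mV NE GV]]]]] := normal_shift_exists R.
have mgf := normal_mgf NE.
pose X w : real_product R I := fun i => shift_seq G V (pickle i) w.
have mX : measurable_fun setT (X : R -> borel (real_product R I)).
  by apply: measurable_fun_real_product => i; exact: measurable_shift_seq.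
have [lambda lX] := image_exists P mX.
(* Indices coding no element of [I] get coefficient 0, as in [psum]. *)
pose code (a : I -> R) k := oapp a 0 (@pickle_inv I k).
have psumX a w : psum (fun i => a i * X w i) = shift_sum G V (code a) ^~ w.
  apply/funext => n; apply: eq_bigr => k _; rewrite /code /X.
  have := @pickle_invK I k; case: pickle_inv => [i /= -> //|_].
  by rewrite /= mul0r.
have psum2 a : psum (fun i => a i ^+ 2) = (fun n => \sum_(0 <= k < n) code a k ^+ 2).
  apply/funext => n; apply: eq_bigr => k _; rewrite /code.
  by case: pickle_inv => //=; rewrite expr0n.
have mpsum (a : I -> R) n :
    measurable_fun setT (fun z : borel (real_product R I) => psum (fun i => a i * z i) n).
  apply: measurable_sum => k; case: (@pickle_inv I k) => [i|]//=.
  by apply: measurable_funM => //; exact: measurable_real_product_coord.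
exists lambda; split.
- move=> J A uJ mA.
  pose B k := if @pickle_inv I k is Some i then A i else setT.
  have mB k : measurable (B k) by rewrite /B; case: pickle_inv.
  have mJ : measurable ([set z | forall i, i \in J -> A i (z i)] : set (borel (real_product R I))).
    rewrite (_ : mkset _ = \bigcap_(i in [set` J])
        ((fun z : borel (real_product R I) => z i) @^-1` A i)); last first.
      by apply/seteqP; split => z.
    apply: fin_bigcap_measurable; first exact: finite_seq.
    move=> i _; rewrite -[X in measurable X]setTI.
    exact: measurable_real_product_coord.
  rewrite [LHS]lX//; transitivity (\prod_(k <- map pickle J) N (B k))%E.
    rewrite -(shift_cylinder mG mV GV _ mB); last first.
      by rewrite map_inj_uniq//; exact: pcan_inj (@pickleK I).
    congr (P _); apply/seteqP; split => w /= H.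
      by move=> _ /mapP[i iJ ->]; rewrite /B pickleK_inv; exact: H.
    move=> i iJ; have := H _ (map_f pickle iJ).
    by rewrite /B pickleK_inv.
  rewrite big_map; apply: eq_bigr => i _.
  by rewrite /B pickleK_inv; exact: NE.
- move=> a ca.
  have [mC _] := measurable_limn (mpsum a).
  have : {ae P, forall w, cvgn (psum (fun i => a i * X w i))}.
    have ca' := ca; rewrite psum2 in ca'.
    apply: filterS (shift_sum_cvg mG mV GV mgf ca') => w.
    by rewrite psumX.
  set C := [set t | _] in mC.
  move=> H; exists (~` C); split => //; first exact: measurableC.
  rewrite [LHS]lX; last exact: measurableC.
  apply: measure_negligible; last exact: H.
  by rewrite -[X in measurable X]setTI; apply: mX => //; exact: measurableC.
- move=> a ca; have [_ ml] := measurable_limn (mpsum a).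
  have /is_imageP -> // := lX; last first.
    by apply/measurable_EFinP; exact: measurableT_comp ml.
  under eq_integral do rewrite /csum psumX.
  rewrite /csum psum2; apply: (shift_sum_lim_mgf mG mV GV mgf).
  by rewrite -psum2.
Qed.

(** * The Gaussian representation *)

Section psum_theory.
Context (R : realType) (I : countType).
Implicit Types F G : I -> R.

Lemma psumD F G : psum (fun i => F i + G i) = (fun n => psum F n + psum G n).
Proof.
apply/funext => n; rewrite -big_split/=; apply: eq_bigr => k _.
by case: pickle_inv => //=; rewrite addr0.
Qed.

Lemma psumZ r F : psum (fun i => r * F i) = (fun n => r * psum F n).
Proof.
apply/funext => n; rewrite mulr_sumr; apply: eq_bigr => k _.
by case: pickle_inv => //=; rewrite mulr0.
Qed.

Lemma is_cvg_psumD F G : cvgn (psum F) -> cvgn (psum G) ->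
  cvgn (psum (fun i => F i + G i)).
Proof. by move=> cF cG; rewrite psumD; exact: is_cvgD. Qed.

Lemma is_cvg_psumZ r F : cvgn (psum F) -> cvgn (psum (fun i => r * F i)).
Proof. by move=> cF; rewrite psumZ; exact: is_cvgMr. Qed.

Lemma csumD F G : cvgn (psum F) -> cvgn (psum G) ->
  csum (fun i => F i + G i) = csum F + csum G.
Proof. by move=> cF cG; rewrite /csum psumD; exact: limD. Qed.

Lemma csumZ r F : cvgn (psum F) -> csum (fun i => r * F i) = r * csum F.
Proof. by move=> cF; rewrite /csum psumZ; exact: limZr. Qed.

Lemma is_cvg_psum_sqrD F G :
  cvgn (psum (fun i => F i ^+ 2)) -> cvgn (psum (fun i => G i ^+ 2)) ->
  cvgn (psum (fun i => (F i + G i) ^+ 2)).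
Proof.
move=> cF cG.
have c2 := is_cvg_psumZ (r := 2) (is_cvg_psumD cF cG).
have mono (K : I -> R) : (forall i, 0 <= K i) ->
    {homo psum K : n m / (n <= m)%N >-> n <= m}.
  move=> K0; apply/nondecreasing_seqP => n.
  by rewrite /psum big_nat_recr//= lerDl; case: pickle_inv => //=.
apply: nondecreasing_is_cvgn; first by apply: mono => i; exact: sqr_ge0.
exists (limn (psum (fun i => 2 * (F i ^+ 2 + G i ^+ 2)))) => _ [n _ <-].
apply: (@le_trans _ _ (psum (fun i => 2 * (F i ^+ 2 + G i ^+ 2)) n)).
  apply: ler_sum => k _; case: pickle_inv => //= i.
  by have := sqr_ge0 (F i - G i); nra.
apply: nondecreasing_cvgn_le => //; apply: mono => i.
by rewrite mulr_ge0// addr_ge0// sqr_ge0.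
Qed.

Lemma is_cvg_psum_sqrB F G :
  cvgn (psum (fun i => F i ^+ 2)) -> cvgn (psum (fun i => G i ^+ 2)) ->
  cvgn (psum (fun i => (F i - G i) ^+ 2)).
Proof.
move=> cF cG; apply: is_cvg_psum_sqrD => //.
by under [X in psum X]eq_fun do rewrite sqrrN.
Qed.

Lemma csum_parallelogram F G :
  cvgn (psum (fun i => F i ^+ 2)) -> cvgn (psum (fun i => G i ^+ 2)) ->
  csum (fun i => (F i + G i) ^+ 2) + csum (fun i => (F i - G i) ^+ 2) =
  2 * (csum (fun i => F i ^+ 2) + csum (fun i => G i ^+ 2)).
Proof.
move=> cF cG; rewrite -csumD//; last 2 first.
- exact: is_cvg_psum_sqrD.
- exact: is_cvg_psum_sqrB.
rewrite -csumD// -csumZ; last exact: is_cvg_psumD.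
by congr csum; apply/funext => i; ring.
Qed.

End psum_theory.

Section gaussian_latent_representation.
Context (R : realType) (X : ptopologicalType) (I : countType).
Variables (c : X -> X -> R) (eps : R) (f : I -> X -> R) (s : X -> R).
Variable lambda : probability (borel (real_product R I)) R.
Hypotheses (eps0 : 0 < eps)
  (mf : forall i, measurable_fun setT (f i : borel X -> R))
  (ms : measurable_fun setT (s : borel X -> R))
  (f2 : forall x, cvgn (psum (fun i => f i x ^+ 2)))
  (cE : forall x y, c x y = csum (fun i => (f i x - f i y) ^+ 2) + s x + s y).
Hypotheses
  (lambda_cvg : forall a : I -> R, cvgn (psum (fun i => a i ^+ 2)) ->
    {ae lambda, forall z : real_product R I, cvgn (psum (fun i => a i * z i))})
  (lambda_mgf : forall a : I -> R, cvgn (psum (fun i => a i ^+ 2)) ->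
    (\int[lambda]_z (expR (csum (fun i => a i * (z : real_product R I) i)))%:E =
     (expR (csum (fun i => a i ^+ 2) / 2))%:E)%E).

Let rho (x : X) (z : real_product R I) : R :=
  expR (Num.sqrt (2 / eps) * csum (fun i => f i x * z i)
        - 2 / eps * csum (fun i => f i x ^+ 2) - s x / eps).

Let rho_gt0 x z : 0 < rho x z.
Proof. exact: expR_gt0. Qed.

Lemma measurable_psum d (T : measurableType d) (F : I -> T -> R) n :
  (forall i, measurable_fun setT (F i)) ->
  measurable_fun setT (fun t => psum (fun i => F i t) n).
Proof.
by move=> mF; apply: measurable_sum => k; case: (@pickle_inv I k).
Qed.

Lemma measurable_csum d (T : measurableType d) (F : I -> T -> R) :
  (forall i, measurable_fun setT (F i)) ->
  measurable_fun setT (fun t => csum (fun i => F i t)).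
Proof.
by move=> mF; apply: (measurable_limn (fun n => measurable_psum n mF)).2.
Qed.

Let measurable_rho :
  measurable_fun setT (fun p : borel X * borel (real_product R I) => rho p.1 p.2).
Proof.
have mf1 i : measurable_fun setT (fun p : borel X * borel (real_product R I) => f i p.1).
  exact: measurableT_comp.
have mz i : measurable_fun setT (fun p : borel X * borel (real_product R I) => p.2 i).
  apply: (measurableT_comp (@measurable_real_product_coord R I i)).
  exact: measurable_snd.
apply: measurableT_comp => //; apply: measurable_funB; last first.
  by apply: measurable_funM => //; exact: measurableT_comp.
apply: measurable_funB; apply: measurable_funM => //;
  apply: measurable_csum => i; first exact: measurable_funM.
exact: measurable_funX.
Qed.

Let measurable_c : measurable_fun setT (fun p : borel X * borel X => c p.1 p.2).
Proof.
rewrite (_ : (fun _ => _) = fun p => csum (fun i => (f i p.1 - f i p.2) ^+ 2) + s p.1 + s p.2); last first.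
  by apply/funext => p; exact: cE.
have m1 := @measurable_fst _ _ (borel X) (borel X).
have m2 := @measurable_snd _ _ (borel X) (borel X).
apply: measurable_funD; last exact: (measurableT_comp ms m2).
apply: measurable_funD; last exact: (measurableT_comp ms m1).
apply: measurable_csum => i; apply: measurable_funX; apply: measurable_funB.
  exact: (measurableT_comp (mf i) m1).
exact: (measurableT_comp (mf i) m2).
Qed.

Let integral_rho x y :
  (\int[lambda]_z (rho x z * rho y z)%:E = (expR (- (c x y / eps)))%:E)%E.
Proof.
pose q := Num.sqrt (2 / eps).
have q2 : q ^+ 2 = 2 / eps by rewrite sqr_sqrtr// divr_ge0// ltW.
pose b i := q * (f i x + f i y).
have bE : (fun i => b i ^+ 2) = (fun i => q ^+ 2 * (f i x + f i y) ^+ 2).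
  by apply/funext => i; rewrite exprMn.
have cD := is_cvg_psum_sqrD (@f2 x) (@f2 y).
have b2 : cvgn (psum (fun i => b i ^+ 2)).
  by rewrite bE; exact: is_cvg_psumZ.
pose K := expR (- (2 / eps * csum (fun i => f i x ^+ 2)) - s x / eps
  - 2 / eps * csum (fun i => f i y ^+ 2) - s y / eps).
have mz (a : I -> R) : measurable_fun setT (fun z : borel (real_product R I) => csum (fun i => a i * z i)).
  apply: measurable_csum => i; apply: measurable_funM => //.
  exact: measurable_real_product_coord.
transitivity (\int[lambda]_z (K%:E * (expR (csum (fun i => b i * (z : real_product R I) i)))%:E))%E.
  apply: ge0_ae_eq_integral => //.
  - apply/measurable_EFinP; apply: measurable_funM.
      exact: (measurable_fun_pair2 (x : borel X) measurable_rho).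
    exact: (measurable_fun_pair2 (y : borel X) measurable_rho).
  - apply/measurable_EFinP; apply: measurable_funM => //.
    exact: measurableT_comp (mz _).
  - by move=> z _; rewrite lee_fin mulr_ge0// ltW.
  - by move=> z _; rewrite mule_ge0// lee_fin expR_ge0.
  (* The series for [x] and [y] may be added where both converge, hence off a null set depending on
     [x] and [y]. *)
  have FL := ae_filter_ringOfSetsType lambda.
  apply: (@filterS _ _ FL _ _ _ (@filterI _ _ FL _ _
    (lambda_cvg (@f2 x)) (lambda_cvg (@f2 y)))) => z [zx zy] _.
  rewrite -EFinM; congr EFin; rewrite /rho /K -!expRD; congr expR.
  have -> : csum (fun i => b i * z i) =
      q * (csum (fun i => f i x * z i) + csum (fun i => f i y * z i)).
    rewrite -csumD// -csumZ; last exact: is_cvg_psumD.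
    by congr csum; apply/funext => i; rewrite /b; ring.
  by rewrite -/q; ring.
rewrite ge0_integralZl//; last 2 first.
- by apply/measurable_EFinP; exact: measurableT_comp (mz _).
- by rewrite lee_fin expR_ge0.
rewrite lambda_mgf// -EFinM -expRD; congr (expR _)%:E.
rewrite bE csumZ// q2 cE.
have := csum_parallelogram (@f2 x) (@f2 y).
set A := csum (fun i => f i x ^+ 2); set B := csum (fun i => f i y ^+ 2).
set D := csum (fun i => (f i x - f i y) ^+ 2).
set S := csum (fun i => (f i x + f i y) ^+ 2) => DS.
have -> : S = 2 * (A + B) - D by rewrite -DS; ring.
by field; rewrite gt_eqF.
Qed.

(** The coordinates [f] are abstract, with summable squares and no Hilbert space, so that the lemma
    serves both the Cholesky features and the coordinates in a given orthonormal basis. *)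
Lemma gaussian_latent_representation : latent_representation c eps lambda rho.
Proof.
have psiE x z : psi_of eps rho x z = - (eps * ln (rho x z)) by [].
have cancelE x z : - psi_of eps rho x z / eps = ln (rho x z).
  by rewrite psiE opprK mulrC mulKf// gt_eqF.
have mpsi : measurable_fun setT (fun p : borel X * borel (real_product R I) => psi_of eps rho p.1 p.2).
  by apply: measurable_funN; apply: measurable_funM => //; exact: measurableT_comp measurable_rho.
split => //.
- move=> x y; rewrite /induced_cost.
  under eq_integral => z _.
    rewrite mulrDl opprD -!mulNr !cancelE expRD !lnK ?posrE//.
    over.
  rewrite integral_rho lne_EFin ?expR_gt0// expRK -EFinM -EFinN; congr EFin.
  by rewrite mulrN opprK mulrC divfK// gt_eqF.
- move=> mu nu [w1 w2 w3].
  apply: (latent_decomposition eps0 measurable_c mpsi) => // x y.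
  transitivity (\int[lambda]_z ((expR (c x y / eps))%:E * (rho x z * rho y z)%:E))%E.
    apply: eq_integral => z _; rewrite -EFinM; congr EFin.
    by rewrite !mulrBl -!mulNr !cancelE !expRD !lnK ?posrE// mulrA.
  rewrite ge0_integralZl//; last 2 first.
  + apply/measurable_EFinP; apply: measurable_funM.
      exact: (measurable_fun_pair2 (x : borel X) measurable_rho).
    exact: (measurable_fun_pair2 (y : borel X) measurable_rho).
  + by move=> z _; rewrite lee_fin mulr_ge0// ltW.
  by rewrite integral_rho -EFinM -expRD subrr expR0.
Qed.

End gaussian_latent_representation.

(** * Features of a negative definite cost *)

Definition positive_kernel (R : realType) (X : Type) (k : X -> X -> R) : Prop :=
  (forall x y, k x y = k y x) /\
  (forall N (x : 'I_N -> X) (a : 'I_N -> R),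
     0 <= \sum_(i < N) \sum_(j < N) a i * a j * k (x i) (x j)).

Definition cons_ord (T : Type) N (p : T) (x : 'I_N -> T) (i : 'I_N.+1) : T :=
  oapp x p (unlift ord0 i).

Lemma quadratic_form_recl (R : realType) (X : Type) (k : X -> X -> R) N
    (x : 'I_N -> X) (a : 'I_N -> R) (p : X) (t : R) :
  (forall x y, k x y = k y x) ->
  \sum_(i < N.+1) \sum_(j < N.+1) cons_ord t a i * cons_ord t a j *
    k (cons_ord p x i) (cons_ord p x j) =
  t ^+ 2 * k p p + 2 * t * (\sum_(i < N) a i * k (x i) p) +
  \sum_(i < N) \sum_(j < N) a i * a j * k (x i) (x j).
Proof.
move=> ksym; rewrite big_ord_recl big_ord_recl /cons_ord unlift_none /=.
under eq_bigr do rewrite liftK /=.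
under [X in _ + X]eq_bigr => i _.
  rewrite big_ord_recl unlift_none liftK /=.
  under eq_bigr do rewrite liftK /=.
  over.
rewrite big_split /= addrA expr2; congr (_ + _); rewrite -addrA; congr (_ + _).
rewrite mulr_sumr -big_split /=; apply: eq_bigr => i _.
by rewrite (ksym p); ring.
Qed.

(** * Cholesky elimination of a positive kernel along a sequence *)

Section cholesky.
Context (R : realType) (X : Type).
Variables (k : X -> X -> R) (d : nat -> X).

(* [x / 0 = 0]: a pivot of null norm leaves the kernel unchanged. *)
Fixpoint schur (n : nat) (x y : X) : R :=
  if n is m.+1 then
    schur m x y - schur m x (d m) * schur m y (d m) / schur m (d m) (d m)
  else k x y.

Definition feature (n : nat) (x : X) : R :=
  schur n x (d n) / Num.sqrt (schur n (d n) (d n)).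

Hypothesis kP : positive_kernel k.

Lemma positive_kernel_diag (h : X -> X -> R) x : positive_kernel h -> 0 <= h x x.
Proof.
by move=> [_ /(_ 1%N (fun=> x) (fun=> 1))]; rewrite !big_ord1 !mul1r.
Qed.

Lemma positive_kernel_pair (h : X -> X -> R) x y t : positive_kernel h ->
  0 <= t ^+ 2 * h y y + 2 * t * h x y + h x x.
Proof.
move=> [hs hP]; have := hP _ (cons_ord y (fun _ : 'I_1 => x)) (cons_ord t (fun=> 1)).
by rewrite (quadratic_form_recl _ _ _ _ hs) !big_ord1 !mul1r.
Qed.

Lemma positive_kernel_null (h : X -> X -> R) x y : positive_kernel h ->
  h y y = 0 -> h x y = 0.
Proof.
move=> hP hy; apply/eqP; apply: contraT => h0.
(* With [h y y = 0] the quadratic polynomial in [t] is affine; this [t] gives it the value [-1]. *)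
have := positive_kernel_pair x y (- (h x x + 1) / (2 * h x y)) hP.
rewrite hy mulr0 add0r (_ : _ + _ = - 1); first by rewrite oppr_ge0 ler10.
by field.
Qed.

Lemma positive_schur n : positive_kernel (schur n).
Proof.
elim: n => [//|n [hs hP]]; split=> [x y|N x a] /=.
  by rewrite hs [schur n x _ * _]mulrC.
pose p := d n; pose S := \sum_(i < N) a i * schur n (x i) p.
(* The form of [schur n] with an extra point [p] of weight [t] is minimal at this [t], and the
   minimum is the form of the next kernel. For a null pivot, [t = 0]. *)
pose t := - S / schur n p p.
have := hP _ (cons_ord p x) (cons_ord t a).
rewrite (quadratic_form_recl _ _ _ _ hs) -/S.
set Q := \sum_(i < N) \sum_(j < N) _.
move=> H; rewrite [leRHS](_ : _ = Q - S ^+ 2 / schur n p p).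
  have [p0|p0] := eqVneq (schur n p p) 0.
    by move: H; rewrite /t p0 invr0 !mulr0 !mul0r subr0 !add0r.
  by apply: le_trans H _; rewrite le_eqVlt; apply/orP; left; apply/eqP; rewrite /t; field.
rewrite /Q /S expr2 mulr_suml mulr_suml -sumrB; apply: eq_bigr => i _.
rewrite mulr_sumr mulr_suml -sumrB; apply: eq_bigr => j _.
by rewrite /p; ring.
Qed.

Lemma feature_mul n x y :
  feature n x * feature n y =
  schur n x (d n) * schur n y (d n) / schur n (d n) (d n).
Proof.
rewrite /feature mulrACA -invfM -expr2 sqr_sqrtr//.
exact: positive_kernel_diag (positive_schur n).
Qed.

Lemma schurE n x y :
  schur n x y = k x y - \sum_(0 <= m < n) feature m x * feature m y.
Proof.
elim: n => [|n IH]; first by rewrite big_nil subr0.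
by rewrite big_nat_recr//= opprD addrA -IH feature_mul.
Qed.

(** A point once eliminated stays so; a null pivot already has a null row by
    [positive_kernel_null]. *)
Lemma schur_pivot n m y : (m < n)%N -> schur n (d m) y = 0.
Proof.
elim: n y => [//|n IH] y; rewrite ltnS leq_eqVlt => /orP[/eqP->|mn] /=; last first.
  by rewrite !IH// !mul0r subr0.
have [hs hP] := positive_schur n; have [p0|p0] := eqVneq (schur n (d n) (d n)) 0.
  by rewrite p0 invr0 mulr0 subr0 hs (positive_kernel_null _ (positive_schur n)).
by rewrite [_ * schur n y _]mulrC mulfK// hs subrr.
Qed.

Let dist h (x y : X) : R := h x x - 2 * h x y + h y y.

Lemma sum_feature_dist n x y :
  \sum_(0 <= m < n) (feature m x - feature m y) ^+ 2 =
  dist k x y - dist (schur n) x y.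
Proof.
rewrite /dist !schurE.
set a := k x x; set b := k x y; set c := k y y.
transitivity (\sum_(0 <= m < n) feature m x * feature m x
  - 2 * \sum_(0 <= m < n) feature m x * feature m y
  + \sum_(0 <= m < n) feature m y * feature m y); last by ring.
rewrite mulr_sumr -sumrB -big_split /=; apply: eq_bigr => m _; ring.
Qed.

(** At an eliminated point [d m] the residual kernel vanishes, so the residual distance from [x] to
    [d m] is the diagonal value at [x]; it differs from the full distance by a sum of squares. *)
Lemma schur_diag_le n m x : (m < n)%N -> schur n x x <= dist k x (d m).
Proof.
move=> mn; have [hs _] := positive_schur n.
have := sum_feature_dist n x (d m); rewrite {2}/dist (hs x).
rewrite !schur_pivot// mulr0 subr0 addr0 => H.
by rewrite -subr_ge0 -H sumr_ge0// => i _; exact: sqr_ge0.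
Qed.

Hypothesis dense_d : forall x e, 0 < e -> exists m, dist k x (d m) < e.

Lemma schur_diag_cvg x : schur ^~ x ^~ x @ \oo --> (0 : R).
Proof.
apply/cvgrPdist_lt => e e0; have [m me] := dense_d x e0.
exists m.+1 => // n mn.
have := positive_kernel_diag x (positive_schur n).
rewrite /= sub0r normrN => /ger0_norm ->.
exact: le_lt_trans (schur_diag_le x mn) me.
Qed.

Lemma feature_dist_cvg x y :
  (fun n => \sum_(0 <= m < n) (feature m x - feature m y) ^+ 2) @ \oo --> dist k x y.
Proof.
under eq_fun do rewrite sum_feature_dist.
have c0 : (fun n => 2 * (schur n x x + schur n y y)) @ \oo --> (0 : R).
  have : (fun n => 2 * (schur n x x + schur n y y)) @ \oo --> (2 * (0 + 0) : R).
    by apply: cvgMr; apply: cvgD; exact: schur_diag_cvg.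
  by rewrite addr0 mulr0.
have d0 : (fun n => dist (schur n) x y) @ \oo --> (0 : R).
  apply: squeeze_cvgr (cvg_cst 0) c0; apply: nearW => n /=.
  (* The weights 1 and -1 place the residual distance between 0 and twice the sum of the diagonal
     values. *)
  have := positive_kernel_pair x y 1 (positive_schur n).
  have := positive_kernel_pair x y (-1) (positive_schur n).
  rewrite /dist => A B; apply/andP; split; lra.
have : (fun n => dist k x y - dist (schur n) x y) @ \oo --> dist k x y - 0.
  by apply: cvgB => //; exact: cvg_cst.
by rewrite subr0.
Qed.

Lemma feature_sqr_cvg x :
  (fun n => \sum_(0 <= m < n) feature m x ^+ 2) @ \oo --> k x x.
Proof.
rewrite (_ : (fun _ => _) = fun n => k x x - schur n x x).
  have : (fun n => k x x - schur n x x) @ \oo --> k x x - 0.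
    by apply: cvgB; [exact: cvg_cst|exact: schur_diag_cvg].
  by rewrite subr0.
by apply/funext => n; rewrite schurE opprB addrC subrK.
Qed.

End cholesky.

Section cost_continuity.
Context (R : realType) (X : ptopologicalType) (c : X -> X -> R).
Hypothesis c_cont : continuous (fun p : X * X => c p.1 p.2).

Lemma cost_continuous_l y : continuous (fun x => c x y).
Proof.
move=> x; apply: (@continuous_comp _ _ _ (fun x => (x, y)) (fun p : X * X => c p.1 p.2)).
  exact: (cvg_pair cvg_id (cvg_cst y)).
exact: c_cont.
Qed.

Lemma cost_continuous_diag : continuous (fun x => c x x).
Proof.
move=> x; apply: (@continuous_comp _ _ _ (fun x => (x, x)) (fun p : X * X => c p.1 p.2)).
  exact: (cvg_pair cvg_id cvg_id).
exact: c_cont.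
Qed.

End cost_continuity.

(** For a cost given by [phi] and [s], this kernel is the inner product of [phi x - phi o] and
    [phi y - phi o]. Giving [o] minus the sum of the weights makes the total weight zero, so that
    negative definiteness applies. *)
Lemma negative_definite_kernel (R : realType) (X : Type) (c : X -> X -> R) (o : X) :
  negative_definite c ->
  positive_kernel (fun x y => (c x o + c y o - c x y - c o o) / 2).
Proof.
move=> [cs cN]; split=> [x y|N x a]; first by rewrite (cs x y); congr (_ / _); ring.
pose A := \sum_(i < N) a i; pose C := \sum_(i < N) a i * c (x i) o.
pose Q := \sum_(i < N) \sum_(j < N) a i * a j * c (x i) (x j).
rewrite [leRHS](_ : _ = (A * C + A * C - Q - A * (A * c o o)) / 2).
  have := cN N.+1 (cons_ord o x) (cons_ord (- A) a) isT.
  rewrite (quadratic_form_recl _ _ _ _ cs) -/C -/Q big_ord_recl /cons_ord unlift_none /=.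
  under eq_bigr do rewrite liftK /=.
  by rewrite addNr => /(_ erefl) H; rewrite divr_ge0//; lra.
have E1 : A * C = \sum_(i < N) \sum_(j < N) a i * (a j * c (x j) o).
  by rewrite big_distrlr.
have E2 : A * C = \sum_(i < N) \sum_(j < N) (a i * c (x i) o) * a j.
  by rewrite mulrC big_distrlr.
have E3 : A * (A * c o o) = \sum_(i < N) \sum_(j < N) a i * (a j * c o o).
  by rewrite [A * c o o]mulr_suml big_distrlr.
rewrite {1}E1 E2 E3 /Q -big_split -!sumrB mulr_suml; apply: eq_bigr => i _.
rewrite -big_split -!sumrB mulr_suml; apply: eq_bigr => j _ /=.
by ring.
Qed.

Lemma psum_nat (V : zmodType) (F : nat -> V) n :
  psum F n = \sum_(0 <= m < n) F m.
Proof.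
apply: eq_bigr => m _.
by have -> : @pickle_inv nat m = Some m by exact: (@pickleK_inv nat m).
Qed.

Lemma polish_dense_sequence (R : realType) (X : ptopologicalType) : polish R X ->
  exists d : nat -> X, dense (range d).
Proof.
move=> [_ [D /pcard_geP[d] dD]]; exists d => O O0 oO.
have [x [Ox /(@surj _ _ _ _ d) dx]] := dD O O0 oO.
by exists x.
Qed.

Lemma negative_definite_features (R : realType) (X : ptopologicalType)
    (c : X -> X -> R) : polish R X ->
  continuous (fun p : X * X => c p.1 p.2) -> negative_definite c ->
  exists f : nat -> X -> R,
  [/\ forall i, measurable_fun setT (f i : borel X -> R),
      forall x, cvgn (psum (fun i => f i x ^+ 2))
    & forall x y,
        c x y = csum (fun i => (f i x - f i y) ^+ 2) + c x x / 2 + c y y / 2].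
Proof.
move=> /polish_dense_sequence[d dd] cc cN; have [cs _] := cN.
pose k x y : R := (c x point + c y point - c x y - c point point) / 2.
have kP : positive_kernel k := negative_definite_kernel point cN.
have distE x y : k x x - 2 * k x y + k y y = c x y - c x x / 2 - c y y / 2.
  by rewrite /k; field.
have dk x e : 0 < e -> exists m, k x x - 2 * k x (d m) + k (d m) (d m) < e.
  move=> e0.
  (* This function of [y] is continuous and vanishes at [x], so a topologically dense sequence is
     dense for the kernel distance too. *)
  have cx : continuous (fun y => c y x - c x x / 2 - c y y / 2).
    move=> y; apply: cvgB; first apply: cvgB.
    - exact: cost_continuous_l.
    - exact: cvg_cst.
    - by apply: cvgMl; exact: cost_continuous_diag.
  have nx : nbhs x [set y | c y x - c x x / 2 - c y y / 2 < e].
    have : (fun y => c y x - c x x / 2 - c y y / 2) @ x -->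
      c x x - c x x / 2 - c x x / 2 := cx x.
    rewrite (_ : c x x - c x x / 2 - c x x / 2 = 0); last by field.
    move=> /cvgrPdist_lt/(_ _ e0); apply: filterS => y /=.
    by rewrite sub0r normrN; apply: le_lt_trans; exact: ler_norm.
  have [|y [yx [m _ my]]] := dd (interior [set y | c y x - c x x / 2 - c y y / 2 < e]) _ (open_interior _).
    by exists x.
  exists m; rewrite distE my cs; exact: (interior_subset yx).
exists (feature k d); split.
- move=> n.
  have ms m y : measurable_fun setT ((fun x => schur k d m x y) : borel X -> R).
    elim: m y => [|m IH] y /=.
      apply: measurable_funM => //; apply: measurable_funB => //.
      apply: measurable_funB.
        by apply: measurable_funD => //; apply: continuous_borel_measurable; exact: cost_continuous_l.
      by apply: continuous_borel_measurable; exact: cost_continuous_l.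
    apply: measurable_funB; first exact: IH.
    by apply: measurable_funM => //; apply: measurable_funM => //; exact: IH.
  by apply: measurable_funM => //; exact: ms.
- move=> x; apply/cvg_ex; exists (k x x).
  rewrite (_ : psum _ = fun n => \sum_(0 <= m < n) feature k d m x ^+ 2).
    exact: feature_sqr_cvg.
  by apply/funext => n; exact: psum_nat.
- move=> x y; rewrite /csum.
  rewrite (_ : psum _ = fun n => \sum_(0 <= m < n) (feature k d m x - feature k d m y) ^+ 2).
    rewrite (cvg_lim _ (@feature_dist_cvg _ _ _ _ kP dk x y))// distE.
    by field.
  by apply/funext => n; exact: psum_nat.
Qed.

(** * Coordinates in an orthonormal basis *)

Section parseval.
Context (R : realType) (H : normedModType R) (ip : H -> H -> R).
Hypothesis ipP : inner_product ip.

Let ipC u v : ip u v = ip v u.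
Proof. by have [h _ _] := ipP; exact: h. Qed.

Let ipDl u v w : ip (u + v) w = ip u w + ip v w.
Proof. by have [_ h _] := ipP; have := h 1 u v w; rewrite scale1r mul1r. Qed.

Let ip0l w : ip 0 w = 0.
Proof. by have := ipDl 0 0 w; rewrite addr0; lra. Qed.

Let ipZl a u w : ip (a *: u) w = a * ip u w.
Proof. by have [_ h _] := ipP; have := h a u 0 w; rewrite addr0 ip0l addr0. Qed.

Lemma ipBl u v w : ip (u - v) w = ip u w - ip v w.
Proof. by rewrite ipDl -scaleN1r ipZl mulN1r. Qed.

Lemma sqr_norm_subZ u v (a : R) :
  `|u - a *: v| ^+ 2 = `|u| ^+ 2 - 2 * a * ip u v + a ^+ 2 * `|v| ^+ 2.
Proof.
have [_ _ ipN] := ipP; rewrite -!ipN ipBl !(ipC _ (u - _)) !ipBl !ipZl.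
by rewrite !(ipC _ (a *: v)) !ipZl (ipC v u); ring.
Qed.

Variables (I : countType) (e : I -> H).
Hypothesis eP : orthonormal_basis ip e.

Let norm_e i : `|e i| ^+ 2 = 1.
Proof. by have [_ _ <-] := ipP; have [-> _] := eP; rewrite eqxx. Qed.

Lemma bessel u i : ip u (e i) ^+ 2 <= `|u| ^+ 2.
Proof.
have := sqr_ge0 `|u - ip u (e i) *: e i|.
rewrite sqr_norm_subZ norm_e; lra.
Qed.

Lemma parseval u : psum (fun i => ip u (e i) ^+ 2) @ \oo --> `|u| ^+ 2.
Proof.
have [ee eb] := eP.
pose r n := u - psum (fun i => ip u (e i) *: e i) n.
have r0 : (fun n => `|r n| ^+ 2) @ \oo --> (0 : R).
  have : (fun n => `|r n| * `|r n|) @ \oo --> (`|u - u| * `|u - u| : R).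
    by apply: cvgM; apply: cvg_norm; apply: cvgB; [exact: cvg_cst|exact: eb|exact: cvg_cst|exact: eb].
  by rewrite subrr normr0 mulr0.
have ip_psum a v n : ip (psum (fun i => a i *: e i) n) v = psum (fun i => a i * ip (e i) v) n.
  rewrite /psum; elim: n => [|n IH]; first by rewrite !big_nil ip0l.
  rewrite !big_nat_recr//= ipDl IH; congr (_ + _).
  by case: pickle_inv => /= [i|]; rewrite ?ipZl ?ip0l.
have E n : psum (fun i => ip u (e i) ^+ 2) n = `|u| ^+ 2 - `|r n| ^+ 2.
  elim: n => [|n IH]; first by rewrite /r /psum !big_nil subr0 subrr.
  rewrite [LHS]big_nat_recr//= -/(psum _ n) IH /r [in RHS]/psum big_nat_recr//=.
  rewrite -/(psum _ n) opprD addrA -/(r n).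
  have := @pickle_invK I n; case: pickle_inv => [i /= i_n|_] /=; last first.
    by rewrite subr0 addr0.
  rewrite sqr_norm_subZ norm_e.
  suff -> : ip (r n) (e i) = ip u (e i) by ring.
  (* The coding by [pickle] is injective: no index below [n] codes [i], so the remainder still has
     the coordinate of [u] along [e i]. *)
  rewrite /r ipBl ip_psum [X in _ - X]big_nat_cond big1 ?subr0// => m.
  rewrite andbT => /andP[_ mn].
  have := @pickle_invK I m; case: pickle_inv => [j /= jm|//].
  rewrite ee; case: eqP => [ji|]; last by rewrite mulr0.
  by move: mn; rewrite -jm ji i_n ltnn.
have : (fun n => `|u| ^+ 2 - `|r n| ^+ 2) @ \oo --> `|u| ^+ 2 - 0.
  by apply: cvgB => //; exact: cvg_cst.
by rewrite subr0; under eq_fun do rewrite -E.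
Qed.

End parseval.

(** Continuity of [phi] is inherited from [c] and [s]: [|phi y - phi x|^2 = c y x - s y - s x] tends
    to 0 as [y] tends to [x], and [bessel] bounds each coordinate. *)
Lemma basis_coord_continuous (R : realType) (X : ptopologicalType)
    (c : X -> X -> R) (H : normedModType R) (ip : H -> H -> R) (I : countType)
    (e : I -> H) (phi : X -> H) (s : X -> R) i :
  continuous (fun p : X * X => c p.1 p.2) ->
  inner_product ip -> orthonormal_basis ip e ->
  (forall x y, c x y = `|phi x - phi y| ^+ 2 + s x + s y) ->
  continuous s -> continuous (basis_coord ip e phi i).
Proof.
move=> cc ipP eP cE sc x; apply/cvgrPdist_lt => r r0.
have nx : \forall y \near x, c y x - s y - s x < r ^+ 2.
  have : (fun y => c y x - s y - s x) @ x --> c x x - s x - s x.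
    apply: cvgB; last exact: cvg_cst.
    by apply: cvgB; [exact: cost_continuous_l|exact: sc].
  rewrite cE subrr normr0 expr0n/= add0r addrK subrr.
  move=> /cvgrPdist_lt/(_ (r ^+ 2)); rewrite exprn_gt0// => /(_ isT).
  by apply: filterS => y; rewrite sub0r normrN; apply: le_lt_trans; exact: ler_norm.
apply: filterS nx => y; rewrite cE => yr.
rewrite distrC /basis_coord -ipBl//.
have := bessel ipP eP (phi y - phi x) i => b.
have : `|ip (phi y - phi x) (e i)| ^+ 2 < r ^+ 2.
  by rewrite real_normK ?num_real//; apply: (le_lt_trans b); lra.
by rewrite ltr_pXn2r// ?nnegrE ?normr_ge0// ltW.
Qed.

Theorem theorem4p11 (R : realType) (X : ptopologicalType) (hX : polish R X)
    (c : X -> X -> R) (c_cont : continuous (fun p : X * X => c p.1 p.2))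
    (c_nd : negative_definite c) (eps : R) (eps_gt0 : 0 < eps) :
  (exists (Z : ptopologicalType) (lambda : probability (borel Z) R)
          (rho : X -> Z -> R),
     polish R Z /\ latent_representation c eps lambda rho)
  /\
  (forall (H : completeNormedModType R) (ip : H -> H -> R)
          (I : countType) (e : I -> H) (phi : X -> H) (s : X -> R),
     inner_product ip -> orthonormal_basis ip e ->
     (forall x y, c x y = `|phi x - phi y| ^+ 2 + s x + s y) ->
     polish R (real_product R I) /\
     exists lambda : probability (borel (real_product R I)) R,
       [/\ standard_gaussian_product lambda,
           forall x, {ae lambda, forall z : real_product R I,
             cvgn (psum (fun i => basis_coord ip e phi i x * z i))},
           latent_representation c eps lambda (gaussian_rho ip e phi s eps)
         & forall x z,
             psi_of eps (gaussian_rho ip e phi s eps) x z =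
             gaussian_psi ip e phi s eps x z]).
Proof.
have diag_cont : continuous (fun x => c x x / 2).
  by move=> x; apply: cvgMl; exact: cost_continuous_diag.
split=> [|H ip I e phi s ipP eP cE].
  have [f [mf f2 cE]] := negative_definite_features hX c_cont c_nd.
  have [lambda [_ lambda_cvg lambda_mgf]] := gaussian_product_exists R nat.
  (* The function [rho] is fixed by unification as the Gaussian one built on the Cholesky
     features. *)
  exists (real_product R nat), lambda; eexists; split.
    exact: polish_real_product.
  apply: (gaussian_latent_representation eps_gt0 mf _ f2 cE lambda_cvg lambda_mgf).
  exact: continuous_borel_measurable.
split; first exact: polish_real_product.
have [lambda [lambda_gauss lambda_cvg lambda_mgf]] := gaussian_product_exists R I.
(* The diagonal of [c] determines [s], which is therefore continuous. *)
have sE : s = fun x => c x x / 2.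
  apply/funext => x; have := cE x x.
  by rewrite subrr normr0 expr0n/= add0r => ->; field.
have sc : continuous s by rewrite sE.
have f2 x : psum (fun i => basis_coord ip e phi i x ^+ 2) @ \oo --> `|phi x| ^+ 2.
  exact: (parseval ipP eP).
have f2c x : cvgn (psum (fun i => basis_coord ip e phi i x ^+ 2)).
  by apply/cvg_ex; exists (`|phi x| ^+ 2); exact: f2.
exists lambda; split => //.
- by move=> x; exact: lambda_cvg _ (f2c x).
- apply: (gaussian_latent_representation eps_gt0 _ _ f2c _ lambda_cvg lambda_mgf).
  + move=> i; apply: continuous_borel_measurable.
    exact: (basis_coord_continuous c_cont ipP eP cE sc).
  + exact: continuous_borel_measurable.
  + move=> x y; rewrite cE; congr (_ + _ + _).
    apply/esym/cvg_lim => //; rewrite (_ : (fun i => _) = fun i => ip (phi x - phi y) (e i) ^+ 2).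
      exact: (parseval ipP eP).
    by apply/funext => i; rewrite /basis_coord (ipBl ipP).
- move=> x z; rewrite /psi_of /gaussian_rho expRK /gaussian_psi.
  have -> : csum (fun i => basis_coord ip e phi i x ^+ 2) = `|phi x| ^+ 2.
    exact: cvg_lim (f2 x).
  have -> : Num.sqrt (2 * eps) = eps * Num.sqrt (2 / eps).
    rewrite (_ : 2 * eps = eps ^+ 2 * (2 / eps)); last by field; rewrite gt_eqF.
    by rewrite sqrtrM ?sqr_ge0// sqrtr_sqr gtr0_norm.
  by field; rewrite gt_eqF.
Qed.
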